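(* Let $\mathcal{C}\subset\mathbb{P}^2$ be a free reduced curve with exponents $d_2,d_3$ (not necessarily ordered), such that $\mathcal{C}=\mathcal{C}'\cup L$ for a line $L\subset\mathbb{P}^2$ with $L\not\subset\mathcal{C}'$. Let $\mathcal{C}''=\mathcal{C}'\cap L$. (1) If $\mathcal{C}'$ is free, then, after possibly interchanging $d_2$ and $d_3$, the exponents of $\mathcal{C}'$ are $(d_2,d_3-1)$ and $|\mathcal{C}''|+\epsilon(\mathcal{C}',L)=d_2+1$. (2) If $\mathcal{C}'$ is plus-one generated, then its exponents are $(d_2,d_3)$ and its level is $d=\deg(\mathcal{C}')-|\mathcal{C}''|-\epsilon(\mathcal{C}',L)$.
   Context: $S=\mathbb{C}[x,y,z]$ with standard grading. A reduced curve $\mathcal{C}\subset\mathbb{P}^2$ is given by a reduced homogeneous $f_{\mathcal{C}}\in S$. A derivation $\theta=\sum f_i\partial_i$ is homogeneous of degree $k$ if all $f_i$ are homogeneous of degree $k$; $\theta_E=x\partial_x+y\partial_y+z\partial_z$. $D(\mathcal{C})=\{\theta\in\mathrm{Der}(S):\theta(f_{\mathcal{C}})\in Sf_{\mathcal{C}}\}$, $D_0(\mathcal{C})=\{\theta:\theta(f_{\mathcal{C}})=0\}$, and $D(\mathcal{C})=D_0(\mathcal{C})\oplus S\theta_E$. $\mathcal{C}$ is free if $D_0(\mathcal{C})$ is a free $S$-module (necessarily of rank 2); its exponents are the degrees of a homogeneous basis of $D_0(\mathcal{C})$ (an unordered pair). $\mathcal{C}$ is plus-one generated if $D(\mathcal{C})$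 has a minimal set of homogeneous generators $\{\theta_E,\theta_2,\theta_3,\psi\}$ with a unique relation $f_1\theta_E+f_2\theta_2+f_3\theta_3+\alpha\psi=0$, $f_i\in S$, $\deg\alpha=1$; exponents $(\deg\theta_2,\deg\theta_3)$, level $\deg\psi$. $\mathcal{E}_{\mathcal{C}}$ is the sheafification of $D_0(\mathcal{C})$ (a rank 2 vector bundle on $\mathbb{P}^2$). $|\mathcal{C}''|$ is the number of distinct points of $\mathcal{C}'\cap L$. For a reduced curve $\mathcal{C}'$ and a line $L\not\subset\mathcal{C}'$, $\epsilon(\mathcal{C}',L)\in\mathbb{Z}$ is the integer defined by A. Dimca, which measures the failure of the singularities of $\mathcal{C}'\cup L$ on $L$ to be quasi-homogeneous (it is $0$ if all these singularities are quasi-homogeneous), and for which there is an exact sequence of vector bundles $0\to\mathcal{E}_{\mathcal{C}'}(-1)\xrightarrow{\alpha_L}\mathcal{E}_{\mathcal{C}'\cup L}\to\mathcal{O}_L(1-|\mathcal{C}'\cap L|-\epsilon(\mathcal{C}',L))\to0$, $\alpha_L$ being a linear form defining $L$. *)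

(* Defs.v *)
From HB Require Import structures.
From mathcomp Require Import all_boot all_algebra.
From mathcomp Require Import complex.
From mathcomp Require Import Rstruct.
From mathcomp Require Export mpoly.
From Stdlib Require Import ClassicalEpsilon.
Set Implicit Arguments. Unset Strict Implicit. Unset Printing Implicit Defensive.
Import GRing.Theory.
Local Open Scope ring_scope.

Definition K : closedFieldType := (Rdefinitions.R)[i].

Notation S := {mpoly K[3]}.

(* A derivation theta = sum_i f_i d_i is represented by its coefficients (f_0,f_1,f_2). *)
Definition der := 'I_3 -> S.

Definition apply_der (th : der) (f : S) : S := \sum_(i < 3) th i * mderiv i f.

Definition hom_der (th : der) (k : nat) : Prop := forall i, th i \is k.-homog.

Definition theta_E : der := fun i => 'X_i.

Definition in_D0 (f : S) (th : der) : Prop := apply_der th f = 0.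
Definition in_D (f : S) (th : der) : Prop := exists g : S, apply_der th f = g * f.

Definition reduced (f : S) : Prop :=
  f != 0 /\ forall g h : S, f = g * g * h -> (msize g <= 1)%N.

Definition free_with_exponents (f : S) (d1 d2 : nat) : Prop :=
  exists th1 th2 : der,
    [/\ hom_der th1 d1 /\ hom_der th2 d2, in_D0 f th1 /\ in_D0 f th2,
        (forall th, in_D0 f th ->
           exists a1 a2 : S, forall i, th i = a1 * th1 i + a2 * th2 i) &
        (forall a1 a2 : S, (forall i, a1 * th1 i + a2 * th2 i = 0) ->
           a1 = 0 /\ a2 = 0)].

Definition pog_gens (th2 th3 psi : der) : 'I_4 -> der :=
  fun j => match val j with 0 => theta_E | 1 => th2 | 2 => th3 | _ => psi end.

Definition lincomb (gens : 'I_4 -> der) (a : 'I_4 -> S) : der :=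
  fun i => \sum_(j < 4) a j * gens j i.

Definition plus_one_generated_data (f : S) (th2 th3 psi : der) (d2 d3 lev : nat)
  : Prop :=
  let gens := pog_gens th2 th3 psi in
  [/\ hom_der th2 d2 /\ hom_der th3 d3 /\ hom_der psi lev,
      (forall j, in_D f (gens j)),
      (forall th, in_D f th -> exists a, forall i, th i = lincomb gens a i),
      (forall j, ~ exists a : 'I_4 -> S, a j = 0 /\
                    forall i, gens j i = lincomb gens a i) &
      exists r : 'I_4 -> S,
        [/\ r (inord 3) != 0, r (inord 3) \is 1.-homog,
            (forall i, lincomb gens r i = 0) &
            (forall s : 'I_4 -> S, (forall i, lincomb gens s i = 0) ->
               exists c : S, forall j, s j = c * r j)]].

Definition pt := 'I_3 -> K.
Definition nonzero_pt (p : pt) : Prop := exists i, p i != 0.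
Definition proportional (p q : pt) : Prop := exists c : K, forall i, p i = c * q i.
Definition common_zero (f g : S) (p : pt) : Prop :=
  [/\ nonzero_pt p, f.@[p] = 0 & g.@[p] = 0].

Definition rep_list (f g : S) (s : seq pt) : Prop :=
  [/\ (forall i : nat, (i < size s)%N -> common_zero f g (nth (fun _ => 0) s i)),
      (forall i j : nat, (i < size s)%N -> (j < size s)%N -> i <> j ->
          ~ proportional (nth (fun _ => 0) s i) (nth (fun _ => 0) s j)) &
      (forall p, common_zero f g p ->
          exists2 i : nat, (i < size s)%N & proportional p (nth (fun _ => 0) s i))].

Definition reps (f g : S) : seq pt :=
  match excluded_middle_informative (exists s, rep_list f g s) with
  | left H => proj1_sig (constructive_indefinite_description _ H)
  | right _ => [::]
  end.

Definition npts (f g : S) : nat := size (reps f g).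

Definition in_ideal (gs : seq S) (r : S) : Prop :=
  exists cs : seq S, r = \sum_(i < size gs) cs`_i * gs`_i.

(* there are n polynomials whose images in O_q / I O_q (O_q = local ring of
   C^3 at q, I = (gs)) are C-linearly independent *)
Definition loc_indep (gs : seq S) (q : pt) (n : nat) : Prop :=
  exists qs : 'I_n -> S, forall c : 'I_n -> K,
    (exists h : S, h.@[q] != 0 /\ in_ideal gs (h * \sum_(i < n) c i *: qs i)) ->
    forall i, c i = 0.

(* maximal n such that P n (P is downward closed); 0 if unbounded *)
Definition maxsat (P : nat -> Prop) : nat :=
  let b := fun n => if excluded_middle_informative (~ P n.+1) then true else false in
  match excluded_middle_informative (exists n, b n) with
  | left H => ex_minn H
  | right _ => 0%N
  end.

(* dim_C O_q / (gs) O_q *)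
Definition loc_len (gs : seq S) (q : pt) : nat := maxsat (loc_indep gs q).

Definition chart (p : pt) : 'I_3 :=
  if p (inord 2) != 0 then inord 2 else if p (inord 1) != 0 then inord 1 else inord 0.
Definition normalize (p : pt) : pt := fun i => p i / p (chart p).

Definition chart_partials (F : S) (p : pt) : seq S :=
  [seq mderiv i F | i <- enum 'I_3 & i != chart p].

(* Milnor and Tjurina numbers of the plane curve germ (F = 0, p), computed in the
   affine chart X_k = 1 (k = chart p), realised as the plane X_k - 1 = 0 in C^3 *)
Definition milnor (F : S) (p : pt) : nat :=
  loc_len ('X_(chart p) - 1 :: chart_partials F p) (normalize p).
Definition tjurina (F : S) (p : pt) : nat :=
  loc_len (F :: 'X_(chart p) - 1 :: chart_partials F p) (normalize p).

(* Dimca's epsilon(C', L) = sum_{p in C' \cap L} ((mu - tau)(C,p) - (mu - tau)(C',p)),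
   C = C' \cup L given by f' * alpha *)
Definition eps_pt (f' alpha : S) (p : pt) : int :=
  ((milnor (f' * alpha) p)%:Z - (tjurina (f' * alpha) p)%:Z)
  - ((milnor f' p)%:Z - (tjurina f' p)%:Z).
Definition eps (f' alpha : S) : int := \sum_(p <- reps f' alpha) eps_pt f' alpha p.

Definition unord_eq (a b c d : int) : Prop := (a = c /\ b = d) \/ (a = d /\ b = c).

(* Submission.v *)
(* Let [L] be the line [alpha = 0], [F = f' * alpha], and let [th1], [th2] be a basis of
   [D_0(F)].  On [L], [th_i] is tangent to [L]; let the binary form [p_i] measure how far it
   is from being proportional to the Euler field [E], and write [p_i = s_i H] with
   [H = gcd(p_1, p_2)].  Then [s_2 th1 - s_1 th2] is proportional to [E] on [L], so that it
   equals [g E + alpha eta] with [eta] in [D(f')] of degree [n' - deg H].  The fields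
   [E], [th1], [th2], [eta] generate [D(f')], with the single relation
   [(g, - s_2, s_1, alpha)].  By Saito's criterion, [th1 x th2] is a constant multiple of
   the gradient of [F]; this gives [d2 + d3 = n'] and shows that [H * eta(alpha)] is a
   constant multiple of [f'] on [L].  If some [s_i] is a nonzero constant, [th_i] and
   [eta] are free generators modulo [E]; otherwise the three generators are minimal.  In
   both cases the degrees of any other homogeneous generators follow by comparing the two
   transition matrices at the origin.

   It remains to see that [|C''| + eps = deg H].  At a point [p] of [C'] on [L], let [i] be
   the intersection multiplicity and [l] the order of [eta(alpha)|_L]; the orders [i] add
   up to [n'] and the orders [l] to [n' - deg H].  In local coordinates with
   [L = {y = 0}] and [C' = {f = 0}], colon ideals give
   [tau(yf) = tau(f) + i + l] and reduce [mu(yf) = mu(f) + 2i - 1] to the equality of the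
   lengths of [(f_x, f + y f_y)] and [(f_x, y f_y)].  By additivity it suffices to compare
   [f + y f_y] and [y f_y] modulo the irreducible factors [h] of [f_x].  In every discrete
   valuation ring of the function field of [h] above [p], [y f_y / f] is the quotient of
   the logarithmic derivatives of [f] and [y], hence has a positive rational residue;
   so [y f_y / f] and [1 + y f_y / f] are units of the integral closure of the local ring
   of [h], and multiplication by such a unit does not change colengths. *)
From HB Require Import structures.
Require Import Defs.
From mathcomp Require Import all_boot all_algebra all_field.
From mathcomp Require Import fingroup perm.
From mathcomp Require Import complex Rstruct.
From mathcomp Require Import ring zify.
From Stdlib Require Import ClassicalEpsilon Classical FunctionalExtensionality.
Set Implicit Arguments. Unset Strict Implicit. Unset Printing Implicit Defensive.
Import GRing.Theory.
Local Open Scope ring_scope.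

(** The residue is a quotient of orders. On a branch of [h = 0] through p with uniformizer t, let f
    and y have orders r and e, both positive. As f_x vanishes along h, df = f_y dy there, so y f_y /
    f is congruent to r/e modulo t; in characteristic 0 neither r/e nor 1 + r/e vanishes. Branches
    are not parametrized: derivatives in t are taken of polynomial truncations whose precision
    outlasts the division by a partial derivative. The integral closure of the local ring A of h
    enters as the intersection of the valuation rings that dominate A. It may be large, but any
    finitely many of its elements lie in an overring W with a common denominator c, that is cW
    inside A. Then W / A has finite dimension, A / aA and W / aW have equal dimension, and a unit of
    W preserves colengths. In the graded part, coordinates are chosen such that the point at
    infinity of the line lies neither on f nor on the nonzero forms p_i: restrictions to the line
    become one-variable polynomials of full degree, and dehomogenizing loses no root. *)

Lemma fun_choice (A B : Type) (P : A -> B -> Prop) :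
  (forall x, exists y, P x y) -> exists f, forall x, P x (f x).
Proof.
move=> h; exists (fun x => proj1_sig (constructive_indefinite_description _ (h x))).
by move=> x; apply: proj2_sig.
Qed.

Lemma nat_max (P : nat -> Prop) (N : nat) :
  P 0%N -> (forall m, P m -> (m <= N)%N) -> exists2 m, P m & ~ P m.+1.
Proof.
move=> P0 PN; apply: NNPP => h.
have Pall m : P m by elim: m => // m ih; apply: NNPP => hm; apply: h; exists m.
by have := PN _ (Pall N.+1); rewrite ltnn.
Qed.

Lemma nat_min (P : nat -> Prop) : (exists n, P n) -> exists2 n, P n & forall m, (m < n)%N -> ~ P m.
Proof.
case=> n; elim/ltn_ind: n => n ih Pn.
case: (classic (exists2 m, (m < n)%N & P m)) => [[m mn Pm]|h]; first exact: ih Pm.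
by exists n => // m mn Pm; apply: h; exists m.
Qed.

(** * Dimensions of quotients of subspaces *)

Section QDim.
Variables (K : fieldType) (R : comNzRingType) (io : {rmorphism K -> R}).
Implicit Types (U V W : R -> Prop).

Definition subsp V :=
  [/\ V 0, forall x y, V x -> V y -> V (x + y) & forall c x, V x -> V (io c * x)].

Definition comb n (c : 'I_n -> K) (b : 'I_n -> R) := \sum_i io (c i) * b i.

Definition indep V W n (b : 'I_n -> R) :=
  (forall i, V (b i)) /\ (forall c, W (comb c b) -> forall i, c i = 0).

Definition spans V W n (b : 'I_n -> R) :=
  forall v, V v -> exists c, W (v - comb c b).

(** [qdim V W n] : the quotient V / W has dimension n over K. *)
Definition qdim V W n := exists2 b, @indep V W n b & @spans V W n b.

Lemma subspN V x : subsp V -> V x -> V (- x).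
Proof. by case=> _ _ h vx; have := h (-1) x vx; rewrite rmorphN1 mulN1r. Qed.

Lemma subspB V x y : subsp V -> V x -> V y -> V (x - y).
Proof. by move=> sV vx vy; case: (sV) => _ h _; apply: h => //; apply: subspN. Qed.

Lemma subsp_sum V (I : Type) (r : seq I) (F : I -> R) :
  subsp V -> (forall i, V (F i)) -> V (\sum_(i <- r) F i).
Proof. by case=> h0 hD _ hF; apply: big_ind. Qed.

Lemma subsp_comb V n (c : 'I_n -> K) b : subsp V -> (forall i, V (b i)) -> V (comb c b).
Proof. by move=> sV hb; apply: subsp_sum => // i; case: sV => _ _; apply. Qed.

Lemma combZ n a (c : 'I_n -> K) b : comb (fun i => a * c i) b = io a * comb c b.
Proof. by rewrite /comb mulr_sumr; apply: eq_bigr => i _; rewrite rmorphM mulrA. Qed.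

Lemma qdim_ext V V' W W' n :
  (forall x, V x <-> V' x) -> (forall x, W x <-> W' x) -> qdim V W n -> qdim V' W' n.
Proof.
move=> hV hW [b [ib1 ib2] sb]; exists b.
  by split=> [i|c /hW]; [apply/hV | apply: ib2].
by move=> v /hV /sb [c /hW]; exists c.
Qed.

(** With m > n, the matrix of coefficients of [d] over [b] has a nonzero left kernel vector, which
    is a relation of [d] modulo [W]. *)
Lemma indep_le V W n m (b : 'I_n -> R) (d : 'I_m -> R) :
  subsp W -> spans V W b -> indep V W d -> (m <= n)%N.
Proof.
move=> sW sb [hd id]; rewrite leqNgt; apply/negP => nm.
have [c hc] := fun_choice (fun j => sb _ (hd j)).
pose M := \matrix_(j < m, i < n) c j i.
have : kermx M != 0.
  rewrite kermx_eq0 /row_free; apply: contraTneq nm => <-.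
  by rewrite -leqNgt rank_leq_col.
case/rowV0Pn => u /sub_kermxP uM unz.
have : W (comb (u 0) d).
  have -> : comb (u 0) d = \sum_j io (u 0 j) * (d j - comb (c j) b).
    have: comb (fun i => (u *m M) 0 i) b = 0.
      by rewrite uM /comb big1 // => i _; rewrite mxE rmorph0 mul0r.
    have -> : comb (fun i => (u *m M) 0 i) b = \sum_j io (u 0 j) * comb (c j) b.
      rewrite /comb; under [RHS]eq_bigr => j _ do rewrite mulr_sumr.
      rewrite exchange_big /=; apply: eq_bigr => i _.
      rewrite mxE rmorph_sum mulr_suml; apply: eq_bigr => j _.
      by rewrite mxE rmorphM mulrA.
    move=> e; rewrite -[LHS]subr0 -[in LHS]e /comb -sumrB.
    by apply: eq_bigr => j _; rewrite mulrBr.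
  by apply: subsp_sum => // j; case: sW => _ _; apply.
move/id => h; case/negP: unz; apply/eqP/rowP => j; rewrite h mxE //.
Qed.

Lemma qdim_uniq V W n m : subsp W -> qdim V W n -> qdim V W m -> n = m.
Proof.
move=> sW [b ib sb] [d id sd]; apply/eqP; rewrite eqn_leq.
by rewrite (indep_le sW sd ib) (indep_le sW sb id).
Qed.

Lemma indep_extend V W n (b : 'I_n -> R) v : subsp V -> subsp W ->
  indep V W b -> V v -> (exists c, W (v - comb c b)) \/
  indep V W (fun i : 'I_n.+1 => if unlift ord0 i is Some j then b j else v).
Proof.
move=> sV sW [hb ib] hv.
case: (classic (exists c, W (v - comb c b))) => h; first by left.
right; split=> [i|c]; first by case: unliftP.
rewrite /comb big_ord_recl unlift_none.
under eq_bigr => i _ do rewrite liftK.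
rewrite -/(comb (fun i => c (lift ord0 i)) b) => hW.
have c0 : c ord0 = 0.
  apply/eqP; apply/negPn; apply/negP => c0; apply: h.
  exists (fun i => - (c ord0)^-1 * c (lift ord0 i)).
  rewrite combZ rmorphN mulNr opprK.
  have -> : v = io (c ord0)^-1 * (io (c ord0) * v).
    by rewrite mulrA -rmorphM mulVf // rmorph1 mul1r.
  by rewrite -mulrDr; case: sW => _ _; apply.
move: hW; rewrite c0 rmorph0 mul0r add0r => /ib h1 i.
by case: (unliftP ord0 i) => [j|] ->.
Qed.

Lemma qdim_exists V W N : subsp V -> subsp W ->
  (forall m b, @indep V W m b -> (m <= N)%N) -> exists2 n, qdim V W n & (n <= N)%N.
Proof.
move=> sV sW hN.
have [||m [b ib] hm] := @nat_max (fun m => exists b, @indep V W m b) N.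
- by exists (fun=> 0); split=> [i|c _ i]; case: i.
- by move=> m [b /hN].
exists m; last exact: hN ib.
exists b => // v hv; case: (indep_extend sV sW ib hv) => // h.
by case: hm; eexists; apply: h.
Qed.

Lemma indep_spans V W n (b : 'I_n -> R) : subsp V -> subsp W ->
  qdim V W n -> indep V W b -> spans V W b.
Proof.
move=> sV sW [d id sd] ib v hv.
case: (indep_extend sV sW ib hv) => // /(indep_le sW sd).
by rewrite ltnn.
Qed.

Lemma qdim_add U V W a b : subsp W -> (forall x, V x -> U x) -> (forall x, W x -> V x) ->
  subsp V -> qdim U V a -> qdim V W b -> qdim U W (a + b).
Proof.
move=> sW VU WV sV [x [hx ix] sx] [y [hy iy] sy].
pose z (i : 'I_(a + b)) := match split i with inl j => x j | inr j => y j end.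
have combz c : comb c z = comb (fun j => c (lshift b j)) x + comb (fun j => c (rshift a j)) y.
  rewrite /comb big_split_ord /=; congr (_ + _); apply: eq_bigr => j _.
    by rewrite /z (unsplitK (inl j)).
  by rewrite /z (unsplitK (inr j)).
exists z.
  split=> [i|c]; first by rewrite /z; case: split => j //; apply: VU.
  rewrite combz => hW.
  have h1 : forall j, c (lshift b j) = 0.
    apply: ix; have := subspB sV (WV _ hW) (subsp_comb (fun j => c (rshift a j)) sV hy).
    by rewrite addrK.
  have h2 : forall j, c (rshift a j) = 0.
    apply: iy; move: hW; rewrite /comb big1 ?add0r // => j _.
    by rewrite h1 rmorph0 mul0r.
  by move=> i; case: (split_ordP i) => j ->.
move=> v /sx [c /sy [d h]].
exists (fun i => match split i with inl j => c j | inr j => d j end).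
rewrite combz.
have -> : comb (fun j => match split (lshift b j) with inl j0 => c j0 | inr j0 => d j0 end) x = comb c x.
  by apply: eq_bigr => j _; rewrite (unsplitK (inl j)).
have -> : comb (fun j => match split (rshift a j) with inl j0 => c j0 | inr j0 => d j0 end) y = comb d y.
  by apply: eq_bigr => j _; rewrite (unsplitK (inr j)).
by rewrite opprD addrA.
Qed.

Lemma qdim_split U V W n : subsp U -> subsp V -> subsp W ->
  (forall x, V x -> U x) -> (forall x, W x -> V x) -> qdim U W n ->
  exists a b, [/\ qdim U V a, qdim V W b & n = (a + b)%N].
Proof.
move=> sU sV sW VU WV dn; case: (dn) => b ib sb.
have [|||a da _] := @qdim_exists U V n.
- by [].
- by [].
- move=> m d [hd id]; apply: (indep_le sW sb (d := d)); split=> // c /WV; exact: id.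
have [|||k dk _] := @qdim_exists V W n.
- by [].
- by [].
- move=> m d [hd id]; apply: (indep_le sW sb (d := d)); split=> // i; exact: VU.
exists a, k; split=> //; apply: (qdim_uniq sW dn); exact: (qdim_add sW VU WV sV da dk).
Qed.

Lemma qdim0P V W : subsp W -> (qdim V W 0 <-> forall x, V x -> W x).
Proof.
move=> sW; split=> [[b _ sb] x /sb [c]|h]; first by rewrite /comb big_ord0 subr0.
exists (fun=> 0) => [|v hv]; first by split=> [i|c _ i]; case: i.
by exists (fun=> 0); rewrite /comb big_ord0 subr0; apply: h.
Qed.

(** An injective endomorphism of the finite-dimensional quotient [V / W] is surjective. This is how
    multiplication operators are inverted later. *)
Lemma qdim_inj_surj V W n (f : R -> R) : subsp V -> subsp W -> qdim V W n ->
  {morph f : x y / x + y} -> (forall c x, f (io c * x) = io c * f x) ->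
  (forall x, V x -> V (f x)) -> (forall x, W x -> W (f x)) ->
  (forall x, V x -> W (f x) -> W x) ->
  forall v, V v -> exists2 v', V v' & W (v - f v').
Proof.
move=> sV sW dn fD fZ fV fW fi v hv; case: (dn) => b [hb ib] sb.
have f0 : f 0 = 0 by rewrite -[X in f X](mul0r 0) -(rmorph0 io) fZ rmorph0 mul0r.
have fcomb m (c : 'I_m -> K) d : comb c (fun i => f (d i)) = f (comb c d).
  rewrite /comb (big_morph f fD f0); apply: eq_bigr => i _; by rewrite fZ.
have : indep V W (fun i => f (b i)).
  split=> [i|c]; first exact/fV.
  by rewrite fcomb => h; apply: ib; apply: fi h; apply: subsp_comb.
move/(indep_spans sV sW dn)/(_ v hv) => [c]; rewrite fcomb => h.
by exists (comb c b) => //; apply: subsp_comb.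
Qed.

End QDim.

Section QDimMap.
Variables (K : fieldType) (R R' : comNzRingType).
Variables (io : {rmorphism K -> R}) (io' : {rmorphism K -> R'}) (f : R -> R').
Hypothesis fD : {morph f : x y / x + y}.
Hypothesis fZ : forall c x, f (io c * x) = io' c * f x.

Lemma map_comb n (c : 'I_n -> K) d : comb io' c (fun i => f (d i)) = f (comb io c d).
Proof.
have f0 : f 0 = 0 by rewrite -[X in f X](mul0r 0) -(rmorph0 io) fZ rmorph0 mul0r.
by rewrite /comb (big_morph f fD f0); apply: eq_bigr => i _; rewrite fZ.
Qed.

Lemma qdim_map (V W : R -> Prop) (V' W' : R' -> Prop) n :
  subsp io V -> subsp io' W' ->
  (forall v, V v -> V' (f v)) ->
  (forall v', V' v' -> exists2 v, V v & W' (v' - f v)) ->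
  (forall v, V v -> (W' (f v) <-> W v)) ->
  qdim io V W n -> qdim io' V' W' n.
Proof.
move=> sV sW' fV fs fW [b [hb ib] sb].
exists (fun i => f (b i)).
  split=> [i|c]; first exact/fV.
  by rewrite map_comb => h; apply: ib; apply/fW => //; apply: subsp_comb.
move=> v' /fs [v hv hv'].
have [c hc] := sb v hv; exists c; rewrite map_comb.
have : W' (f (v - comb io c b)).
  by apply/fW => //; apply: (subspB (io := io)) => //; apply: (subsp_comb (io := io)).
have fN x : f (- x) = - f x by rewrite -mulN1r -(rmorphN1 io) fZ rmorphN1 mulN1r.
rewrite fD fN => h.
by case: sW' => _ h' _; have := h' _ _ hv' h; rewrite addrA subrK.
Qed.

(** Here the source is not known to be finite-dimensional: images of independent families bound it
    first, then uniqueness of the dimension applies. *)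
Lemma qdim_map_inv (V W : R -> Prop) (V' W' : R' -> Prop) n :
  subsp io V -> subsp io W -> subsp io' W' ->
  (forall v, V v -> V' (f v)) ->
  (forall v', V' v' -> exists2 v, V v & W' (v' - f v)) ->
  (forall v, V v -> (W' (f v) <-> W v)) ->
  qdim io' V' W' n -> qdim io V W n.
Proof.
move=> sV sW sW' fV fs fW dn.
have [m dm _] : exists2 m, qdim io V W m & (m <= n)%N.
  apply: qdim_exists => // m b [hb ib]; case: dn => b' _ sb'.
  apply: (indep_le sW' sb' (d := fun i => f (b i))).
  split=> [i|c]; first exact: fV.
  by rewrite map_comb => h; apply: ib; apply/fW => //; apply: subsp_comb.
by rewrite (qdim_uniq sW' dn (qdim_map sV sW' fV fs fW dm)).
Qed.

End QDimMap.

(** * Discrete valuation rings and the integral closure of a local ring of a curve *)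

Section EvalTwo.
Variables (K A : comNzRingType) (j : {rmorphism K -> A}).

Definition ev1 (y : A) (p : {poly K}) : A := (map_poly j p).[y].

Lemma ev1D y p q : ev1 y (p + q) = ev1 y p + ev1 y q.
Proof. by rewrite /ev1 rmorphD hornerD. Qed.
Lemma ev1M y p q : ev1 y (p * q) = ev1 y p * ev1 y q.
Proof. by rewrite /ev1 rmorphM hornerM. Qed.
Lemma ev1C y c : ev1 y c%:P = j c.
Proof. by rewrite /ev1 map_polyC hornerC. Qed.
Lemma ev1X y : ev1 y 'X = y.
Proof. by rewrite /ev1 map_polyX hornerX. Qed.
Lemma ev1N y p : ev1 y (- p) = - ev1 y p.
Proof. by rewrite /ev1 rmorphN hornerN. Qed.
Lemma ev1Xn y n : ev1 y 'X^n = y ^+ n.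
Proof. by rewrite /ev1 map_polyXn hornerXn. Qed.
Lemma ev1Mn y p n : ev1 y (p *+ n) = n%:R * ev1 y p.
Proof. by rewrite /ev1 rmorphMn hornerMn mulr_natl. Qed.
Lemma ev10 y : ev1 y 0 = 0.
Proof. by rewrite /ev1 rmorph0 horner0. Qed.

Lemma ev1_is_zmod y : zmod_morphism (ev1 y).
Proof. by move=> p q; rewrite ev1D ev1N. Qed.
Lemma ev1_is_monoid y : monoid_morphism (ev1 y).
Proof. by split=> [|p q]; rewrite ?ev1M // ev1C rmorph1. Qed.
HB.instance Definition _ y := GRing.isZmodMorphism.Build {poly K} A (ev1 y) (ev1_is_zmod y).
HB.instance Definition _ y := GRing.isMonoidMorphism.Build {poly K} A (ev1 y) (ev1_is_monoid y).

(** The value at X = u, Y = y of a polynomial in X with coefficients in K[Y]. *)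
Definition ev2 (P : {poly {poly K}}) (u y : A) : A := (map_poly (ev1 y) P).[u].

Lemma ev20 u y : ev2 0 u y = 0.
Proof. by rewrite /ev2 rmorph0 horner0. Qed.
Lemma ev2_cons P c u y : ev2 (P * 'X + c%:P) u y = ev2 P u y * u + ev1 y c.
Proof. by rewrite /ev2 rmorphD rmorphM /= map_polyX map_polyC !hornerE. Qed.

(** The chain rule for an arbitrary derivation killing constants; it serves both for d/dt on
    polynomials and for the derivation [pbr h] along a curve. *)
Lemma ev2_deriv (d : A -> A) P u y :
  (forall a b, d (a + b) = d a + d b) -> (forall a b, d (a * b) = d a * b + a * d b) ->
  (forall c, d (j c) = 0) ->
  d (ev2 P u y) = ev2 P^`() u y * d u + ev2 (map_poly deriv P) u y * d y.
Proof.
move=> dD dM dC; have d0 : d 0 = 0 by rewrite -[X in d X](rmorph0 j) dC.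
have d1 p : d (ev1 y p) = ev1 y p^`() * d y.
  elim/poly_ind: p => [|p c ih]; first by rewrite deriv0 ev10 d0 mul0r.
  rewrite derivD derivM derivX derivC mulr1 addr0 !ev1D !ev1M ev1X ev1C dD dM ih dC; ring.
elim/poly_ind: P => [|P c ih].
  by rewrite deriv0 map_poly0 !ev20 d0 !mul0r addr0.
rewrite ev2_cons dD dM ih d1 derivMXaddC.
have -> : map_poly deriv (P * 'X + c%:P) = map_poly deriv P * 'X + (c^`())%:P.
  apply/polyP => i; rewrite coef_map_id0 ?deriv0 // !coefD !coefMX !coefC coef_map_id0 ?deriv0 //.
  by case: i => [|i] /=; rewrite ?coef_map_id0 ?deriv0 ?add0r ?addr0 ?derivD ?deriv0 ?add0r ?addr0.
have -> : P + P^`() * 'X = P^`() * 'X + 0%:P + P by rewrite addr0 addrC.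
have e2D : forall F G, ev2 (F + G) u y = ev2 F u y + ev2 G u y.
  by move=> F G; rewrite /ev2 rmorphD hornerD.
rewrite e2D !ev2_cons ev10; ring.
Qed.
End EvalTwo.

Section DVR.
Variables (K Q : fieldType) (io : {rmorphism K -> Q}).
Hypothesis char0 : forall n, n.+1%:R != 0 :> K.
Notation e1 := (ev1 io).
Notation e2 := (ev2 io).

Record subring (O : Q -> Prop) : Prop := {
  srC : forall c, O (io c);
  srD : forall x y, O x -> O y -> O (x + y);
  srM : forall x y, O x -> O y -> O (x * y) }.

(** The axioms are those that localization at a maximal ideal delivers directly: residue field [K],
    inverses outside [tO], and no nonzero element divisible by all powers of [t]. Orders are derived
    in [dvr_ord]. *)
Record dvr (O : Q -> Prop) (t : Q) : Prop := {
  dvr_sr : subring O;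
  dvr_t : O t;
  dvr_tV : ~ O t^-1;
  dvr_res : forall z, O z -> exists c z', O z' /\ z = io c + t * z';
  dvr_inv : forall z, O z -> (forall z', O z' -> z <> t * z') -> O z^-1;
  dvr_sep : forall z, O z -> z <> 0 -> exists k, forall z', O z' -> z <> t ^+ k * z' }.

Lemma srN O x : subring O -> O x -> O (- x).
Proof. by move=> sO ox; rewrite -mulN1r -(rmorphN1 io); apply: srM => //; apply: srC. Qed.
Lemma srB O x y : subring O -> O x -> O y -> O (x - y).
Proof. by move=> sO ox oy; apply: srD => //; apply: srN. Qed.
Lemma sr1 O : subring O -> O 1.
Proof. by move=> sO; rewrite -(rmorph1 io); apply: srC. Qed.
Lemma sr0 O : subring O -> O 0.
Proof. by move=> sO; rewrite -(rmorph0 io); apply: srC. Qed.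
Lemma srX O x n : subring O -> O x -> O (x ^+ n).
Proof.
by move=> sO ox; elim: n => [|n ih]; rewrite ?expr0 ?exprS; [apply: sr1|apply: srM].
Qed.
Lemma srnat O n : subring O -> O n%:R.
Proof. by move=> sO; rewrite -(rmorph_nat io); apply: srC. Qed.
Lemma sr_ev1 O y p : subring O -> O y -> O (e1 y p).
Proof.
move=> sO oy; elim/poly_ind: p => [|p c ih]; first by rewrite ev10; apply: sr0.
rewrite ev1D ev1M ev1X ev1C; apply: srD => //; last exact: srC.
exact: srM.
Qed.
Lemma sr_ev2 O P u y : subring O -> O u -> O y -> O (e2 P u y).
Proof.
move=> sO ou oy; elim/poly_ind: P => [|P c ih]; first by rewrite ev20; apply: sr0.
rewrite ev2_cons; apply: srD => //; last exact: sr_ev1.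
exact: srM.
Qed.

Lemma ev2_congr O P u y s u1 y1 : subring O -> O u -> O y -> O s -> O u1 -> O y1 ->
  exists2 w, O w & e2 P (u + s * u1) (y + s * y1) = e2 P u y + s * w.
Proof.
move=> sO ou oy os ou1 oy1.
have h1 p : exists2 w, O w & e1 (y + s * y1) p = e1 y p + s * w.
  elim/poly_ind: p => [|p c [w ow e]].
    by exists 0; rewrite ?ev10 ?mulr0 ?addr0 //; apply: sr0.
  exists (w * (y + s * y1) + e1 y p * y1).
    apply: srD => //; apply: srM => //; last exact: sr_ev1.
    by apply: srD => //; apply: srM.
  by rewrite !ev1D !ev1M !ev1X !ev1C e; ring.
elim/poly_ind: P => [|P c [w ow e]].
  by exists 0; rewrite ?ev20 ?mulr0 ?addr0 //; apply: sr0.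
have [v ov e'] := h1 c.
exists (w * (u + s * u1) + e2 P u y * u1 + v).
  apply: srD => //; apply: srD => //; apply: srM => //; last exact: sr_ev2.
  by apply: srD => //; apply: srM.
by rewrite !ev2_cons e e'; ring.
Qed.

Section Fix.
Variables (O : Q -> Prop) (t : Q).
Hypothesis dO : dvr O t.
Let sO := dvr_sr dO.
Let Ot := dvr_t dO.

Lemma dvr_t0 : t != 0.
Proof. by apply/eqP => t0; apply: (dvr_tV dO); rewrite t0 invr0; apply: sr0. Qed.

Lemma dvr_unit c w : O w -> c != 0 -> io c + t * w != 0 /\ O (io c + t * w)^-1.
Proof.
move=> ow c0.
have key z' : O z' -> io c + t * w <> t * z'.
  move=> oz e; apply: (dvr_tV dO).
  have -> : t^-1 = (z' - w) * io c^-1.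
    rewrite fmorphV; have ec : io c = t * (z' - w) by rewrite mulrBr -e addrK.
    rewrite ec invfM mulrCA mulfV ?mulr1 //.
    by apply: contra_neq c0 => e0; apply/eqP; rewrite -(fmorph_eq0 io) ec e0 mulr0.
  by apply: srM => //; [apply: srB | apply: srC].
split; first by apply/eqP => e; apply: (key 0); [apply: sr0 | rewrite mulr0].
apply: (dvr_inv dO) => //; apply: srD => //; [exact: srC | exact: srM].
Qed.

Lemma dvr_ord z : O z -> z != 0 -> exists r c w, [/\ O w, c != 0 & z = t ^+ r * (io c + t * w)].
Proof.
move=> oz /eqP nz.
have [k kP kmin] := nat_min (dvr_sep dO oz nz).
case: k kP kmin => [|r] kP kmin.
  by case: (kP z) => //; rewrite expr0 mul1r.
have [z' e] : exists z', O z' /\ z = t ^+ r * z'.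
  apply: NNPP => h; apply: (kmin r) => // z' oz' e; apply: h; by exists z'.
case: e => oz' e; have [c [w [ow ez]]] := dvr_res dO oz'.
exists r, c, w; split=> //; last by rewrite e ez.
apply/eqP => c0; apply: (kP w) => //.
by rewrite e ez c0 rmorph0 add0r mulrA exprSr.
Qed.

(** A truncated t-adic expansion: polynomials in [t] can be differentiated, whereas [O] carries no
    derivation. *)
Lemma dvr_expand k z : O z -> exists U z', O z' /\ z = e1 t U + t ^+ k * z'.
Proof.
move=> oz; elim: k => [|k [U [z' [oz' e]]]].
  by exists 0, z; rewrite ev10 add0r expr0 mul1r.
have [c [w [ow ez]]] := dvr_res dO oz'.
exists (U + c%:P * 'X^k), w; split=> //.
by rewrite ev1D ev1M ev1C ev1Xn e ez exprSr; ring.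
Qed.

(** A nonzero constant term makes the value a unit, so each factor [t] of the value comes from a
    factor ['X] of [F]. *)
Lemma dvr_ordK F k z : O z -> e1 t F = t ^+ k * z -> exists G, F = 'X^k * G.
Proof.
move=> oz; elim: k F => [|k ih] F e; first by exists F; rewrite expr0 mul1r.
have [G [c eF]] : exists G c, F = 'X * G + c%:P.
  by elim/poly_ind: F {e} => [|G c _]; [exists 0, 0|exists G, c]; rewrite ?mulr0 ?addr0 // mulrC.
have c0 : c = 0.
  apply/eqP; apply/negPn; apply/negP => c0.
  have [h _] := dvr_unit (w := e1 t G - t ^+ k * z)
    (srB sO (sr_ev1 G sO Ot) (srM sO (srX k sO Ot) oz)) c0.
  case/negP: h; apply/eqP; move: e; rewrite eF ev1D ev1M ev1X ev1C exprS => e.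
  by rewrite mulrBr addrA mulrA -e; ring.
move: e; rewrite eF c0 addr0 ev1M ev1X exprS -mulrA => /(mulfI dvr_t0) /ih [G' ->].
by exists G'; rewrite mulrA exprS.
Qed.

(** [u'] is du/dy, given by implicit differentiation of P(u, y) = 0. If [u] and [y] have orders r
    and e, the logarithmic derivatives of both in t begin with r and e, so [c] is r/e. *)
Lemma dvr_log_deriv P u y u' :
  O u -> O y -> u != 0 -> y != 0 -> (exists2 w, O w & u = t * w) -> (exists2 w, O w & y = t * w) ->
  e2 P u y = 0 -> e2 P^`() u y != 0 ->
  e2 P^`() u y * u' + e2 (map_poly deriv P) u y = 0 ->
  exists c w, [/\ O w, c != 0, 1 + c != 0 & y * u' / u = io c + t * w].
Proof.
move=> ou oy u0 y0 [u1 ou1 eu1] [y1 oy1 ey1] P0 PX0 PD.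
have [r [cu [wu [owu cu0 eu]]]] := dvr_ord ou u0.
have [e [cy [wy [owy cy0 ey]]]] := dvr_ord oy y0.
have opx : O (e2 P^`() u y) by apply: sr_ev2.
have [rho [cp [wp [owp cp0 ep]]]] := dvr_ord opx PX0.
have pos x s c w x1 : O w -> O x1 -> c != 0 -> x = t * x1 -> x = t ^+ s * (io c + t * w) ->
    exists s', s = s'.+1.
  case: s => [|s] ow ox1 c0 e' e''; last by exists s.
  have [_] := dvr_unit (w := w - x1) (srB sO ow ox1) c0.
  have [+ _] := dvr_unit (w := w - x1) (srB sO ow ox1) c0.
  case/negP; apply/eqP; move: e''; rewrite e' expr0 mul1r => e''.
  by rewrite mulrBr addrA -e'' subrr.
have [r' er] := pos _ _ _ _ _ owu ou1 cu0 eu1 eu.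
have [e' ee] := pos _ _ _ _ _ owy oy1 cy0 ey1 ey.
(* Differentiation costs one order and division by the X-derivative of [P] costs [rho]; the
   remaining precision r + e is what the comparison of [u] and [y] needs. *)
pose k := (rho + r + e).+1.
have expand x s c w : O w -> x = t ^+ s * (io c + t * w) -> (s <= k)%N ->
   exists U b a, [/\ O b, O a, x = e1 t U + t ^+ k * b & t * e1 t U^`() = s%:R * x + t ^+ s.+1 * a].
  move=> ow ex sk; have [W [w' [ow' eW]]] := dvr_expand k ow.
  exists ('X^s * (c%:P + 'X * W)), (t ^+ s.+1 * w').
  exists (e1 t W + t * e1 t W^`() - t ^+ k * s%:R * w').
  split.
  - by apply: srM => //; apply: srX.
  - apply: srB => //; last first.
      by do 2![apply: srM => //]; [apply: srX|apply: srnat].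
    apply: srD => //; first exact: sr_ev1.
    by apply: srM => //; apply: sr_ev1.
  - by rewrite ex eW !(ev1M, ev1D, ev1C, ev1X, ev1Xn) exprS; ring.
  rewrite ex eW derivM derivD derivM derivC derivX derivXn.
  rewrite !(ev1M, ev1D, ev1C, ev1X, ev1Xn); rewrite ev1Mn ev1Xn rmorph0 rmorph1.
  by case: (s) => [|s']; rewrite /= ?mul0r ?add0r !exprS; ring.
have rk : (r < k)%N by rewrite /k ltnS; lia.
have [U [bu [au [obu oau eU eU']]]] := expand u r cu wu owu eu ltac:(rewrite /k; lia).
have [Y [vy [ay [ovy oay eY eY']]]] := expand y e cy wy owy ey ltac:(rewrite /k; lia).
pose F := ev2 polyC P U Y.
have eF G : e1 t (ev2 polyC G U Y) = e2 G (e1 t U) (e1 t Y).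
  have h p : e1 t (ev1 polyC Y p) = e1 (e1 t Y) p.
    elim/poly_ind: p => [|p c ih]; first by rewrite !ev10.
    by rewrite !ev1D !ev1M !ev1X !ev1C ih.
  elim/poly_ind: G => [|G c ih]; first by rewrite !ev20 ev10.
  by rewrite !ev2_cons ev1D ev1M ih h.
have oU := sr_ev1 U sO Ot; have oY := sr_ev1 Y sO Ot; have otk := srX k sO Ot.
have congr G : exists2 w, O w & e2 G u y = e1 t (ev2 polyC G U Y) + t ^+ k * w.
  by rewrite eU eY eF; apply: ev2_congr.
have [w0 ow0 ew0] := congr P.
(* P(u, y) = 0, so P at the truncations has a value divisible by [t ^+ k], and [dvr_ordK] lifts this
   to polynomials, where d/dt applies. *)
have [G eG] : exists G, F = 'X^k * G.
  apply: (dvr_ordK (z := - w0)); first exact: srN.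
  by move: ew0; rewrite P0 mulrN => /eqP; rewrite eq_sym addr_eq0 => /eqP.
have [w1 ow1 ew1] := congr P^`().
have [w2 ow2 ew2] := congr (map_poly deriv P).
pose k' := (rho + r + e)%N.
have [v2 ov2 ev2] : exists2 v2, O v2 &
    e2 P^`() u y * e1 t U^`() + e2 (map_poly deriv P) u y * e1 t Y^`() = t ^+ k' * v2.
  exists (k%:R * e1 t G + t * e1 t G^`() + t * w1 * e1 t U^`() + t * w2 * e1 t Y^`()).
    have oe p : O (e1 t p) by apply: sr_ev1.
    by repeat (apply: srD => // || apply: srM => // || apply: srnat => //).
  have : e1 t F^`() = e1 t ('X^k * G)^`() by rewrite eG.
  rewrite (@ev2_deriv _ _ polyC deriv) ?ev1D ?ev1M //; last 3 first.
  - exact: derivD.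
  - exact: derivM.
  - exact: derivC.
  rewrite ew1 ew2 derivM derivXn !(ev1D, ev1M, ev1Mn, ev1Xn) => h.
  have ek : t ^+ k = t * t ^+ k' by rewrite -exprS.
  by rewrite !mulrDl addrACA h ek; ring.
have PYE : e2 (map_poly deriv P) u y = - (e2 P^`() u y * u').
  by apply/eqP; rewrite -addr_eq0 addrC PD.
have [p0 op] := dvr_unit owp cp0; have [mu0 omu] := dvr_unit owu cu0.
have [nu0 onu] := dvr_unit owy cy0.
set p := io cp + t * wp in ep p0 op; set mu := io cu + t * wu in eu mu0 omu.
set nu := io cy + t * wy in ey nu0 onu.
have t0 := dvr_t0.
(* The chain rule for [F], divided by the partial derivative of order [rho], compares t dU/dt with
   u' t dY/dt; these begin with r u and e y u'. *)
have E : (r%:R * u + t ^+ r.+1 * au) - u' * (e%:R * y + t ^+ e.+1 * ay) = t ^+ (r + e).+1 * (v2 / p).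
  rewrite -eU' -eY'.
  apply: (mulfI (x := e2 P^`() u y)) => //.
  have -> : e2 P^`() u y * (t * e1 t U^`() - u' * (t * e1 t Y^`())) =
    t * (e2 P^`() u y * e1 t U^`() + - (e2 P^`() u y * u') * e1 t Y^`()) by ring.
  rewrite -PYE ev2 ep /k' -addnA exprD exprS; field.
  exact: p0.
pose z := y * u' / u.
pose b := ay / nu.
pose a := au / mu - t ^+ e * (v2 / p / mu).
have ob : O b by apply: srM.
have oa : O a by apply: srB => //; do ?[apply: srM => //]; apply: srX.
have Z : z * (e%:R + t * b) = r%:R + t * a.
  have u'E : u' * (e%:R * y + t ^+ e.+1 * ay) = r%:R * u + t ^+ r.+1 * au - t ^+ (r + e).+1 * (v2 / p).
    by rewrite -E; ring.
  have -> : z * (e%:R + t * b) = u' * (e%:R * y + t ^+ e.+1 * ay) / u.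
    rewrite /z /b ey exprS; field; by rewrite u0 nu0.
  rewrite u'E /a eu !exprS exprD; field.
  by rewrite mu0 p0 expf_neq0.
have e0 : e%:R != 0 :> K by rewrite ee.
have r0 : r%:R != 0 :> K by rewrite er.
have [d0 od] := dvr_unit ob e0.
rewrite rmorph_nat in d0 od.
exists (r%:R / e%:R), ((a - io (r%:R / e%:R) * b) / (e%:R + t * b)).
split.
- by apply: srM => //; apply: srB => //; apply: srM => //; apply: srC.
- by rewrite mulf_neq0 // invr_eq0.
- have -> : 1 + r%:R / e%:R = (e + r)%:R / e%:R :> K by rewrite natrD; field.
  by rewrite mulf_neq0 ?invr_eq0 // ee addSn.
- rewrite -/z; apply: (mulIf d0); rewrite Z mulrDl -mulrA divfK // rmorphM fmorphV !rmorph_nat.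
  field; by rewrite -(rmorph_nat io) fmorph_eq0.
Qed.
End Fix.
End DVR.

Lemma poly_Xstrip (R : nzRingType) (p : {poly R}) : p != 0 ->
  exists j q, [/\ p = q * 'X^j, q`_0 != 0 & (j < size p)%N].
Proof.
elim/poly_ind: p => [|p c ih]; first by rewrite eqxx.
have [->|c0] := eqVneq c 0; last first.
  move=> nz; exists 0, (p * 'X + c%:P); rewrite expr0 mulr1; split=> //.
    by rewrite coefD coefMX coefC eqxx add0r.
  by rewrite size_poly_gt0.
rewrite addr0 => nz; have p0 : p != 0 by apply: contraNneq nz => ->; rewrite mul0r.
have [j [q [e q0 jp]]] := ih p0.
exists j.+1, q; split=> //; first by rewrite e exprSr mulrA.
by rewrite size_mulX.
Qed.

(** * Complete integral closure of a one-dimensional local domain *)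

Section Norm.
Variables (K : closedFieldType) (Q : fieldType) (io : {rmorphism K -> Q}).

Let srC O (s : subring io O) c : O (io c) := srC s c.
Let srD O (s : subring io O) x z : O x -> O z -> O (x + z) := @srD _ _ io O s x z.
Let srM O (s : subring io O) x z : O x -> O z -> O (x * z) := @srM _ _ io O s x z.
Let srB O (s : subring io O) x z : O x -> O z -> O (x - z) := @srB _ _ io O x z s.
Let srX O n (s : subring io O) x : O x -> O (x ^+ n) := @srX _ _ io O x n s.

Definition mulS (a : Q) (V : Q -> Prop) (x : Q) := exists2 b, V b & x = a * b.

Lemma subsp_sr V : subring io V -> subsp io V.
Proof.
move=> sV; split; [exact: sr0 sV|exact: (srD sV)|].
by move=> c x vx; apply: (srM sV) => //; apply: (srC sV).
Qed.

Lemma subsp_mulS a V : subsp io V -> subsp io (mulS a V).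
Proof.
case=> h0 hD hZ; split.
- by exists 0; rewrite ?mulr0.
- move=> x y [b vb ->] [c vc ->]; exists (b + c); first exact: hD.
  by rewrite mulrDr.
- move=> c x [b vb ->]; exists (io c * b); first exact: hZ.
  by rewrite mulrCA.
Qed.

Lemma qdim_scale a V W n : a != 0 -> subsp io V -> subsp io W ->
  qdim io V W n -> qdim io (mulS a V) (mulS a W) n.
Proof.
move=> a0 sV sW; apply: (qdim_map (f := fun x => a * x)) => //.
- by move=> x y; rewrite mulrDr.
- by move=> c x; rewrite mulrCA.
- exact: subsp_mulS.
- by move=> v vv; exists v.
- move=> _ [v vv ->]; exists v => //; rewrite subrr.
  by case: (subsp_mulS a sW).
- by move=> v vv; split=> [[w ww /(mulfI a0) ->]|ww] //; exists v.
Qed.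

Variables (A m : Q -> Prop) (y : Q).
Hypothesis sA : subring io A.
Hypothesis mA : forall x, m x -> A x.
Hypothesis m1 : ~ m 1.
Hypothesis mD : forall x z, m x -> m z -> m (x + z).
Hypothesis mM : forall a x, A a -> m x -> m (a * x).
Hypothesis m_unit : forall a, A a -> ~ m a -> A a^-1.
Hypothesis my : m y.
Hypothesis y0 : y != 0.
Hypothesis A_fin : forall a, A a -> a != 0 -> exists n, qdim io A (mulS a A) n.
Hypothesis A_frac : forall z, exists a b, [/\ A a, A b, b != 0 & z = a / b].

(* Complete integral closure of [A]. *)
Definition cic (z : Q) := exists c, [/\ A c, c != 0 & forall k, A (c * z ^+ k)].

(** A common denominator takes the place of finite generation over [A]: with finite colengths in [A]
    it makes [W / A] finite-dimensional. *)
Definition overring (W : Q -> Prop) :=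
  [/\ subring io W, forall x, A x -> W x & exists c, [/\ A c, c != 0 & forall x, W x -> A (c * x)]].

(** [W[b]] works: a denominator of [W] times a common denominator of the powers of [b] is a
    denominator of [W[b]]. *)
Lemma overring_ext W b : overring W -> cic b ->
  exists W', [/\ overring W', forall x, W x -> W' x & W' b].
Proof.
move=> [sW AW [c [Ac c0 cW]]] [d [Ad d0 db]].
exists (fun x => exists2 p : {poly Q}, (forall i, W p`_i) & x = p.[b]).
have Cin x : W x -> exists2 p : {poly Q}, (forall i, W p`_i) & x = p.[b].
  move=> Wx; exists x%:P; last by rewrite hornerC.
  by move=> i; rewrite coefC; case: ifP => // _; apply: sr0 sW.
split=> //.
- split.
  + split.
    * by move=> e; apply: Cin; apply: srC.
    * move=> _ _ [p Wp ->] [q Wq ->]; exists (p + q); last by rewrite hornerD.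
      by move=> i; rewrite coefD; apply: srD.
    * move=> _ _ [p Wp ->] [q Wq ->]; exists (p * q); last by rewrite hornerM.
      move=> i; rewrite coefM; apply: (subsp_sum (io := io)); first exact: subsp_sr.
      by move=> j; apply: srM.
  + by move=> x /AW; apply: Cin.
  + exists (c * d); split; [exact: srM|exact: mulf_neq0|].
    move=> _ [p Wp ->]; rewrite horner_coef mulr_sumr.
    apply: (subsp_sum (io := io)); first exact: subsp_sr.
    by move=> i; rewrite mulrACA; apply: srM => //; apply: cW.
- exists 'X; last by rewrite hornerX.
  move=> i; rewrite coefX -(rmorph_nat io); exact: srC.
Qed.

Lemma overringA : overring A.
Proof.
split=> //; exists 1; split; [exact: sr1 sA|exact: oner_neq0|by move=> x; rewrite mul1r].
Qed.

Lemma overring_fin (I : finType) (b : I -> Q) : (forall i, cic (b i)) ->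
  exists W, overring W /\ forall i, W (b i).
Proof.
move=> hb.
have [W [oW hW]] : exists W, overring W /\ forall i, i \in enum I -> W (b i).
  elim: (enum I) => [|i s [W [oW hW]]]; first by exists A; split=> //; apply: overringA.
  have [W' [oW' WW' W'b]] := overring_ext oW (hb i).
  exists W'; split=> // j; rewrite inE => /predU1P[->//|/hW]; exact: WW'.
by exists W; split=> // i; apply: hW; rewrite mem_enum.
Qed.

(** [W / A] embeds in the finite-dimensional [c^-1 A / A], and multiplication by [a] identifies it
    with [aW / aA]. The chains W, A, aA and W, aW, aA have the same total length, so A / aA and W /
    aW agree. *)
Lemma overring_len W a n : overring W -> A a -> a != 0 ->
  qdim io A (mulS a A) n -> qdim io W (mulS a W) n.
Proof.
move=> [sW AW [c [Ac c0 cW]]] Aa a0 dn.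
have pA := subsp_sr sA; have pW := subsp_sr sW.
have [N dN] := A_fin Ac c0.
have [_ [k [_ dk _]]] : exists u v, [/\ qdim io A (mulS c W) u, qdim io (mulS c W) (mulS c A) v & N = (u + v)%N].
  apply: qdim_split dN => //; try exact: subsp_mulS.
    by move=> _ [x /cW Ax ->].
  by move=> _ [x Ax ->]; exists x => //; apply: AW.
have dWA : qdim io W A k.
  have := qdim_scale (a := c^-1) _ (subsp_mulS c pW) (subsp_mulS c pA) dk.
  rewrite invr_eq0 => /(_ c0); apply: qdim_ext => x; split.
  - by move=> [_ [z Wz ->] ->]; rewrite mulKf.
  - by move=> Wx; exists (c * x); [exists x|rewrite mulKf].
  - by move=> [_ [z Wz ->] ->]; rewrite mulKf.
  - by move=> Wx; exists (c * x); [exists x|rewrite mulKf].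
have aAA x : mulS a A x -> A x by move=> [z Az ->]; apply: srM.
have d1 : qdim io W (mulS a A) (k + n).
  by apply: qdim_add dWA dn => //; apply: subsp_mulS.
have [|||||p [q [dp dq e]]] := qdim_split (V := mulS a W) _ _ _ _ _ d1.
- by [].
- exact: subsp_mulS.
- exact: subsp_mulS.
- by move=> _ [z Wz ->]; apply: srM => //; apply: AW.
- by move=> _ [z Az ->]; exists z => //; apply: AW.
have := qdim_uniq (subsp_mulS a pA) dq (qdim_scale a0 pW pA dWA).
by move=> eq; move: e dp; rewrite eq addnC => /addIn ->.
Qed.

(** In an overring [W] containing both quotients, [aW = bW]; [overring_len] brings this back to
    [A]. *)
Lemma unit_len a b n : A a -> A b -> a != 0 -> b != 0 -> cic (a / b) -> cic (b / a) ->
  qdim io A (mulS a A) n -> qdim io A (mulS b A) n.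
Proof.
move=> Aa Ab a0 b0 cab cba dn.
have [W1 [oW1 _ W1ab]] := overring_ext overringA cab.
have [W [oW W1W Wba]] := overring_ext oW1 cba.
have Wab := W1W _ W1ab.
have [N dN] := A_fin Ab b0.
have dWa := overring_len oW Aa a0 dn; have dWb := overring_len oW Ab b0 dN.
have sW : subring io W by case: oW.
have dWa' : qdim io W (mulS b W) n.
  apply: qdim_ext dWa => // x; split=> [[w Ww ->]|[w Ww ->]].
  - exists (a / b * w); first exact: srM.
    by rewrite mulrA mulrCA divff ?mulr1.
  - exists (b / a * w); first exact: srM.
    by rewrite mulrA mulrCA divff ?mulr1.
by rewrite (qdim_uniq (subsp_mulS b (subsp_sr sW)) dWa' dWb).
Qed.

Lemma cicA x : A x -> cic x.
Proof.
move=> Ax; exists 1; split; [exact: sr1 sA|exact: oner_neq0|].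
by move=> k; rewrite mul1r; apply: srX.
Qed.

Lemma cic_sr : subring io cic.
Proof.
have two x z : cic x -> cic z -> exists W, [/\ overring W, W x & W z].
  move=> cx cz; have [W [oW _ Wx]] := overring_ext overringA cx.
  have [W' [oW' WW' Wz]] := overring_ext oW cz; exists W'; split=> //; exact: WW'.
have ofW W x : overring W -> W x -> cic x.
  move=> [sW _ [c [Ac c0 cW]]] Wx; exists c; split=> // k; apply: cW; exact: srX.
split.
- by move=> c; apply: cicA; apply: srC.
- move=> x z cx cz; have [W [oW Wx Wz]] := two _ _ cx cz.
  apply: (ofW _ _ oW); case: (oW) => sW _ _; exact: srD.
- move=> x z cx cz; have [W [oW Wx Wz]] := two _ _ cx cz.
  apply: (ofW _ _ oW); case: (oW) => sW _ _; exact: srM.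
Qed.

Notation B := cic.
Let pB : subsp io B := subsp_sr cic_sr.

(** [B] itself may lack a common denominator, but a finite family of it lies in one overring [W],
    where the colength of [a] bounds independent families uniformly. *)
Lemma cic_fin a : A a -> a != 0 -> exists n, qdim io B (mulS a B) n.
Proof.
move=> Aa a0; have [N dN] := A_fin Aa a0.
have [|||n dn _] := @qdim_exists _ _ io B (mulS a B) N; last by exists n.
- exact: pB.
- exact: subsp_mulS.
move=> k b [hb ib]; have [W [oW Wb]] := overring_fin hb.
have [d id sd] := overring_len oW Aa a0 dN.
have sW : subring io W by case: oW.
apply: (indep_le (subsp_mulS a (subsp_sr sW)) sd (d := b)).
split=> // c [w Ww e]; apply: ib; exists w => //.
by case: oW => _ _ [c' [Ac' c0' cW]]; exists c'; split=> // i; apply: cW; apply: srX.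
Qed.

Definition bideal (J : Q -> Prop) :=
  [/\ forall x, J x -> B x, J 0, forall x z, J x -> J z -> J (x + z) & forall b x, B b -> J x -> J (b * x)].

Lemma bideal_subsp J : bideal J -> subsp io J.
Proof.
case=> _ h0 hD hM; split=> // c x Jx; apply: hM => //; exact: srC cic_sr _.
Qed.

Lemma bideal_mulS a : B a -> bideal (mulS a B).
Proof.
move=> Ba; have [h0 hD hZ] := subsp_mulS a pB; split=> //.
- by move=> _ [b Bb ->]; apply: (srM cic_sr).
- move=> b _ Bb [x Bx ->]; exists (b * x); last by rewrite mulrCA.
  exact: (srM cic_sr).
Qed.

Section Maximal.
Variable n : Q -> Prop.
Hypothesis nI : bideal n.
Hypothesis n1 : ~ n 1.
Hypothesis n_max : forall J, bideal J -> (forall x, n x -> J x) -> ~ J 1 -> forall x, J x -> n x.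
Hypothesis n_fin : exists k, qdim io B n k.

Let Bsr := cic_sr.
Let nB x : n x -> B x. Proof. by case: nI => h _ _ _; apply: h. Qed.
Let nD x z : n x -> n z -> n (x + z). Proof. by case: nI => _ _ h _; apply: h. Qed.
Let nM b x : B b -> n x -> n (b * x). Proof. by case: nI => _ _ _ h; apply: h. Qed.
Let nN x : n x -> n (- x).
Proof. by move=> h; apply: subspN (bideal_subsp nI) h. Qed.
Let nBr x z : n x -> n z -> n (x - z).
Proof. by move=> h1 h2; apply: nD => //; apply: nN. Qed.

Lemma max_prime x z : B x -> B z -> n (x * z) -> ~ n x -> n z.
Proof.
move=> Bx Bz nxz nx.
pose J w := exists a b, [/\ n a, B b & w = a + x * b].
have JI : bideal J.
  split.
  - by move=> _ [a [b [na Bb ->]]]; apply: srD => //; [apply: nB|apply: srM].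
  - exists 0, 0; rewrite mulr0 addr0; split=> //; [by case: nI|exact: sr0 Bsr].
  - move=> _ _ [a [b [na Bb ->]]] [a' [b' [na' Bb' ->]]].
    exists (a + a'), (b + b'); split; [exact: nD|exact: srD|by rewrite mulrDr addrACA].
  - move=> c _ Bc [a [b [na Bb ->]]]; exists (c * a), (c * b).
    by split; [exact: nM|exact: srM|rewrite mulrDr mulrCA].
have [[a [b [na Bb e]]]|J1] := classic (J 1).
  have -> : z = z * a + b * (x * z) by rewrite -[LHS]mulr1 e; ring.
  by apply: nD; apply: nM.
case: nx; apply: (n_max JI) => //.
- by move=> w nw; exists w, 0; rewrite mulr0 addr0; split=> //; apply: sr0 Bsr.
- by exists 0, 1; rewrite mulr1 add0r; split=> //; [case: nI|apply: sr1 Bsr].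
Qed.

Lemma max_nconst c : c != 0 -> ~ n (io c).
Proof.
move=> c0 h; apply: n1; have := nM (srC Bsr c^-1) h.
by rewrite -rmorphM mulVf // rmorph1.
Qed.

Lemma pow_dep k (W : Q -> Prop) b : subsp io W -> qdim io B W k -> B b ->
  exists p : {poly K}, [/\ p != 0, W (ev1 io b p) & (size p <= k.+1)%N].
Proof.
move=> sW [d id sd] Bb; apply: NNPP => h.
have : (k.+1 <= k)%N; last by rewrite ltnn.
apply: (indep_le sW sd (d := fun i : 'I_k.+1 => b ^+ i)).
split=> [i|c hc i]; first exact: srX.
pose p := \poly_(i < k.+1) c (inord i).
have pc j : p`_(j : 'I_k.+1) = c j by rewrite coef_poly ltn_ord inord_val.
have -> : c i = 0; last by [].
rewrite -pc; have [->|p0] := eqVneq p 0; first by rewrite coef0.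
case: h; exists p; split=> //; last exact: size_poly.
suff -> : ev1 io b p = comb io c (fun i : 'I_k.+1 => b ^+ i) by [].
rewrite /ev1 (horner_coef_wide _ (n := k.+1)) ?size_map_poly ?size_poly //.
by apply: eq_bigr => j _; rewrite coef_map pc.
Qed.

(** [n] is prime and [K] algebraically closed: a polynomial of least degree whose value at [b] lies
    in [n] has a root, and splitting off the root leaves a linear factor with value in [n]. *)
Lemma max_res b : B b -> exists c, n (b - io c).
Proof.
move=> Bb; have [k dk] := n_fin.
have := pow_dep (bideal_subsp nI) dk Bb.
case=> p0 [p0nz p0n _].
have [s [p [pnz pn ps]] smin] := nat_min (P := fun s => exists p : {poly K}, [/\ p != 0, n (ev1 io b p) & size p = s])
  (ex_intro _ (size p0) (ex_intro _ p0 (And3 p0nz p0n erefl))).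
have [c rc] : exists c, root p c.
  apply/closed_rootP; apply/negP => /size_poly1P [c c0 pc].
  by apply: (max_nconst c0); move: pn; rewrite pc ev1C.
move/factor_theorem: rc => [q eq]; exists c.
apply: NNPP => nc; apply: (smin (size q)); last first.
  exists q; split=> //; first by apply: contraNneq pnz => q0; rewrite eq q0 mul0r.
  apply: max_prime nc => //; last first.
  - by move: pn; rewrite eq ev1M mulrC -polyCN ev1D ev1X ev1C rmorphN.
  - exact: sr_ev1.
  - by apply: srB => //; apply: srC.
rewrite -ps eq size_Mmonic ?monicXsubC ?size_XsubC //; last first.
  by apply: contraNneq pnz => q0; rewrite eq q0 mul0r.
by rewrite addn2.
Qed.

Lemma max_m x : m x -> n x.
Proof.
move=> mx; have [c nc] := max_res (cicA (mA mx)).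
have [c0|c0] := eqVneq c 0; first by move: nc; rewrite c0 rmorph0 subr0.
case: n1; rewrite -(mulVf (x := x - io c)); last first.
  apply/eqP => e; apply: m1; have := mM (srC sA c^-1) mx.
  move/eqP: e; rewrite subr_eq0 => /eqP ->.
  by rewrite -rmorphM mulVf // rmorph1.
apply: nM nc; apply: cicA; apply: m_unit.
  by apply: srB => //; [exact: mA|exact: srC].
move=> h; apply: m1.
have -> : 1 = io c^-1 * (x + (- 1) * (x - io c)).
  by rewrite mulN1r opprB addrC subrK -rmorphM mulVf // rmorph1.
apply: mM; first exact: srC.
by apply: mD => //; apply: mM => //; rewrite -(rmorphN1 io); apply: srC.
Qed.

(** [b] is a nonzero element of the finite-dimensional [B / yB] killed by [n]. Then b / y maps [n]
    into [B] without lying in [B], the usual step towards a generator of [n] after localization. *)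
Lemma max_colon : exists2 b, B b & ~ mulS y B b /\ forall x, n x -> mulS y B (b * x).
Proof.
have By := cicA (mA my); have yI := bideal_mulS By.
have [N dN] := cic_fin (mA my) y0.
pose col b x := B x /\ mulS y B (x * b).
have colI b : B b -> bideal (col b).
  move=> Bb; case: (yI) => h1 h2 h3 h4; split.
  - by move=> x [].
  - by split; [exact: sr0 Bsr|rewrite mul0r].
  - by move=> x z [Bx hx] [Bz hz]; split; [exact: srD|rewrite mulrDl; apply: h3].
  - by move=> c x Bc [Bx hx]; split; [exact: srM|rewrite -mulrA; apply: h4].
have colY b : B b -> forall x, mulS y B x -> col b x.
  move=> Bb x [z Bz ->]; split; first exact: srM.
  by exists (z * b); [exact: srM|rewrite mulrA].
have colfin b : B b -> exists d, qdim io B (col b) d.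
  move=> Bb; have [|||||u [v [du _ _]]] := qdim_split (V := col b) _ _ _ _ _ dN; last by exists u.
  - exact: pB.
  - exact/bideal_subsp/colI.
  - exact: subsp_mulS.
  - by move=> x [].
  - exact: colY.
have yn x : mulS y B x -> n x.
  by move=> [z Bz ->]; rewrite mulrC; apply: nM => //; apply: max_m.
pose P d := exists b, [/\ B b, forall x, col b x -> n x & qdim io B (col b) d].
have [d [b [Bb cbn dd]] dmin] : exists2 d, P d & forall e, (e < d)%N -> ~ P e.
  apply: nat_min; have B1 := sr1 Bsr; have [d dd] := colfin 1 B1.
  by exists d, 1; split=> // x [_]; rewrite mulr1 => /yn.
(* Otherwise [col (x * b)] also lies in [n] and equals [col b] by minimality of [d]; multiplication
   by [x] is then injective, hence surjective, on B / col b, which puts 1 in [n]. *)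
have stepx x : n x -> exists s, [/\ B s, ~ n s & mulS y B (s * (x * b))].
  move=> nx; apply: NNPP => h.
  have Bx := nB nx; have Bxb : B (x * b) by apply: srM.
  have cxn z : col (x * b) z -> n z.
    by move=> [Bz hz]; apply: NNPP => nz; apply: h; exists z.
  have sub z : col b z -> col (x * b) z.
    move=> [Bz hz]; split=> //; rewrite mulrCA; case: yI => _ _ _; exact.
  have [|||||u [v [du dv e]]] := qdim_split (V := col (x * b)) _ _ _ _ _ dd.
  - exact: pB.
  - exact/bideal_subsp/colI.
  - exact/bideal_subsp/colI.
  - by move=> z [].
  - exact: sub.
  have v0 : v = 0%N.
    case: v dv e => // v dv e; case: (dmin u); first by rewrite e addnS ltnS leq_addr.
    by exists (x * b).
  move: dv; rewrite v0 => /(qdim0P _ (bideal_subsp (colI _ Bb))) eqc.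
  have [||||||||z Bz hz] := @qdim_inj_surj _ _ io B (col b) d (fun z => x * z) _ _ dd _ _ _ _ _ 1.
  - exact: pB.
  - exact/bideal_subsp/colI.
  - by move=> ? ?; rewrite mulrDr.
  - by move=> ? ?; rewrite mulrCA.
  - by move=> z Bz; apply: srM.
  - by move=> z; case: (colI _ Bb) => _ _ _; apply.
  - move=> z Bz [_ hz]; apply: eqc; split=> //.
    by rewrite mulrA [z * x]mulrC.
  - exact: sr1 Bsr.
  apply: n1; rewrite -[1](subrK (x * z)); apply: nD; first exact: cbn.
  by rewrite mulrC; apply: nM.
have [|||||u [v [_ dv _]]] := qdim_split (V := n) _ _ _ _ _ dN.
- exact: pB.
- exact: bideal_subsp nI.
- exact: subsp_mulS.
- exact: nB.
- exact: yn.
case: dv => g [ng ig] sg.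
have [s hs] := fun_choice (fun i => stepx _ (ng i)).
(* One multiplier outside the prime [n] that serves for all the finitely many generators [g] of [n]
   modulo [yB]. *)
pose S := \prod_i s i.
have [BS nS] : B S /\ ~ n S.
  rewrite /S; elim/big_rec: _ => [|i z _ [Bz nz]]; first by split=> //; apply: sr1 Bsr.
  have [Bs ns _] := hs i; split; first exact: srM.
  by move=> h; apply: nz; apply: max_prime h ns.
exists (S * b); first exact: srM.
split.
  by move=> h; apply: nS; apply: cbn.
move=> x /sg [c [z Bz e]].
have -> : x = y * z + comb io c g by rewrite -e subrK.
case: (yI) => h1 h2 h3 h4.
rewrite mulrDr; apply: h3; first by exists (S * b * z); [do 2?apply: srM|rewrite mulrCA].
rewrite /comb mulr_sumr; apply: (subsp_sum (io := io)); first exact: subsp_mulS.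
move=> i; have [Bs ns hi] := hs i.
have -> : S * b * (io (c i) * g i) = (io (c i) * \prod_(j | j != i) s j) * (s i * (g i * b)).
  by rewrite /S (bigD1 i) //=; ring.
apply: h4 => //; apply: srM => //; first exact: srC.
by elim/big_rec: _ => [|j w _ Bw]; [exact: sr1 Bsr|apply: srM => //; case: (hs j)].
Qed.

Definition locO (z : Q) := exists s, [/\ B s, ~ n s & B (s * z)].

Lemma locO_sr : subring io locO.
Proof.
have prod s s' : B s -> B s' -> ~ n s -> ~ n s' -> ~ n (s * s').
  by move=> Bs Bs' ns ns' h; apply: ns'; apply: max_prime h ns.
split.
- move=> c; exists 1; split=> //; first exact: sr1 Bsr.
  by rewrite mul1r; apply: srC.
- move=> x z [s [Bs ns hs]] [s' [Bs' ns' hs']]; exists (s * s'); split; [exact: srM|exact: prod|].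
  have -> : s * s' * (x + z) = s' * (s * x) + s * (s' * z) by ring.
  by apply: (srD Bsr); apply: (srM Bsr).
- move=> x z [s [Bs ns hs]] [s' [Bs' ns' hs']]; exists (s * s'); split; [exact: srM|exact: prod|].
  by rewrite mulrACA; apply: (srM Bsr).
Qed.

Lemma locO_B x : B x -> locO x.
Proof. by move=> Bx; exists 1; rewrite mul1r; split=> //; apply: sr1 Bsr. Qed.

(* If q n lay in n, the B-submodules sum_(j < k) q^j y B of B would stabilise, B / yB being finite dimensional, so q would be integral over B. *)
Lemma max_endo q : (forall x, n x -> n (q * x)) -> B q.
Proof.
move=> qn; have By := cicA (mA my).
have [N dN] := cic_fin (mA my) y0.
have Bpow k : B (y * q ^+ k).
  apply: nB; elim: k => [|k ih]; first by rewrite expr0 mulr1; apply: max_m.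
  by rewrite exprS mulrCA; apply: qn.
pose M k x := exists p : {poly Q}, [/\ forall i, B p`_i, (size p <= k)%N & x = y * p.[q]].
have MB k x : M k x -> B x.
  move=> [p [Bp _ ->]]; rewrite horner_coef mulr_sumr.
  apply: (subsp_sum (io := io)) => [|i]; first exact: pB.
   rewrite mulrCA; exact: srM.
have Msub k : subsp io (M k).
  split.
  - exists 0; rewrite horner0 mulr0 size_poly0; split=> // i; rewrite coef0; exact: sr0 Bsr.
  - move=> _ _ [p [Bp sp ->]] [p' [Bp' sp' ->]]; exists (p + p'); split.
    + by move=> i; rewrite coefD; apply: srD.
    + by rewrite (leq_trans (size_polyD _ _)) // geq_max sp.
    + by rewrite hornerD mulrDr.
  - move=> c _ [p [Bp sp ->]]; exists (io c *: p); split.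
    + by move=> i; rewrite coefZ; apply: srM => //; apply: srC.
    + exact: leq_trans (size_scale_leq _ _) sp.
    + by rewrite hornerZ mulrCA.
have yM k x : mulS y B x -> M k.+1 x.
  move=> [b Bb ->]; exists b%:P; rewrite hornerC; split=> //.
    by move=> i; rewrite coefC; case: ifP => // _; apply: sr0 Bsr.
  by rewrite size_polyC; case: eqP.
have Mfin k : exists d, qdim io B (M k.+1) d.
  have [|||||u [v [du _ _]]] := qdim_split (V := M k.+1) _ _ _ _ _ dN; last by exists u.
  - exact: pB.
  - exact: Msub.
  - exact: subsp_mulS.
  - exact: MB.
  - exact: yM.
have [d [k dk] dmin] : exists2 d, (exists k, qdim io B (M k.+1) d) &
    forall e, (e < d)%N -> ~ (exists k, qdim io B (M k.+1) e).
  by apply: nat_min; have [d dd] := Mfin 0%N; exists d, 0%N.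
have MS x : M k.+1 x -> M k.+2 x.
  by move=> [p [Bp sp ->]]; exists p; split=> //; apply: leqW.
have [|||||u [v [du dv e]]] := qdim_split (V := M k.+2) _ _ _ _ _ dk.
- exact: pB.
- exact: Msub.
- exact: Msub.
- exact: MB.
- exact: MS.
have v0 : v = 0%N.
  case: v dv e => // v dv e; case: (dmin u); first by rewrite e addnS ltnS leq_addr.
  by exists k.+1.
move: dv; rewrite v0 => /(qdim0P _ (Msub _)) stab.
have [p [Bp sp ep]] : M k.+1 (y * q ^+ k.+1).
  apply: stab; exists 'X^(k.+1); rewrite hornerXn size_polyXn; split=> // i.
  by rewrite coefXn -(rmorph_nat io); apply: srC.
have {}ep : q ^+ k.+1 = p.[q] by apply: (mulfI y0).
have [W [oW Wp]] := @overring_fin _ (fun i : 'I_k.+1 => p`_i) (fun i => Bp i).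
have [sW AW [c [Ac c0 cW]]] := oW.
have WpA i : W p`_i.
  case: (ltnP i k.+1) => h; first exact: (Wp (Ordinal h)).
  by rewrite nth_default ?(leq_trans sp) //; apply: sr0 sW.
(* The integral equation, with coefficients in the single overring [W], reduces every power of [q]
   to degree at most k, so one denominator suffices for all powers. *)
have red l : exists r : {poly Q}, [/\ forall i, W r`_i, (size r <= k.+1)%N & q ^+ l = r.[q]].
  elim: l => [|l [r [Wr sr er]]].
    exists 1; rewrite hornerE expr0 size_poly1; split=> // i.
    by rewrite coef1 -(rmorph_nat io); apply: srC.
  exists (r * 'X - r`_k *: ('X^(k.+1) - p)); split.
  - move=> i; rewrite coefB coefMX coefZ coefB coefXn.
    apply: (srB sW); first by case: ifP => // _; apply: sr0 sW.
    apply: (srM sW) => //; apply: (srB sW) => //; rewrite -(rmorph_nat io); exact: srC.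
  - apply/leq_sizeP => j; rewrite leq_eqVlt => /predU1P[<-|hj].
      rewrite coefB coefMX coefZ coefB coefXn eqxx /= (nth_default 0 sp) subr0 mulr1.
      by rewrite subrr.
    have pj : p`_j = 0 by apply: nth_default; apply: leq_trans sp (ltnW hj).
    rewrite coefB coefMX coefZ coefB coefXn pj (gtn_eqF hj).
    rewrite subr0 mulr0 subr0; case: j hj {pj} => // j hj /=.
    by rewrite nth_default // (leq_trans sr).
  - by rewrite hornerD hornerN hornerM hornerX hornerZ hornerD hornerN hornerXn -ep subrr mulr0 subr0 exprSr er.
have [be [al [Abe Aal al0 eq]]] := A_frac q.
exists (c * al ^+ k.+1); split.
- by apply: srM => //; apply: srX.
- by rewrite mulf_neq0 // expf_neq0.
move=> l; have [r [Wr sr ->]] := red l.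
rewrite (horner_coef_wide _ sr) mulr_sumr; apply: (subsp_sum (io := io)) => [|i]; first exact: subsp_sr.
have -> : c * al ^+ k.+1 * (r`_i * q ^+ i) = (c * r`_i) * (al ^+ (k.+1 - i) * be ^+ i).
  have -> : be = al * q by rewrite eq mulrC divfK.
  rewrite exprMn [_ * (al ^+ i * _)]mulrA -exprD subnK; last exact: ltnW.
  by ring.
by apply: (srM sA); [exact: cW|apply: (srM sA); apply: (srX _ sA)].
Qed.

(** [q n] lies in [B] but not in [n], for else [max_endo] would give [q] in [B] and [b1] in [yB].
    Choose [t] in [n] with [q t] outside [n]: every [x] in [n] is [t] times the local element (q x)
    / (q t). *)
Lemma locO_dvr : exists2 t, dvr io locO t & forall x, n x -> exists2 w, locO w & x = t * w.
Proof.
have [b1 Bb1 [b1y b1n]] := max_colon.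
pose q := b1 / y.
have eb1 : b1 = y * q by rewrite /q mulrC divfK.
have qnB x : n x -> B (q * x).
  by move=> /b1n [b Bb]; rewrite eb1 -mulrA => /(mulfI y0) ->.
have [t nt ntq] : exists2 t, n t & ~ n (q * t).
  apply: NNPP => h; apply: b1y; exists q => //; apply: max_endo => x nx.
  by apply: NNPP => hx; apply: h; exists x.
have Bt := nB nt; have Be := qnB t nt.
have pull s x z : B s -> ~ n s -> n x -> s * z = x -> exists2 w, locO w & z = t * w.
  move=> Bs ns nx e.
  have t0 : t != 0 by apply/eqP => t0; apply: ntq; rewrite t0 mulr0; case: nI.
  exists (z / t); last by rewrite mulrC divfK.
  exists (q * t * s); split; first exact: srM.
    by move=> h; apply: ns; apply: max_prime h ntq.
  have -> : q * t * s * (z / t) = q * x by rewrite -e; field.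
  exact: qnB.
have sO := locO_sr.
have tV : ~ locO t^-1.
  move=> [s [Bs ns h]]; apply: ns.
  have t0 : t != 0 by apply/eqP => t0; apply: ntq; rewrite t0 mulr0; case: nI.
  by rewrite -(divfK t0 s); apply: nM.
exists t; last first.
  move=> x nx; apply: (pull 1 x x); rewrite ?mul1r //; exact: sr1 Bsr.
have nounit c w : locO w -> locO (io c) -> c != 0 -> io c <> t * w.
  move=> Ow _ c0 e; apply: tV.
  have t0 : t != 0 by apply/eqP => t0; move: e; rewrite t0 mul0r => /eqP; rewrite fmorph_eq0 (negPf c0).
  have -> : t^-1 = io c^-1 * w by rewrite fmorphV e invfM mulrAC -mulrA divff ?mulr1 //; apply: contra_neq c0 => w0; apply/eqP; rewrite -(fmorph_eq0 io) e w0 mulr0.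
  by apply: (srM sO) => //; apply: (srC sO).
split=> //.
- exact: locO_B.
- move=> z [s [Bs ns Bsz]].
  have [c1 nc1] := max_res Bs; have [c2 nc2] := max_res Bsz.
  have c10 : c1 != 0 by apply/eqP => c10; apply: ns; move: nc1; rewrite c10 rmorph0 subr0.
  have [||w Ow ew] := pull s (s * z - io c2 - io (c2 / c1) * (s - io c1)) (z - io (c2 / c1)) Bs ns.
  + by apply: nBr => //; apply: nM => //; apply: srC.
  + rewrite !rmorphM fmorphV; field; by rewrite fmorph_eq0.
  exists (c2 / c1), w; split=> //.
  by rewrite -ew addrC subrK.
- move=> z [s [Bs ns Bsz]] zt.
  have nsz : ~ n (s * z).
    by move=> h; have [w Ow ew] := pull s (s * z) z Bs ns h erefl; apply: (zt w).
  exists (s * z); split=> //.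
  have [z0|z0] := eqVneq z 0; first by case: nsz; rewrite z0 mulr0; case: nI.
  by rewrite mulfK.
- move=> z [s [Bs ns Bsz]] z0.
  have [be [al [Abe Aal al0 ez]]] := A_frac (s * z).
  have s0 : s != 0 by apply/eqP => s0; apply: ns; rewrite s0; case: nI.
  have be0 : be != 0.
    apply/eqP => be0; move: ez; rewrite be0 mul0r => /eqP; rewrite mulf_eq0 (negPf s0) /=.
    by move/eqP.
  have [d dd] := cic_fin Abe be0.
  exists d.+1 => x Ox ex.
  (* Separatedness: a nonzero polynomial in [t] of degree at most [d] lies in [beB], and [be] is a
     multiple of [z]. If [t ^+ d.+1] divided [z], cancelling the lowest power of [t] in it would
     make a nonzero constant a multiple of [t]. *)
  have [p [p0 [b Bb eb] sp]] := pow_dep (subsp_mulS be pB) dd Bt.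
  have [j [p' [ep p'0 jp]]] := poly_Xstrip p0.
  have t0 : t != 0 by apply/eqP => t0; apply: ntq; rewrite t0 mulr0; case: nI.
  have ebe : be = al * s * z by rewrite -mulrA ez mulrC divfK.
  have jd : (j < d.+1)%N by exact: leq_trans sp.
  have Op' : locO (ev1 io t p') by apply: locO_B; apply: sr_ev1.
  have [p'' ep'] : exists p'', p' = p'' * 'X + (p'`_0)%:P.
    elim/poly_ind: (p') => [|r c _]; first by exists 0; rewrite coef0 mul0r add0r.
    by exists r; rewrite coefD coefMX coefC eqxx add0r.
  apply: (nounit p'`_0 (t ^+ (d - j) * (al * s * x * b) - ev1 io t p'')) => //.
  + apply: (srB sO); last by apply: locO_B; apply: sr_ev1.
    have Oal := locO_B (cicA Aal); have Os := locO_B Bs; have Ob := locO_B Bb.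
    by do ![apply: (srM sO) => //]; apply: (srX _ sO); apply: locO_B.
  + exact: (srC sO).
  have : ev1 io t p = t ^+ j * (ev1 io t p'' * t + io p'`_0).
    by rewrite ep {1}ep' ev1M ev1Xn ev1D ev1M ev1X ev1C mulrC.
  rewrite eb ebe ex.
  have -> : al * s * (t ^+ d.+1 * x) * b = t ^+ j * (t ^+ (d - j).+1 * (al * s * x * b)).
    by rewrite [RHS]mulrA -exprD addnS subnKC //; ring.
  move=> /(mulfI (expf_neq0 j t0)) e.
  have -> : io p'`_0 = t ^+ (d - j).+1 * (al * s * x * b) - ev1 io t p'' * t by rewrite e; ring.
  by rewrite exprS; ring.
Qed.
End Maximal.

(** The denominators [D] of [z] in [B] form an ideal, proper if [z] is not in [B]. Localizing at a
    maximal ideal [n] above [D] gives a valuation ring dominating (A, m); [z] lies in it, so it has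
    a denominator outside [n], contrary to the choice of [n]. *)
Theorem cic_criterion z :
  (forall O t, dvr io O t -> (forall x, A x -> O x) ->
     (forall x, m x -> exists2 w, O w & x = t * w) -> O z) -> cic z.
Proof.
move=> hz; apply: NNPP => nz; have Bsr := cic_sr.
pose D b := B b /\ B (b * z).
have DI : bideal D.
  split.
  - by move=> x [].
  - by split; rewrite ?mul0r; apply: sr0 Bsr.
  - by move=> x w [Bx hx] [Bw hw]; split; rewrite ?mulrDl; apply: (srD Bsr).
  - by move=> b x Bb [Bx hx]; split; rewrite -?mulrA; apply: (srM Bsr).
have [be [al [Abe Aal al0 ez]]] := A_frac z.
have Dal : D al.
  by split; [exact: cicA|rewrite ez mulrC divfK //; apply: cicA].
have D1 : ~ D 1 by move=> [_]; rewrite mul1r.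
have [N dN] := cic_fin Aal al0.
have alJ J : bideal J -> (forall x, D x -> J x) -> forall x, mulS al B x -> J x.
  by move=> [_ _ _ JM] DJ _ [b Bb ->]; rewrite mulrC; apply: JM => //; apply: DJ.
have Jfin J : bideal J -> (forall x, D x -> J x) -> exists d, qdim io B J d.
  move=> JI DJ; have [|||||u [v [du _ _]]] := qdim_split (V := J) _ _ _ _ _ dN; last by exists u.
  - exact: pB.
  - exact: bideal_subsp.
  - exact: subsp_mulS.
  - by case: JI.
  - exact: alJ.
pose P d := exists J, [/\ bideal J, ~ J 1, forall x, D x -> J x & qdim io B J d].
(* A proper ideal of least colength above [D] is maximal; colengths are finite because [D] contains
   the nonzero element [al] of [A]. *)
have [d [n [nI n1 Dn dn]] dmin] : exists2 d, P d & forall e, (e < d)%N -> ~ P e.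
  by apply: nat_min; have [d dd] := Jfin D DI (fun x h => h); exists d, D.
have n_max J : bideal J -> (forall x, n x -> J x) -> ~ J 1 -> forall x, J x -> n x.
  move=> JI nJ J1.
  have [|||||u [v [du dv e]]] := qdim_split (V := J) _ _ _ _ _ dn.
  - exact: pB.
  - exact: bideal_subsp.
  - exact: bideal_subsp.
  - by case: JI.
  - exact: nJ.
  have v0 : v = 0%N.
    case: v dv e => // v dv e; case: (dmin u); first by rewrite e addnS ltnS leq_addr.
    by exists J; split=> // x /Dn /nJ.
  by move: dv; rewrite v0 => /(qdim0P _ (bideal_subsp nI)).
have nfin : exists k, qdim io B n k by exists d.
have [t dt tn] := locO_dvr nI n1 n_max nfin.
have [||s [Bs ns Bsz]] := hz _ _ dt.
- by move=> x /cicA; apply: locO_B.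
- by move=> x mx; apply: tn; apply: (max_m nI n1 n_max nfin).
by apply: ns; apply: Dn.
Qed.
End Norm.

(** * Lengths of localizations *)

Section Saturation.
Variables (K : fieldType) (R : comNzRingType) (io : {rmorphism K -> R}) (T : R -> Prop).
Hypothesis T1 : T 1.
Hypothesis TM : forall s t, T s -> T t -> T (s * t).
Implicit Types (I : R -> Prop) (gs hs : seq R).

Definition ideal I := [/\ I 0, forall x y, I x -> I y -> I (x + y) & forall a x, I x -> I (a * x)].

Fixpoint gen gs (r : R) : Prop :=
  if gs is g :: gs' then exists u r', gen gs' r' /\ r = u * g + r' else r = 0.

Definition sat I (r : R) := exists2 s, T s & I (s * r).

(** Dimension over K of the localization of R / (gs) at T. *)
Definition len gs n := qdim io (fun=> True) (sat (gen gs)) n.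

Lemma idealB I x y : ideal I -> I x -> I y -> I (x - y).
Proof. by case=> _ hD hM Ix Iy; apply: hD => //; rewrite -mulN1r; apply: hM. Qed.

Lemma ideal_subsp I : ideal I -> subsp io I.
Proof. by case=> h0 hD hM; split=> // c x; apply: hM. Qed.

Lemma gen_ideal gs : ideal (gen gs).
Proof.
elim: gs => [|g gs [h0 hD hM]] /=.
  by split=> // [x y -> ->|a x ->]; rewrite ?addr0 ?mulr0.
split.
- by exists 0, 0; rewrite mul0r addr0.
- move=> _ _ [u [r [hr ->]]] [v [r' [hr' ->]]]; exists (u + v), (r + r').
  by split; [exact: hD|rewrite mulrDl addrACA].
- move=> a _ [u [r [hr ->]]]; exists (a * u), (a * r).
  by split; [exact: hM|rewrite mulrDr mulrA].
Qed.

Lemma gen_incl gs I : ideal I -> (forall g, g \in gs -> I g) -> forall r, gen gs r -> I r.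
Proof.
move=> [h0 hD hM]; elim: gs => [|g gs ih] hg r /=; first by move=> ->.
move=> [u [r' [/ih h ->]]]; apply: hD; first by apply: hM; apply: hg; rewrite mem_head.
by apply: h => x xs; apply: hg; rewrite inE xs orbT.
Qed.

Lemma gen_mem gs g : g \in gs -> gen gs g.
Proof.
elim: gs => // h gs ih; rewrite inE => /predU1P[->|/ih hg] /=.
  by exists 1, 0; rewrite mul1r addr0; split=> //; case: (gen_ideal gs).
by exists 0, g; rewrite mul0r add0r.
Qed.

Lemma sat_ideal I : ideal I -> ideal (sat I).
Proof.
move=> [h0 hD hM]; split.
- by exists 1; rewrite ?mulr0.
- move=> x y [s Ts hs] [t Tt ht]; exists (s * t); first exact: TM.
  have -> : s * t * (x + y) = t * (s * x) + s * (t * y) by ring.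
  by apply: hD; apply: hM.
- by move=> a x [s Ts hs]; exists s => //; rewrite mulrCA; apply: hM.
Qed.

Lemma satW I r : I r -> sat I r.
Proof. by exists 1; rewrite ?mul1r. Qed.

Lemma satT I s r : T s -> sat I (s * r) -> sat I r.
Proof. by move=> Ts [t Tt h]; exists (t * s); [exact: TM|rewrite -mulrA]. Qed.

Lemma sat_incl I J : (forall x, I x -> J x) -> forall x, sat I x -> sat J x.
Proof. by move=> h x [s Ts hs]; exists s => //; apply: h. Qed.

Lemma sat_incl2 I J : (forall x, I x -> sat J x) -> forall x, sat I x -> sat J x.
Proof. by move=> h x [s Ts /h hs]; apply: satT hs. Qed.

Lemma ideal_satgen gs : ideal (sat (gen gs)).
Proof. exact/sat_ideal/gen_ideal. Qed.

Lemma gen_sat gs hs : (forall g, g \in gs -> sat (gen hs) g) ->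
  forall r, sat (gen gs) r -> sat (gen hs) r.
Proof. by move=> h; apply: sat_incl2; apply: gen_incl => //; apply: ideal_satgen. Qed.

Lemma len_ext gs hs n : (forall g, g \in gs -> sat (gen hs) g) ->
  (forall g, g \in hs -> sat (gen gs) g) -> len gs n -> len hs n.
Proof. by move=> h1 h2; apply: qdim_ext => // x; split; apply: gen_sat. Qed.

Lemma len_uniq gs n m : len gs n -> len gs m -> n = m.
Proof. by apply: qdim_uniq; apply/ideal_subsp/ideal_satgen. Qed.

Lemma len_incl gs hs n : (forall g, g \in gs -> sat (gen hs) g) ->
  len gs n -> exists2 m, len hs m & (m <= n)%N.
Proof.
move=> h dn.
have [|||||u [v [du dv e]]] := qdim_split (V := sat (gen hs)) _ _ _ _ _ dn => //.
- exact/ideal_subsp/ideal_satgen.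
- exact/ideal_subsp/ideal_satgen.
- exact: gen_sat.
by exists u; rewrite // e leq_addr.
Qed.

Lemma len_unit gs : (exists2 s, T s & gen gs s) -> len gs 0.
Proof.
move=> [s Ts hs]; apply/qdim0P; first exact/ideal_subsp/ideal_satgen.
move=> x _; exists s => //; rewrite mulrC; by case: (gen_ideal gs) => _ _; apply.
Qed.

(** Multiplication by [s] is injective modulo the saturation, hence bijective in finite dimension.
    So the quotient of [R] by the saturation already is the localization. *)
Lemma sat_inv gs n s : T s -> len gs n -> forall v, exists w, sat (gen gs) (v - s * w).
Proof.
move=> Ts dn v.
have sI := ideal_subsp (ideal_satgen gs).
have [||||||||w _ hw] := @qdim_inj_surj _ _ io (fun=> True) _ n (fun x => s * x) _ _ dn _ _ _ _ _ v => //.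
- by move=> ? ?; rewrite mulrDr.
- by move=> ? ?; rewrite mulrCA.
- by move=> x; case: (ideal_satgen gs) => _ _; apply.
- by move=> x _; apply: satT.
by exists w.
Qed.

(* Multiplication by a identifies R / (I : a) with (I + aR) / I. *)
Lemma len_colon gs hs a p q :
  (forall r, sat (gen gs) (a * r) <-> sat (gen hs) r) ->
  len hs p -> len (a :: gs) q -> len gs (p + q).
Proof.
move=> colon dp dq.
have sg := ideal_subsp (ideal_satgen gs); have sh := ideal_subsp (ideal_satgen hs).
have [_ gD gM] := ideal_satgen gs.
rewrite addnC; apply: (qdim_add sg _ _ _ dq) => //.
- by apply: gen_sat => g hg; apply: satW; apply: gen_mem; rewrite inE hg orbT.
- exact/ideal_subsp/ideal_satgen.
apply: (qdim_map (f := fun x => a * x) _ _ _ sg _ _ _ dp) => //.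
- by move=> ? ?; rewrite mulrDr.
- by move=> ? ?; rewrite mulrCA.
- move=> v _; rewrite mulrC; case: (ideal_satgen (a :: gs)) => _ _; apply.
  by apply: satW; apply: gen_mem; rewrite mem_head.
move=> v [s Ts [u [r' [hr' e]]]].
have [w hw] := sat_inv Ts dp u; exists w => //.
apply: (satT Ts).
have -> : s * (v - a * w) = r' + a * (u - s * w) by rewrite mulrBr e; ring.
by apply: gD; [exact: satW|apply/colon].
Qed.

End Saturation.
Arguments gen {R} gs r.

(** * The local ring of the plane at the origin *)

Section Bivariate.
Variable K : closedFieldType.
Hypothesis char0 : forall n, n.+1%:R != 0 :> K.

(* The plane has coordinates x = 'X and y = 'X%:P. *)
Notation R := {poly {poly K}}.
Implicit Types (a b g h r s : R).

Definition bc : K -> R := polyC \o polyC.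
HB.instance Definition _ := GRing.RMorphism.copy bc (polyC \o polyC).

Definition ry : R -> {poly K} := map_poly (horner_eval 0).
HB.instance Definition _ := GRing.RMorphism.copy ry (map_poly (horner_eval 0)).

Definition at0 r : K := (ry r).[0].
Definition yy : R := 'X%:P.
Definition dy : R -> R := map_poly deriv.
Definition unit0 r : Prop := at0 r != 0.

Lemma ryC p : ry p%:P = p.[0]%:P. Proof. by rewrite /ry map_polyC. Qed.
Lemma ryX : ry 'X = 'X. Proof. by rewrite /ry map_polyX. Qed.
Lemma ryyy : ry yy = 0. Proof. by rewrite /yy ryC hornerX. Qed.
Lemma ry_lift (p : {poly K}) : ry (map_poly polyC p) = p.
Proof. by apply/polyP => i; rewrite !coef_map /= /horner_eval hornerC. Qed.

Lemma at0M r s : at0 (r * s) = at0 r * at0 s. Proof. by rewrite /at0 rmorphM hornerM. Qed.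
Lemma at0D r s : at0 (r + s) = at0 r + at0 s. Proof. by rewrite /at0 rmorphD hornerD. Qed.
Lemma at0B r s : at0 (r - s) = at0 r - at0 s. Proof. by rewrite /at0 rmorphB hornerD hornerN. Qed.
Lemma at01 : at0 1 = 1. Proof. by rewrite /at0 rmorph1 hornerE. Qed.
Lemma at0bc c : at0 (bc c) = c. Proof. by rewrite /at0 /bc /= ryC !hornerC. Qed.
Lemma at0C p : at0 p%:P = p.[0]. Proof. by rewrite /at0 ryC hornerC. Qed.
Lemma at0yy : at0 yy = 0. Proof. by rewrite at0C hornerX. Qed.

Lemma unit01 : unit0 1. Proof. by rewrite /unit0 at01 oner_eq0. Qed.
Lemma unit0M r s : unit0 r -> unit0 s -> unit0 (r * s).
Proof. by rewrite /unit0 at0M => h1 h2; rewrite mulf_neq0. Qed.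

Notation len0 := (len bc unit0).
Notation sat0 := (sat unit0).

Lemma ry_ker r : ry r = 0 -> exists r', r = r' * yy.
Proof.
elim/poly_ind: r => [|r c ih]; first by exists 0; rewrite mul0r.
rewrite rmorphD rmorphM /= ryX ryC => /eqP.
have [p [d ec]] : exists p d, c = p * 'X + d%:P.
  by elim/poly_ind: c => [|p d _]; [exists 0, 0; rewrite mul0r addr0|exists p, d].
rewrite ec !hornerE => h.
have h0 : d = 0 by move/eqP/(congr1 (fun q : {poly K} => q`_0)): h; rewrite coefD coefMX coefC coef0 eqxx add0r.
move: h; rewrite h0 addr0 mulf_eq0 polyX_eq0 orbF => /eqP /ih [r' ->].
exists (r' * 'X + p%:P); rewrite addr0 /yy polyCM; ring.
Qed.

Lemma y_prime a b : ry a != 0 -> (exists r, a * b = r * yy) -> exists r, b = r * yy.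
Proof.
move=> a0 [r e]; apply: ry_ker; move/(congr1 ry): e.
by rewrite !rmorphM /= ryyy mulr0 => /eqP; rewrite mulf_eq0 (negPf a0) => /eqP.
Qed.

Lemma yy0 : yy != 0. Proof. by rewrite polyC_eq0 polyX_eq0. Qed.

Lemma y_strip r : r != 0 -> exists k r', r = r' * yy ^+ k /\ ry r' != 0.
Proof.
have [n] := ubnP (size (lead_coef r)); elim: n r => // n ih r sn r0.
have [h|h] := eqVneq (ry r) 0; last by exists 0%N, r; rewrite expr0 mulr1.
have [r1 e] := ry_ker h.
have r10 : r1 != 0 by apply: contraNneq r0 => r10; rewrite e r10 mul0r.
have [|k [r' [e' h']]] := ih r1 _ r10.
  move: sn; rewrite e lead_coefM lead_coefC size_mulX ?lead_coef_eq0 //.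
by exists k.+1, r'; split=> //; rewrite e e' exprSr mulrA.
Qed.

Lemma y_cancel h k a s : ry h != 0 -> a * yy ^+ k = h * s -> exists s', a = h * s'.
Proof.
move=> h0; elim: k a s => [|k ih] a s; first by rewrite expr0 mulr1; exists s.
rewrite exprSr mulrA => e.
have [s1 es] : exists r, s = r * yy by apply: (y_prime h0); exists (a * yy ^+ k).
by apply: (ih a s1); apply: (mulIf yy0); rewrite e es mulrA.
Qed.

Lemma strip0 (c : {poly K}) : c != 0 -> exists k (c' : {poly K}), c%:P = c'%:P * yy ^+ k :> R /\ c'.[0] != 0.
Proof.
move=> c0; have [k [c' [e h _]]] := poly_Xstrip c0.
by exists k, c'; rewrite /yy -polyC_exp -polyCM -e horner_coef0.
Qed.

(** The intersection multiplicity with the line y = 0 is the order of the restriction [ry a]: modulo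
    [yy] the ideal becomes that of ['X^n], as [b] is a unit at 0. *)
Lemma len_y a n (b : {poly K}) : ry a = b * 'X^n -> b.[0] != 0 -> len0 [:: yy; a] n.
Proof.
move=> ea b0.
have satP r : sat0 (gen [:: yy; a]) r <-> exists q, ry r = q * 'X^n.
  split=> [[s s0 [u [_ [[v [_ [-> ->]]] e]]]]|[q eq]].
    move/(congr1 ry): e; rewrite !rmorphD !rmorphM rmorph0 /= ryyy mulr0 add0r addr0 ea => e.
    have : 'X^n %| ry s * ry r by apply/dvdpP; exists (ry v * b); rewrite e mulrA.
    rewrite Gauss_dvdpr; first by move/dvdpP.
    by rewrite coprimep_expl // coprimep_sym coprimepX.
  exists (map_poly polyC b); first by rewrite /unit0 /at0 ry_lift.
  have [u eu] : exists u, map_poly polyC b * r - map_poly polyC q * a = u * yy.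
    apply: ry_ker; rewrite rmorphB !rmorphM /= !ry_lift eq ea; ring.
  exists u, (map_poly polyC q * a); split; last by rewrite -eu subrK.
  by exists (map_poly polyC q), 0; rewrite addr0.
apply: (@qdim_map_inv _ _ _ bc polyC ry _ _ (fun=> True) _ (fun=> True)
  (fun p => exists q, p = q * 'X^n) n) => //.
- by move=> x z; rewrite rmorphD.
- by move=> c x; rewrite rmorphM /= /bc /= ryC hornerC.
- exact/ideal_subsp/ideal_satgen/unit0M/unit01.
- split; first by exists 0; rewrite mul0r.
  + by move=> _ _ [p ->] [q ->]; exists (p + q); rewrite mulrDl.
  + by move=> c _ [p ->]; exists (c%:P * p); rewrite mulrA.
- move=> p _; exists (map_poly polyC p) => //; rewrite ry_lift subrr.
  by exists 0; rewrite mul0r.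
- by move=> r _; apply: iff_sym; apply: satP.
exists (fun i : 'I_n => 'X^i).
  split=> // c [q eq] i.
  have ec : comb polyC c (fun i : 'I_n => 'X^i) = \poly_(i < n) (if insub i is Some j then c j else 0).
    rewrite poly_def; apply: eq_bigr => j _; by rewrite mul_polyC valK.
  move/(congr1 (fun p : {poly K} => p`_i)): eq; rewrite ec coefMXn ltn_ord coef_poly ltn_ord.
  by rewrite valK.
move=> p _; exists (fun i => p`_i).
have -> : comb polyC (fun i : 'I_n => p`_i) (fun i : 'I_n => 'X^i) = take_poly n p.
  by rewrite /take_poly poly_def; apply: eq_bigr => j _; rewrite mul_polyC.
exists (drop_poly n p); by rewrite -[X in X - _](poly_take_drop n p) addrC addKr.
Qed.

End Bivariate.

(** * Irreducible curves and their function fields *)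

Lemma frac_clear (D : idomainType) (x : {fraction D}) :
  exists n d, d != 0 /\ tofrac d * x = tofrac n.
Proof.
elim/quotW: x => x; exists (frac x).1, (frac x).2; split; first exact: denom_ratioP.
unlock tofrac; rewrite -[LHS]FracField.pi_mul; apply/eqmodP => /=.
by rewrite FracField.equivfE /FracField.mulf /= !numden_Ratio ?(oner_neq0, mul1r, mulr1, denom_ratioP) // mulrC.
Qed.

Section Irreducible.
Variable K : closedFieldType.
Hypothesis char0 : forall n, n.+1%:R != 0 :> K.
Notation R := {poly {poly K}}.
Notation F := {fraction {poly K}}.
Notation yy := (yy K).
Implicit Types (a b g h r s : R).

Definition fr : R -> {poly F} := map_poly (@tofrac {poly K}).
HB.instance Definition _ := GRing.RMorphism.copy fr (map_poly (@tofrac {poly K})).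

Lemma size_fr r : size (fr r) = size r.
Proof. by apply: size_map_inj_poly; [move=> x z /eqP; rewrite tofrac_eq => /eqP|rewrite tofrac0]. Qed.

Lemma fr_eq0 r : (fr r == 0) = (r == 0).
Proof. by rewrite -!size_poly_eq0 size_fr. Qed.

Lemma fr_inj : injective fr.
Proof. by move=> r s e; apply/eqP; rewrite -subr_eq0 -fr_eq0 rmorphB /= e subrr. Qed.

Lemma frX : fr 'X = 'X.
Proof. by rewrite /fr map_polyX. Qed.

Lemma frM a b : fr (a * b) = fr a * fr b. Proof. exact: rmorphM. Qed.
Lemma frD a b : fr (a + b) = fr a + fr b. Proof. exact: rmorphD. Qed.
Lemma frC (c : {poly K}) : fr c%:P = (tofrac c)%:P.
Proof. by rewrite /fr map_polyC. Qed.

Lemma fr_clear (q : {poly F}) : exists (c : {poly K}) s, c != 0 /\ fr c%:P * q = fr s.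
Proof.
elim/poly_ind: q => [|q x [c [s [c0 e]]]].
  by exists 1, 0; rewrite oner_neq0 rmorph0 mulr0.
have [n [d [d0 ed]]] := frac_clear x.
exists (c * d), (d%:P * s * 'X + (c * n)%:P); split; first exact: mulf_neq0.
have ed' : fr d%:P * x%:P = fr n%:P by rewrite !frC -polyCM ed.
rewrite polyCM frM [in RHS]frD ![in RHS]frM polyCM [in RHS]frM.
rewrite -e -ed' frX.
move: (fr c%:P) (fr d%:P) (x%:P) => C D X'; ring.
Qed.

(** Irreducibility over [K(y)] ignores factors in y alone. Locally these are units, which [ker]
    inverts, or powers of y, which [ry h != 0] excludes. *)
Definition irr h := [/\ irreducible_poly (fr h), ry h != 0 & at0 h = 0].

(* The kernel of R -> K(y)[x] / (h). *)
Definition ker h r := exists (c : {poly K}) s, c.[0] != 0 /\ c%:P * r = h * s.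

(** A denominator in y is a unit at 0 times a power of y, and the power cancels because y is prime
    and does not divide [h]. *)
Lemma ker_dvd h r : ry h != 0 -> (ker h r <-> fr h %| fr r).
Proof.
move=> h0; split=> [[c [s [c0 e]]]|/dvdpP [q eq]].
  have c1 : tofrac c != 0 by rewrite tofrac_eq0; apply: contraNneq c0 => ->; rewrite horner0.
  rewrite -(dvdpZr _ _ c1) -mul_polyC -frC -frM e frM.
  exact: dvdp_mulr.
have [c [s [c0 es]]] := fr_clear q.
have e : c%:P * r = h * s by apply: fr_inj; rewrite !frM eq -es [LHS]mulrA mulrC.
have [k [c' [ec c'0]]] := strip0 c0.
have [s' es'] : exists s', c'%:P * r = h * s'.
  apply: (y_cancel (k := k) (s := s) h0). rewrite mulrAC -ec e.
  by [].
by exists c', s'.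
Qed.

Lemma ker_irr_prime h a b : irr h -> ker h (a * b) -> ker h a \/ ker h b.
Proof.
move=> [ih h0 _] /(ker_dvd _ h0); rewrite rmorphM /= => hd.
have [ha|ha] := boolP (fr h %| fr a); first by left; apply/ker_dvd.
right; apply/ker_dvd => //; rewrite -(Gauss_dvdpr _ (_ : coprimep (fr h) (fr a))) //.
by rewrite irreducible_poly_coprime.
Qed.

Lemma ker_ideal h : ry h != 0 -> ideal (ker h).
Proof.
move=> h0; split.
- by apply/ker_dvd => //; rewrite rmorph0 dvdp0.
- by move=> x z /(ker_dvd _ h0) hx /(ker_dvd _ h0) hz; apply/ker_dvd => //; rewrite rmorphD dvdp_add.
- by move=> x z /(ker_dvd _ h0) hx; apply/ker_dvd => //; rewrite rmorphM /= dvdp_mull.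
Qed.

Lemma ker_mem h : ry h != 0 -> ker h h.
Proof. by move=> h0; apply/ker_dvd. Qed.

Lemma irr_size h : irr h -> (1 < size h)%N.
Proof. by case=> -[+ _] _ _; rewrite size_fr. Qed.

Lemma ker_size h r : irr h -> ker h r -> (size r < size h)%N -> r = 0.
Proof.
move=> [ih h0 _] /(ker_dvd _ h0) hd sr; apply/eqP; rewrite -fr_eq0.
apply: contraLR sr => r0; rewrite -leqNgt -!size_fr; exact: dvdp_leq.
Qed.

Lemma ker_at0 h r : irr h -> ker h r -> at0 r = 0.
Proof.
move=> [_ _ ah] [c [s [c0 e]]]; move/(congr1 (@at0 K)): e.
by rewrite !at0M ah mul0r at0C => /eqP; rewrite mulf_eq0 (negPf c0) => /eqP.
Qed.

(** The function field K(y)[x] / (h) of the curve h = 0. *)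
Lemma function_field h : irr h -> exists (L : fieldType) (phi : {rmorphism R -> L}),
  [/\ forall r, phi r = 0 <-> ker h r,
      forall w, exists r (c : {poly K}), c != 0 /\ w = phi r / phi c%:P &
      forall u, exists2 P : R, P != 0 & (map_poly (fun p => phi p%:P) P).[u] = 0].
Proof.
move=> hI; have [ih h0 a0] := hI.
have [L _ [z rz fz]] := irredp_FAdjoin ih.
pose phi : {rmorphism R -> L} := horner_eval z \o map_poly (in_alg L) \o fr.
have phiE r : phi r = (map_poly (in_alg L) (fr r)).[z] by [].
have phiC c : phi c%:P = in_alg L (tofrac c) by rewrite phiE frC map_polyC hornerC.
have phiC0 c : c != 0 -> phi c%:P != 0 by move=> c0; rewrite phiC fmorph_eq0 tofrac_eq0.
exists L, phi; split.
- move=> r; split=> [e|/(ker_dvd _ h0)/dvdpP [q eq]].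
    apply/(ker_dvd _ h0); apply/negPn; apply/negP => nd.
    have : coprimep (fr h) (fr r) by rewrite irreducible_poly_coprime.
    case/Bezout_eq1_coprimepP => -[u v] /= /(congr1 (fun p => (map_poly (in_alg L) p).[z])).
    rewrite rmorphD !rmorphM rmorph1 hornerD !hornerM hornerC -[(map_poly _ (fr r)).[z]]phiE e (rootP rz) !mulr0 addr0 => /eqP.
    by rewrite eq_sym oner_eq0.
  by rewrite phiE eq rmorphM /= hornerM (rootP rz) mulr0.
- move=> w; have : w \in <<1; z>>%VS by rewrite fz memvf.
  case/Fadjoin_polyP => p /polyOver1P [q ->] ->.
  have [c [s [c0 e]]] := fr_clear q.
  exists s, c; split=> //; apply: (canRL (mulfK (phiC0 _ c0))).
  by rewrite [phi s]phiE -e rmorphM /= hornerM -phiE mulrC.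
- move=> u; have /polyOver1P [q eq] := minPolyOver 1%AS u.
  have [c [s [c0 e]]] := fr_clear q.
  have q0 : q != 0.
    apply: contra_eq_neq eq => ->; rewrite rmorph0; exact/monic_neq0/monic_minPoly.
  exists s.
    rewrite -fr_eq0 -e mulf_neq0 // frC polyC_eq0 tofrac_eq0 //.
  have -> : map_poly (fun p => phi p%:P) s = map_poly (in_alg L) (fr s).
    by rewrite /fr -map_poly_comp; apply: eq_map_poly => p; rewrite [LHS]phiC.
  by rewrite -e rmorphM /= -eq hornerM (rootP (root_minPoly _ _)) mulr0.
Qed.
End Irreducible.

Lemma gen2P (A : comNzRingType) (a b r : A) : gen [:: a; b] r <-> exists u v, r = u * a + v * b.
Proof.
split=> [[u [_ [[v [_ [-> ->]]] ->]]]|[u [v ->]]]; first by exists u, v; rewrite addr0.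
by exists u, (v * b); split=> //; exists v, 0; rewrite addr0.
Qed.

Lemma gen3P (A : comNzRingType) (a b c r : A) :
  gen [:: a; b; c] r <-> exists u v w, r = u * a + v * b + w * c.
Proof.
split=> [[u [r' [/gen2P [v [w ->]] ->]]]|[u [v [w ->]]]]; first by exists u, v, w; rewrite addrA.
by exists u, (v * b + w * c); rewrite addrA; split=> //; apply/gen2P; exists v, w.
Qed.

(** * Derivations along a curve and finiteness of colengths *)

Section Curve.
Variable K : closedFieldType.
Hypothesis char0 : forall n, n.+1%:R != 0 :> K.
Notation R := {poly {poly K}}.
Notation yy := (yy K).
Notation bc := (@bc K).
Notation unit0 := (@unit0 K).
Notation len0 := (@len K R bc unit0).
Notation sat0 := (@sat R unit0).
Implicit Types (a b g h r s : R).
Let U1 : unit0 1 := unit01 K.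
Let UM := @unit0M K.

Lemma len_uniq0 gs n m : len0 gs n -> len0 gs m -> n = m.
Proof. exact: (len_uniq U1 UM). Qed.

Lemma dyD : {morph @dy K : a b / a + b}.
Proof. exact: raddfD. Qed.

Lemma dy0 : dy 0 = 0 :> R. Proof. exact: raddf0. Qed.

Lemma dyC p : dy p%:P = (p^`())%:P :> R.
Proof. by apply/polyP => i; rewrite coef_map_id0 ?deriv0 // !coefC; case: ifP; rewrite ?deriv0. Qed.

Lemma dy_cons a p : dy (a * 'X + p%:P) = dy a * 'X + (p^`())%:P :> R.
Proof.
apply/polyP => i; rewrite coef_map_id0 ?deriv0 // !coefD !coefMX !coefC.
by case: i => [|i] /=; rewrite ?coef_map_id0 ?derivD ?deriv0.
Qed.

Lemma dyM a b : dy (a * b) = dy a * b + a * dy b :> R.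
Proof.
elim/poly_ind: a b => [|a p ih] b; first by rewrite !mul0r dy0 mul0r addr0.
have mX r : dy (r * 'X) = dy r * 'X :> R.
  by rewrite -[r * 'X]addr0 -(polyC0 {poly K}) dy_cons deriv0 polyC0 addr0.
have mC : dy (p%:P * b) = (p^`())%:P * b + p%:P * dy b :> R.
  elim/poly_ind: b {ih} => [|b q ih]; first by rewrite !mulr0 dy0 mulr0 addr0.
  rewrite mulrDr mulrA -polyCM !dy_cons ih derivM polyCD !polyCM; ring.
rewrite mulrDl mulrAC dyD mX ih mC dy_cons; ring.
Qed.

Lemma dyyy : dy yy = 1 :> R. Proof. by rewrite /yy dyC derivX. Qed.
Lemma derivyy : yy^`() = 0 :> R. Proof. by rewrite /yy derivC. Qed.

(* The derivation {h, .} of the plane, tangent to the curve h = 0. *)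
Definition pbr h r : R := h^`() * dy r - dy h * r^`().

Lemma pbrD h a b : pbr h (a + b) = pbr h a + pbr h b.
Proof. rewrite /pbr dyD derivD; ring. Qed.
Lemma pbrM h a b : pbr h (a * b) = pbr h a * b + a * pbr h b.
Proof. rewrite /pbr dyM derivM; ring. Qed.
Lemma pbrC h c : pbr h (bc c) = 0.
Proof. by rewrite /pbr /bc /= dyC !derivC !mulr0 subr0. Qed.

Lemma ker_pbr h r : ry h != 0 -> ker h r -> ker h (pbr h r).
Proof.
move=> h0 [c [s [c0 e]]]; have /(congr1 (pbr h)) := e.
rewrite !pbrM => e'.
exists (c * c), (c%:P * pbr h s - s * pbr h c%:P); split; first by rewrite hornerM mulf_neq0.
have hh : pbr h h = 0 by rewrite /pbr; ring.
have -> : (c * c)%:P * pbr h r = c%:P * (pbr h c%:P * r + c%:P * pbr h r) - pbr h c%:P * (c%:P * r).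
  by rewrite polyCM; ring.
by rewrite e' e hh; ring.
Qed.

Lemma deriv_neq0 r : (1 < size r)%N -> r^`() != 0.
Proof.
move=> s1; apply/eqP => /(congr1 (fun p : R => p`_(size r).-2)).
rewrite coef_deriv coef0 => /eqP; apply/negP.
have -> : (size r).-2.+1 = (size r).-1 by case: (size r) s1 => [|[]].
rewrite -mulr_natr; apply: mulf_neq0.
  by rewrite -lead_coefE lead_coef_eq0 -size_poly_gt0 ltnW.
case: (size r) s1 => [|[|n]] // _ /=.
by rewrite -(rmorph_nat (@polyC K)) polyC_eq0; apply: char0.
Qed.

Lemma len_yh h : ry h != 0 -> exists n, len0 [:: yy; h] n.
Proof.
move=> h0; have [n [b [e b0 _]]] := poly_Xstrip h0.
by exists n; apply: len_y e _; rewrite horner_coef0.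
Qed.

Lemma len_yXh h k : ry h != 0 -> exists n, len0 [:: yy ^+ k; h] n.
Proof.
move=> h0; elim: k => [|k [n dn]].
  by exists 0%N; apply: len_unit => //; exists 1 => //; apply: gen_mem; rewrite expr0 mem_head.
have [m dm] := len_yh h0; exists (n + m)%N.
apply: (@len_colon K R bc unit0 U1 UM _ _ yy _ _ _ dn) => [r|].
  split=> [[s Us /gen2P [u [v e]]]|[s Us /gen2P [u [v e]]]]; exists s => //; apply/gen2P.
    have [|v' ev] := y_prime (b := v) h0.
      exists (s * r - u * yy ^+ k); move: e; rewrite exprS => e.
      rewrite mulrBl -[s * r * yy]mulrA [r * yy]mulrC e; ring.
    exists u, v'; apply: (mulfI (yy0 K)).
    by rewrite mulrCA e ev exprS; ring.
  by exists u, (v * yy); rewrite mulrCA e exprS; ring.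
apply: (@len_ext K R bc unit0 U1 UM [:: yy; h] _ m _ _ dm) => g; rewrite !inE.
  by case/orP => /eqP->; apply: satW => //; apply: gen_mem; rewrite !inE eqxx ?orbT.
case/or3P => /eqP->; apply: satW => //; try by apply: gen_mem; rewrite !inE eqxx ?orbT.
by apply/gen2P; exists (yy ^+ k), 0; rewrite exprSr mul0r addr0.
Qed.

(** A Bezout relation over [K(y)], cleared of denominators, puts a polynomial in y into (h, r). Up
    to a unit it is [yy ^+ k], so (yy^k, h) bounds the colength. *)
Lemma len_coprime h r : irr h -> ~ ker h r -> exists n, len0 [:: h; r] n.
Proof.
move=> hI nk; have [ih h0 _] := hI.
have : coprimep (fr h) (fr r).
  by rewrite irreducible_poly_coprime //; apply/negP => /(ker_dvd _ h0).
case/Bezout_eq1_coprimepP => -[u v] /= e.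
have [cu [su [cu0 eu]]] := fr_clear u; have [cv [sv [cv0 ev]]] := fr_clear v.
have E : (cu * cv)%:P = (cv%:P * su) * h + (cu%:P * sv) * r :> R.
  apply: fr_inj; rewrite frD !frM -eu -ev polyCM frM -[LHS]mulr1 -e.
  by move: (fr _) (fr _) (fr _) (fr _) => *; ring.
have [k [c' [ec c'0]]] := strip0 (mulf_neq0 cu0 cv0).
have [n dn] := len_yXh k h0.
have [|m dm _] := @len_incl K R bc unit0 U1 UM _ [:: h; r] _ _ dn; last by exists m.
move=> g; rewrite !inE => /orP[] /eqP->.
  exists c'%:P; first by rewrite /unit0 at0C.
  by rewrite -ec; apply/gen2P; exists (cv%:P * su), (cu%:P * sv).
by apply: satW => //; apply: gen_mem; rewrite mem_head.
Qed.
End Curve.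

(** * Logarithmic derivatives on the branches of a curve *)

Section Branches.
Variable K : closedFieldType.
Hypothesis char0 : forall n, n.+1%:R != 0 :> K.
Notation R := {poly {poly K}}.
Notation yy := (yy K).
Notation bc := (@bc K).
Notation unit0 := (@unit0 K).
Notation len0 := (@len K R bc unit0).
Notation sat0 := (@sat R unit0).
Notation ev2b := (@ev2 K R bc).
Notation ev1b := (@ev1 K R bc).
Implicit Types (a b g h r s : R).
Let U1 : unit0 1 := unit01 K.
Let UM := @unit0M K.

Section LocalRing.
Variables (h : R) (L : fieldType) (phi : {rmorphism R -> L}).
Hypothesis hI : irr h.
Hypothesis phi0 : forall r, phi r = 0 <-> ker h r.
Hypothesis phi_frac : forall w, exists r (c : {poly K}), c != 0 /\ w = phi r / phi c%:P.

Definition iL : K -> L := phi \o bc.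
HB.instance Definition _ := GRing.RMorphism.copy iL (phi \o bc).

Definition locA (z : L) := exists r s, unit0 s /\ z = phi r / phi s.
Definition locm (z : L) := exists r s, [/\ at0 r = 0, unit0 s & z = phi r / phi s].

Lemma phi_unit s : unit0 s -> phi s != 0.
Proof. by move=> Us; apply/eqP => /phi0 /(ker_at0 hI) e; move: Us; rewrite /Submission.unit0 e eqxx. Qed.

Lemma phi_polyC (c : {poly K}) : c != 0 -> phi c%:P != 0.
Proof.
move=> c0; apply/eqP => /phi0 /(ker_size hI) e.
have : c%:P = 0 :> R by apply: e; apply: leq_ltn_trans (irr_size hI); exact: size_polyC_leq1.
by move/eqP; rewrite polyC_eq0 (negPf c0).
Qed.

Lemma locA_sr : subring iL locA.
Proof.
split.
- by move=> c; exists (bc c), 1; rewrite rmorph1 divr1.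
- move=> _ _ [r [s [Us ->]]] [r' [s' [Us' ->]]].
  exists (r * s' + r' * s), (s * s'); split; first exact: UM.
  by rewrite rmorphD !rmorphM addf_div // phi_unit.
- move=> _ _ [r [s [Us ->]]] [r' [s' [Us' ->]]].
  exists (r * r'), (s * s'); split; first exact: UM.
  by rewrite !rmorphM mulf_div.
Qed.

Lemma locA_phi r : locA (phi r).
Proof. by exists r, 1; rewrite rmorph1 divr1. Qed.

(** [sat_inv] inverts denominators modulo [r], so [R] already surjects onto the quotient of [locA]
    and its kernel is the saturated ideal. *)
Lemma locA_len r n : phi r != 0 -> len0 [:: h; r] n -> qdim iL locA (mulS (phi r) locA) n.
Proof.
move=> r0 dn.
have AAr : subsp iL (mulS (phi r) locA) := subsp_mulS _ (subsp_sr locA_sr).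
have inA v : mulS (phi r) locA (phi v) <-> sat0 (gen [:: h; r]) v.
  split=> [[_ [b [s [Us ->]]] e]|[s Us /gen2P [u [w e]]]].
    have : phi (s * v - r * b) = 0.
      rewrite rmorphB !rmorphM e mulrCA [phi s * _]mulrC divfK ?subrr //; exact: phi_unit.
    move=> /phi0 [c [t [c0 ec]]]; exists (c%:P * s); first by apply: UM => //; rewrite /Submission.unit0 at0C.
    apply/gen2P; exists t, (c%:P * b).
    have -> : c%:P * s * v = c%:P * (s * v - r * b) + c%:P * b * r by ring.
    by rewrite ec mulrC.
  exists (phi w / phi s); first by exists w, s.
  apply: (mulfI (phi_unit Us)); rewrite -rmorphM e rmorphD !rmorphM.
  have [_ _] := hI; have -> : phi h = 0 by apply/phi0/ker_mem; case: hI.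
  by move=> _; rewrite mulr0 add0r; field; apply: phi_unit.
apply: (@qdim_map K R L bc iL phi _ _ (fun=> True) (sat0 (gen [:: h; r])) locA (mulS (phi r) locA) n) => //.
- by move=> x z; rewrite rmorphD.
- by move=> c x; rewrite rmorphM.
- by move=> v _; apply: locA_phi.
- move=> _ [r' [s' [Us' ->]]].
  have [w hw] := sat_inv U1 UM Us' dn 1.
  exists (r' * w) => //.
  have /inA [_ [b [s [Us ->]]] e] := hw.
  exists (phi (r' * b) / phi (s * s')).
    by exists (r' * b), (s * s'); split=> //; apply: UM.
  rewrite !rmorphM; rewrite rmorphB rmorph1 rmorphM in e.
  have u := phi_unit Us; have u' := phi_unit Us'.
  have ew : phi w = (1 - phi r * (phi b / phi s)) / phi s' by rewrite -e; field.
  by rewrite ew; field; rewrite u u'.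
Qed.

Lemma locA_fin (a : L) : locA a -> a != 0 -> exists n, qdim iL locA (mulS a locA) n.
Proof.
move=> [r [s [Us ea]]] a0; have r0 : phi r != 0.
  by apply: contraNneq a0 => r0; rewrite ea r0 mul0r.
have [|n dn] := len_coprime hI (r := r); first by move/phi0/eqP; apply/negP.
exists n; apply: qdim_ext (locA_len r0 dn) => // x.
have u := phi_unit Us; have u1 := phi_unit U1.
split=> [[_ [b [t [Ut ->]]] ->]|[_ [b [t [Ut ->]]] ->]].
- exists (phi (s * b) / phi t); first by exists (s * b), t.
  by rewrite ea rmorphM; field; rewrite u phi_unit.
- exists (phi b / phi (s * t)); first by exists b, (s * t); split=> //; apply: UM.
  by rewrite ea rmorphM; field; rewrite u phi_unit.
Qed.

Lemma locm_locA z : locm z -> locA z.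
Proof. by move=> [r [s [_ Us ->]]]; exists r, s. Qed.

Lemma locm1 : ~ locm 1.
Proof.
move=> [r [s [r0 Us e]]]; have : phi (s - r) = 0.
  apply/eqP; rewrite rmorphB subr_eq0 eq_sym -(inj_eq (mulIf (invr_neq0 (phi_unit Us)))).
  by rewrite -e divff // phi_unit.
by move/phi0/(ker_at0 hI)/eqP; rewrite at0B r0 subr0; apply/negP.
Qed.

Lemma locmD x z : locm x -> locm z -> locm (x + z).
Proof.
move=> [r [s [r0 Us ->]]] [r' [s' [r0' Us' ->]]].
exists (r * s' + r' * s), (s * s'); split; last by rewrite rmorphD !rmorphM addf_div // phi_unit.
  by rewrite at0D !at0M r0 r0' !mul0r addr0.
exact: UM.
Qed.

Lemma locmM (a x : L) : locA a -> locm x -> locm (a * x).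
Proof.
move=> [r [s [Us ->]]] [r' [s' [r0' Us' ->]]].
exists (r * r'), (s * s'); split; last by rewrite !rmorphM mulf_div.
  by rewrite at0M r0' mulr0.
exact: UM.
Qed.

Lemma locm_unit (a : L) : locA a -> ~ locm a -> locA a^-1.
Proof.
move=> [r [s [Us ->]]] nm; exists s, r; rewrite invf_div; split=> //.
by apply/eqP => r0; apply: nm; exists r, s.
Qed.

Lemma locm_yy : locm (phi yy).
Proof. by exists yy, 1; rewrite at0yy rmorph1 divr1. Qed.

Lemma phi_yy0 : phi yy != 0.
Proof. by apply: phi_polyC; rewrite polyX_eq0. Qed.

Lemma locA_frac (w : L) : exists a b : L, [/\ locA a, locA b, b != 0 & w = a / b].
Proof.
have [r [c [c0 ->]]] := phi_frac w; exists (phi r), (phi c%:P).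
by split=> //; [exact: locA_phi|exact: locA_phi|exact: phi_polyC].
Qed.

Let crit := cic_criterion locA_sr locm_locA locm1 locmD locmM locm_unit locm_yy phi_yy0 locA_fin locA_frac.
Let ulen := unit_len locA_sr locA_fin.

Lemma ev1_phi p : ev1 iL (phi yy) p = phi p%:P.
Proof.
elim/poly_ind: p => [|p c ih]; first by rewrite ev10 polyC0 rmorph0.
by rewrite ev1D ev1M ev1X ev1C ih polyCD polyCM rmorphD rmorphM.
Qed.

Lemma ev_phi (P : R) (u : L) : (map_poly (fun p => phi p%:P) P).[u] = ev2 iL P u (phi yy).
Proof.
by rewrite /ev2; congr (_.[_]); apply: eq_map_poly => p; rewrite ev1_phi.
Qed.

Lemma ev_phi2 (P : R) g : phi (ev2b P g yy) = ev2 iL P (phi g) (phi yy).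
Proof.
have h1 p : phi (ev1b yy p) = ev1 iL (phi yy) p.
  elim/poly_ind: p => [|p c ih]; first by rewrite !ev10 rmorph0.
  by rewrite !ev1D !ev1M !ev1X !ev1C rmorphD rmorphM ih.
elim/poly_ind: P => [|P c ih]; first by rewrite !ev20 rmorph0.
by rewrite !ev2_cons rmorphD rmorphM ih h1.
Qed.

Hypothesis phi_alg : forall u, exists2 P : R, P != 0 & (map_poly (fun p => phi p%:P) P).[u] = 0.

(** An equation of least degree: its X-derivative is nonzero in characteristic 0 and of smaller
    degree, so it cannot vanish at [u]. *)
Lemma phi_minpoly u : exists P : R, ev2 iL P u (phi yy) = 0 /\ ev2 iL P^`() u (phi yy) != 0.
Proof.
have [P0 P0nz P0u] := phi_alg u; rewrite ev_phi in P0u.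
have [sz [P [Pnz Pu sP]] smin] := nat_min (P := fun k : nat => exists P : R,
   [/\ P != 0, ev2 iL P u (phi yy) = 0 & size P = k]) (ex_intro _ (size P0) (ex_intro _ P0 (And3 P0nz P0u erefl))).
exists P; split=> //; apply/eqP => e.
have s1 : (1 < size P)%N.
  rewrite ltnNge; apply/negP => /size1_polyC ec; move: Pu Pnz.
  rewrite ec -[X in ev2 _ X]add0r -[X in X + _](mul0r 'X) ev2_cons ev20 mul0r add0r ev1_phi polyC_eq0.
  by move/eqP=> p0 /phi_polyC /negP.
apply: (smin (size P^`())); first by rewrite -sP lt_size_deriv.
by exists P^`(); split=> //; apply: (deriv_neq0 char0).
Qed.

(** For [z] = y g_y / g, [dvr_log_deriv] shows that [z] and 1 + z are units in every dominating
    valuation ring, hence units of the integral closure. So z g and (1 + z) g both have the colength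
    of g. *)
Lemma phi_log_deriv g : at0 g = 0 -> ker h g^`() -> ~ ker h g ->
  exists2 n, len0 [:: h; yy * dy g] n /\ len0 [:: h; g + yy * dy g] n &
    ~ ker h (yy * dy g) /\ ~ ker h (g + yy * dy g).
Proof.
move=> g0 kgx kg; have [ih h0 ah0] := hI.
have u0 : phi g != 0 by apply/eqP => /phi0.
have [P [Pu Pu']] := phi_minpoly (phi g).
have PD : ev2 iL P^`() (phi g) (phi yy) * phi (dy g) + ev2 iL (map_poly deriv P) (phi g) (phi yy) = 0.
  have hx0 : phi h^`() != 0.
    apply/eqP => /phi0 /(ker_size hI) e.
    have sh := irr_size hI; have := deriv_neq0 char0 sh.
    rewrite e ?eqxx // lt_size_deriv // -size_poly_gt0; exact: ltnW.
  (* Apply {h, .} to the equation of [g]: {h, y} is h_x, and {h, g} is h_x g_y because g_x vanishes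
     on the curve. The factor h_x is nonzero there for degree reasons. *)
  have : phi (pbr h (ev2b P g yy)) = 0.
    by apply/phi0; apply: ker_pbr => //; apply/phi0; rewrite ev_phi2.
  rewrite (@ev2_deriv K R bc (pbr h)); [|exact: pbrD|exact: pbrM|exact: pbrC].
  have -> : pbr h yy = h^`() by rewrite /pbr dyyy derivyy mulr1 mulr0 subr0.
  rewrite rmorphD !rmorphM !ev_phi2 /pbr rmorphB !rmorphM.
  have -> : phi g^`() = 0 by apply/phi0.
  rewrite mulr0 subr0 mulrCA [_ * phi h^`()]mulrC -mulrDr => /eqP.
  by rewrite mulf_eq0 (negPf hx0) => /eqP.
pose z := phi yy * phi (dy g) / phi g.
have key O t : dvr iL O t -> (forall x, locA x -> O x) ->
    (forall x, locm x -> exists2 w, O w & x = t * w) ->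
    [/\ O z, O z^-1, O (1 + z), O (1 + z)^-1 & z != 0 /\ 1 + z != 0].
  move=> dO AO mO; have y0 := phi_yy0.
  have [||||c [w [Ow c0 c1 ez]]] := dvr_log_deriv char0 dO _ _ u0 y0 _ _ Pu Pu' PD.
  - exact/AO/locA_phi.
  - exact/AO/locA_phi.
  - by apply: mO; exists g, 1; rewrite g0 rmorph1 divr1.
  - exact/mO/locm_yy.
  have [z0 Ozv] := dvr_unit dO Ow c0; have [z1 Ozv1] := dvr_unit dO Ow c1.
  rewrite -/z in ez; have e1 : 1 + z = iL (1 + c) + t * w by rewrite rmorphD rmorph1 ez addrA.
  have sO := dvr_sr dO.
  have inO e : O (iL e + t * w).
    by apply: (srD sO); [exact: (srC sO)|apply: (srM sO) => //; exact: (dvr_t dO)].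
  by rewrite e1 ez; split.
have c1 : cic locA z by apply: crit => O t dO AO mO; case: (key O t dO AO mO).
have c2 : cic locA z^-1 by apply: crit => O t dO AO mO; case: (key O t dO AO mO).
have c3 : cic locA (1 + z) by apply: crit => O t dO AO mO; case: (key O t dO AO mO).
have c4 : cic locA (1 + z)^-1 by apply: crit => O t dO AO mO; case: (key O t dO AO mO).
have A1 : locA 1 by exists 1, 1; rewrite divff // phi_unit.
have sA := subsp_sr locA_sr.
(* A single dominating valuation ring would settle this. If there were none, the criterion would
   hold vacuously, every element would be integral, and y would have the colength of 1 although it
   lies in the maximal ideal. *)
have [z0 z1] : z != 0 /\ 1 + z != 0.
  apply: NNPP => nz.
  have all w : cic locA w by apply: crit => O t dO AO mO; case: nz; case: (key O t dO AO mO).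
  have d1 : qdim iL locA (mulS 1 locA) 0.
    by apply/qdim0P; [exact: subsp_mulS|move=> x Ax; exists x; rewrite ?mul1r].
  have := ulen A1 (locA_phi yy) (oner_neq0 _) phi_yy0 (all _) (all _) d1.
  move/(qdim0P _ (subsp_mulS (phi yy) sA)) => /(_ 1 A1) [w Aw e].
  by apply: locm1; rewrite e mulrC; apply: locmM => //; apply: locm_yy.
have ea : phi (yy * dy g) = z * phi g by rewrite rmorphM /z divfK.
have eb : phi (g + yy * dy g) = (1 + z) * phi g by rewrite rmorphD ea mulrDl mul1r.
have na : phi (yy * dy g) != 0 by rewrite ea mulf_neq0.
have nb : phi (g + yy * dy g) != 0 by rewrite eb mulf_neq0.
have ka : ~ ker h (yy * dy g) by move/phi0/eqP; apply/negP.
have kb : ~ ker h (g + yy * dy g) by move/phi0/eqP; apply/negP.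
have [n dn] := len_coprime hI ka; have [m dm] := len_coprime hI kb.
exists n; split=> //.
have [k dk] := len_coprime hI kg.
have Ag := locA_phi.
have lg := locA_len u0 dk.
have la := locA_len na dn; have lb := locA_len nb dm.
have l1 : qdim iL locA (mulS (phi (yy * dy g)) locA) k.
  by apply: ulen lg => //; rewrite ea ?mulfK // invfM mulrCA divff // mulr1.
have l2 : qdim iL locA (mulS (phi (g + yy * dy g)) locA) k.
  by apply: ulen lg => //; rewrite eb ?mulfK // invfM mulrCA divff // mulr1.
have e1 := qdim_uniq (subsp_mulS _ sA) la l1.
have e2 := qdim_uniq (subsp_mulS _ sA) lb l2.
by rewrite -e1 in e2; rewrite -e2.
Qed.
End LocalRing.

Lemma irr_log_deriv h g : irr h -> at0 g = 0 -> ker h g^`() -> ~ ker h g ->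
  exists2 n, len0 [:: h; yy * dy g] n /\ len0 [:: h; g + yy * dy g] n &
    ~ ker h (yy * dy g) /\ ~ ker h (g + yy * dy g).
Proof.
move=> hI; have [L [phi [h1 h2 h3]]] := function_field hI.
exact: (phi_log_deriv hI h1 h2 h3).
Qed.
End Branches.

Section LocalNumbers.
Variable K : closedFieldType.
Hypothesis char0 : forall n, n.+1%:R != 0 :> K.
Notation R := {poly {poly K}}.
Notation yy := (yy K).
Notation bc := (@bc K).
Notation unit0 := (@unit0 K).
Notation len0 := (@len K R bc unit0).
Notation sat0 := (@sat R unit0).
Implicit Types (a b g h r s : R).
Let U1 : unit0 1 := unit01 K.
Let UM := @unit0M K.
Let len_colon0 := @len_colon K R bc unit0 U1 UM.
Let len_ext0 := @len_ext K R bc unit0 U1 UM.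
Let len_incl0 := @len_incl K R bc unit0 U1 UM.

(** * Milnor and Tjurina numbers of a curve and of its union with a line *)

Lemma irreducible_factor (F : fieldType) (p : {poly F}) : (1 < size p)%N ->
  exists2 q, irreducible_poly q & q %| p.
Proof.
move=> sp; have p0 : p != 0 by rewrite -size_poly_gt0 ltnW.
have [k [q [sq qp ek]] kmin] := nat_min (P := fun k : nat => exists q : {poly F}, [/\ (1 < size q)%N, q %| p & size q = k])
  (ex_intro _ _ (ex_intro _ p (And3 sp (dvdpp p) erefl))).
exists q => //; split=> // r sr rq.
have q0 : q != 0 by rewrite -size_poly_gt0 ltnW.
rewrite -dvdp_size_eqp // eqn_leq dvdp_leq //= leqNgt; apply/negP => h.
apply: (kmin (size r)); first by rewrite -ek.
exists r; split=> //; last exact: dvdp_trans qp.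
have : (0 < size r)%N by rewrite size_poly_gt0; apply: contraNneq q0 => r0; rewrite -dvd0p -r0.
by case: (size r) sr => [|[]].
Qed.

Lemma ker_factor G : ry G != 0 -> (1 < size G)%N ->
  exists h, [/\ irreducible_poly (fr h), ry h != 0 & ker h G].
Proof.
move=> G0 sG; have [|p ip pG] := @irreducible_factor _ (fr G); first by rewrite size_fr.
have [c [s [c0 es]]] := fr_clear p.
have fc0 : tofrac c != 0 by rewrite tofrac_eq0.
have p0 : p != 0 by rewrite -size_poly_gt0 ltnW //; case: ip.
have ps : fr s %= p by rewrite -es frC mul_polyC eqp_scale.
have s0 : s != 0 by rewrite -fr_eq0 -size_poly_gt0 (eqp_size ps) size_poly_gt0.
have [k [h [eh h0]]] := y_strip s0.
have hp : fr h %= p.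
  apply: eqp_trans ps; rewrite eh frM.
  have -> : fr (yy ^+ k) = (tofrac ('X ^+ k))%:P by rewrite -frC /Submission.yy polyC_exp.
  have t0 : tofrac ('X ^+ k : {poly K}) != 0 by rewrite tofrac_eq0 expf_neq0 // polyX_eq0.
  move: (tofrac _) t0 => t t0; rewrite mulrC mul_polyC eqp_sym; exact: eqp_scale.
exists h; split=> //.
  case: ip => sp ip; split; first by rewrite (eqp_size hp).
  move=> q sq qh; have : q %= p by apply: ip => //; rewrite -(eqp_dvdr _ hp).
  by move/eqp_trans; apply; rewrite eqp_sym.
by apply/ker_dvd => //; rewrite (eqp_dvdl _ hp).
Qed.

(** Additivity over the factors of [G]: if c G = h k with c a unit and d is regular modulo h, the
    colength of (G, d) is the sum of those of (h, d) and (k, d). A factor not through the origin is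
    a unit. *)
Lemma len_prod G a b : ry G != 0 ->
  (forall h, irr h -> ker h G -> (~ ker h a /\ ~ ker h b) /\ exists n, len0 [:: h; a] n /\ len0 [:: h; b] n) ->
  exists n, len0 [:: G; a] n /\ len0 [:: G; b] n.
Proof.
have [N] := ubnP (size G); elim: N G => // N IH G sN G0 hG.
have [sG|sG] := leqP (size G) 1.
  exists 0%N; have UG : unit0 G.
    move: G0; rewrite (size1_polyC sG) /Submission.unit0 at0C ryC => h.
    by apply: contraNneq h => ->.
  by split; apply: (len_unit _ U1 UM); exists G => //; apply: gen_mem; rewrite mem_head.
have [h [ih h0 kh]] := ker_factor G0 sG; have [c [k [c0 e]]] := kh.
have Uc : unit0 c%:P by rewrite /Submission.unit0 at0C.
have k0 : ry k != 0.
  apply: contraNneq G0 => k0; move/(congr1 (@ry K)): e; rewrite !rmorphM /= k0 mulr0 ryC => /eqP.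
  by rewrite mulf_eq0 polyC_eq0 (negPf c0).
have sk : (size k < N)%N.
  have c1 : c != 0 by apply: contraNneq c0 => ->; rewrite horner0.
  have k1 : k != 0 by apply: contraNneq k0 => ->; rewrite rmorph0.
  have h1 : h != 0 by apply: contraNneq h0 => ->; rewrite rmorph0.
  have sh : (1 < size h)%N by rewrite -size_fr; case: ih.
  have : size (c%:P * G) = size G by rewrite mul_polyC size_scale.
  rewrite e size_mul // => eG; apply: leq_trans (sN : (size G <= N)%N).
  by rewrite -eG; case: (size h) sh => [|[|n]] // _; rewrite !addSn /= ltnS leq_addl.
have [|n [dna dnb]] := IH k sk k0.
  move=> h' ih' [c' [k' [c'0 e']]]; apply: hG => //.
  exists (c' * c), (h * k'); rewrite hornerM mulf_neq0 //; split=> //.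
  by rewrite polyCM -mulrA e mulrCA e' mulrCA.
have Gk d : sat0 (gen [:: k; d]) G.
  by exists c%:P => //; rewrite e; apply/gen2P; exists h, 0; rewrite mul0r addr0.
have [ah|ah] := eqVneq (at0 h) 0; last first.
  exists n; have kG d : sat0 (gen [:: G; d]) k.
    by exists h => //; rewrite -e; apply/gen2P; exists c%:P, 0; rewrite mul0r addr0.
  have ext d : len0 [:: k; d] n -> len0 [:: G; d] n.
    apply: len_ext0 => x; rewrite !inE => /orP[]/eqP-> //; apply: satW => //;
      by apply: gen_mem; rewrite !inE eqxx orbT.
  by split; apply: ext.
have hI : irr h by [].
have [[na nb] [m [dma dmb]]] := hG h hI kh.
have h1 : h != 0 by apply: contraNneq h0 => ->; rewrite rmorph0.
have ext d : ~ ker h d -> len0 [:: k; d] n -> len0 [:: h; d] m -> len0 [:: G; d] (n + m).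
  move=> nd dn dm; apply: (len_colon0 (a := h) _ dn) => [r|].
    split=> [[s Us /gen2P [u [v E]]]|[s Us /gen2P [u [v E]]]]; last first.
      exists s => //; apply/gen2P; exists (u * c%:P), (v * h).
      by rewrite mulrCA E mulrDr -[u * c%:P * G]mulrA e; ring.
    have E' : h * (c%:P * s * r - u * k) = c%:P * v * d.
      rewrite mulrBr [h * (u * k)]mulrCA -e.
      have -> : h * (c%:P * s * r) = c%:P * (s * (h * r)) by ring.
      by rewrite E; ring.
    have [|[c' [w [c'0 ew]]]|//] := @ker_irr_prime _ h (c%:P * v) d hI.
      by exists 1, (c%:P * s * r - u * k); rewrite E' hornerC oner_neq0 polyC1 mul1r.
    exists (c'%:P * c%:P * s); first by apply: UM => //; apply: UM => //; rewrite /Submission.unit0 at0C.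
    apply/gen2P; exists (c'%:P * u), w; apply: (mulfI h1).
    have -> : h * (c'%:P * c%:P * s * r) = c'%:P * (h * (c%:P * s * r - u * k)) + c'%:P * u * (h * k) by ring.
    by rewrite E' mulrA ew; ring.
  apply: len_ext0 dm => x; rewrite !inE.
    by case/orP => /eqP->; apply: satW => //; apply: gen_mem; rewrite !inE eqxx ?orbT.
  case/or3P => /eqP->; try by apply: satW => //; apply: gen_mem; rewrite !inE eqxx ?orbT.
  by exists c%:P => //; rewrite e; apply/gen2P; exists k, 0; rewrite mul0r addr0 mulrC.
by exists (n + m)%N; split; apply: ext.
Qed.

Definition locally_reduced g :=
  forall h, irr h -> ~ exists (c : {poly K}) s, c.[0] != 0 /\ c%:P * g = h * h * s.

(** If h divided both g = h s and g_x, it would divide h_x s, hence s since h_x has smaller degree,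
    and g would contain the square of h. *)
Lemma locally_reduced_ker g h : locally_reduced g -> irr h -> ker h g^`() -> ~ ker h g.
Proof.
move=> lr hI kx [c [s [c0 e]]]; apply: (lr h hI).
have [_ h0 _] := hI; have [k1 k2 k3] := ker_ideal h0.
have : ker h (h^`() * s).
  have -> : h^`() * s = c%:P * g^`() - s^`() * h.
    move/(congr1 (fun p : R => p^`())): e; rewrite !derivM derivC mul0r add0r => ->; ring.
  apply: (idealB (ker_ideal h0)); apply: k3 => //; exact: ker_mem.
move/(ker_irr_prime hI) => [/(ker_size hI)|[c' [s' [c'0 e']]]].
  have sh := irr_size hI; rewrite lt_size_deriv -?size_poly_gt0 ?(ltnW sh) // => /(_ isT) h1.
  by have := deriv_neq0 char0 sh; rewrite h1 eqxx.
exists (c' * c), s'; rewrite hornerM mulf_neq0 //; split=> //.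
by rewrite polyCM -mulrA e mulrCA e' mulrA.
Qed.

Lemma ry_deriv r : ry r^`() = (ry r)^`().
Proof. by rewrite /ry deriv_map. Qed.

Section AtPoint.
Variables (g : R) (i : nat) (b : {poly K}).
Hypothesis eg : ry g = b * 'X^(i.+1).
Hypothesis b0 : b.[0] != 0.
Hypothesis g_red : locally_reduced g.
Notation w := (g + yy * dy g).

Lemma dyyg : dy (yy * g) = w.
Proof. by rewrite dyM dyyy mul1r. Qed.
Lemma dxyg : (yy * g)^`() = yy * g^`().
Proof. by rewrite derivM derivyy mul0r add0r. Qed.

Lemma ry_g0 : ry g != 0.
Proof.
rewrite eg mulf_neq0 ?expf_neq0 ?polyX_eq0 //.
by apply: contraNneq b0 => ->; rewrite horner0.
Qed.

Lemma ry_w : ry w = ry g.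
Proof. by rewrite rmorphD rmorphM /= ryyy mul0r addr0. Qed.

Lemma len_yg : len0 [:: yy; g] i.+1.
Proof. exact: len_y eg b0. Qed.

Lemma ry_gx : exists2 d : {poly K}, ry g^`() = d * 'X^i & d.[0] != 0.
Proof.
exists (b^`() * 'X + b *+ i.+1).
  by rewrite ry_deriv eg derivM derivXn /= mulrDl -mulrA -exprS mulrnAr mulrnAl.
by rewrite hornerD hornerMX mulr0 add0r hornerMn -mulr_natr mulf_neq0 // char0.
Qed.

(** The intersection multiplicity is [i.+1]. Passing from (g_x, y g_y) to (g_x, g_y) costs the
    length i of (y, g_x), differentiation in x lowering the order by one; passing from (y g_x, w) to
    (g_x, w) costs the length i + 1 of (y, g). The two middle ideals have equal colength by
    [len_prod]. *)
Theorem milnor_local : exists m, len0 [:: g^`(); dy g] m /\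
  len0 [:: (yy * g)^`(); dy (yy * g)] (m + i + i.+1).
Proof.
have [d ed d0] := ry_gx.
have gx0 : ry g^`() != 0.
  rewrite ed mulf_neq0 ?expf_neq0 ?polyX_eq0 //.
  by apply: contraNneq d0 => ->; rewrite horner0.
have ag : at0 g = 0 by rewrite /at0 eg hornerM hornerXn expr0n mulr0.
have [|n [dna dnb]] := @len_prod g^`() (yy * dy g) w gx0.
  move=> h hI kx; have kg := locally_reduced_ker g_red hI kx.
  by have [n [d1 d2] [k1 k2]] := irr_log_deriv char0 hI ag kx kg; split=> //; exists n.
have lenyx : len0 [:: yy; g^`()] i by exact: len_y ed d0.
have [|m dm _] := len_incl0 (hs := [:: g^`(); dy g]) _ dna.
  move=> x; rewrite !inE => /orP[]/eqP->; apply: satW => //.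
    by apply: gen_mem; rewrite mem_head.
  by apply/gen2P; exists 0, yy; rewrite mul0r add0r.
exists m; split=> //.
have en : n = (m + i)%N.
  apply: (len_uniq0 dna); apply: (len_colon0 (a := yy) _ dm) => [r|].
    split=> [[s Us /gen2P [u [v E]]]|[s Us /gen2P [u [v E]]]]; exists s => //; apply/gen2P.
      have [|u' eu] := y_prime (b := u) gx0.
        exists (s * r - v * dy g); have -> : g^`() * u = s * (yy * r) - v * (yy * dy g) by rewrite E; ring.
        by ring.
      exists u', v; apply: (mulfI (yy0 K)); rewrite mulrCA E eu; ring.
    by exists (u * yy), v; rewrite mulrCA E; ring.
  apply: len_ext0 lenyx => x; rewrite !inE.
    by case/orP => /eqP->; apply: satW => //; apply: gen_mem; rewrite !inE eqxx ?orbT.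
  case/or3P => /eqP->; apply: satW => //; try by apply: gen_mem; rewrite !inE eqxx ?orbT.
  by apply/gen2P; exists (dy g), 0; rewrite mul0r addr0 mulrC.
rewrite -en dyyg dxyg.
apply: (len_colon0 (a := yy) _ dnb) => [r|].
  split=> [[s Us /gen2P [u [v E]]]|[s Us /gen2P [u [v E]]]]; exists s => //; apply/gen2P.
    have [||v' ev] := @y_prime _ w v; first by rewrite ry_w ry_g0.
      exists (s * r - u * g^`()); have -> : w * v = s * (yy * r) - u * (yy * g^`()) by rewrite E; ring.
      by ring.
    exists u, v'; apply: (mulfI (yy0 K)); rewrite mulrCA E ev; ring.
  by exists u, (v * yy); rewrite mulrCA E; ring.
apply: len_ext0 len_yg => x; rewrite !inE.
  case/orP => /eqP->; apply: satW => //; first by apply: gen_mem; rewrite !inE eqxx ?orbT.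
  by apply/gen3P; exists (- dy g), 0, 1; ring.
case/or3P => /eqP->; apply: satW => //; first by apply: gen_mem; rewrite !inE eqxx ?orbT.
  by apply/gen2P; exists g^`(), 0; ring.
by apply/gen2P; exists (dy g), 1; ring.
Qed.

Variables (q : R) (l : nat) (e : {poly K}).
Hypothesis eq : ry q = e * 'X^l.
Hypothesis e0 : e.[0] != 0.
Hypothesis q1 : sat0 (gen [:: g; g^`()]) (q * dy g).
Hypothesis q2 : forall c, gen [:: g; g^`()] (c * dy g) -> sat0 (gen [:: yy; q]) c.

(** [q1] and [q2] say that the colon of (g, g_x, y g_y) by g_y is (y, q), of length [l]. The colon
    of (y g, y g_x, w) by y is (g, g_x, y g_y), with quotient (y, g) of length [i.+1]. *)
Theorem tjurina_local : exists t, len0 [:: g; g^`(); dy g] t /\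
  len0 [:: yy * g; (yy * g)^`(); dy (yy * g)] (t + i.+1 + l).
Proof.
have [m [dm _]] := milnor_local.
have [|t dt _] := len_incl0 (hs := [:: g; g^`(); dy g]) _ dm.
  by move=> x hx; apply: satW => //; apply: gen_mem; rewrite inE hx orbT.
exists t; split=> //.
have dyq : len0 [:: yy; q] l by exact: len_y eq e0.
have dh : len0 [:: g; g^`(); yy * dy g] (l + t).
  apply: (len_colon0 (a := dy g) _ dyq) => [r|].
    split=> [[s Us /gen3P [u [v [z E]]]]|[s Us /gen2P [u [v E]]]].
      apply: (satT UM Us); have -> : s * r = (s * r - z * yy) + z * yy by ring.
      have [_ iD iM] := ideal_satgen U1 UM [:: yy; q]; apply: iD.
        apply: q2; apply/gen2P; exists u, v.
        have -> : (s * r - z * yy) * dy g = s * (dy g * r) - z * (yy * dy g) by ring.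
        by rewrite E; ring.
      by apply: iM; apply: satW => //; apply: gen_mem; rewrite mem_head.
    apply: (satT UM Us); have -> : s * (dy g * r) = u * (yy * dy g) + v * (q * dy g).
      by rewrite mulrCA E; ring.
    have [_ iD iM] := ideal_satgen U1 UM [:: g; g^`(); yy * dy g]; apply: iD; apply: iM.
      by apply: satW => //; apply: gen_mem; rewrite !inE eqxx ?orbT.
    apply: sat_incl q1 => x; apply: gen_incl => [|y]; first exact: gen_ideal.
    by rewrite !inE => /orP[] /eqP->; apply: gen_mem; rewrite !inE eqxx ?orbT.
  apply: len_ext0 dt => x; rewrite !inE.
    by case/or3P => /eqP->; apply: satW => //; apply: gen_mem; rewrite !inE eqxx ?orbT.
  case/or4P => /eqP->; apply: satW => //; try by apply: gen_mem; rewrite !inE eqxx ?orbT.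
  by apply/gen3P; exists 0, 0, yy; ring.
rewrite dyyg dxyg; have -> : (t + i.+1 + l = (l + t) + i.+1)%N by lia.
apply: (len_colon0 (a := yy) _ dh) => [r|].
  split=> [[s Us /gen3P [u [v [z E]]]]|[s Us /gen3P [u [v [z E]]]]]; exists s => //; apply/gen3P.
    have [||z' ez] := @y_prime _ w z; first by rewrite ry_w ry_g0.
      exists (s * r - u * g - v * g^`()).
      have -> : w * z = s * (yy * r) - u * (yy * g) - v * (yy * g^`()) by rewrite E; ring.
      by ring.
    exists (u + z'), v, z'; apply: (mulfI (yy0 K)); rewrite mulrCA E ez; ring.
  by exists (u - z), v, (z * yy); rewrite mulrCA E; ring.
apply: len_ext0 len_yg => x; rewrite !inE.
  case/orP => /eqP->; apply: satW => //; first by apply: gen_mem; rewrite !inE eqxx ?orbT.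
  by exists (- dy g), w; split; [apply: gen_mem; rewrite !inE eqxx ?orbT|ring].
case/or4P => /eqP->; apply: satW => //; first by apply: gen_mem; rewrite !inE eqxx ?orbT.
- by apply/gen2P; exists g, 0; ring.
- by apply/gen2P; exists g^`(), 0; ring.
- by apply/gen2P; exists (dy g), 1; ring.
Qed.
End AtPoint.
End LocalNumbers.

(** * Homogeneous polynomials and affine charts *)

Section Homogeneous.
Variables (K : fieldType).
Notation S := {mpoly K[3]}.
Implicit Types (F G : S).

Lemma mpoly_gen_ind (P : S -> Prop) :
  (forall c, P c%:MP) -> (forall i, P 'X_i) -> (forall F G, P F -> P G -> P (F + G)) ->
  (forall F G, P F -> P G -> P (F * G)) -> forall F, P F.
Proof.
move=> PC PX PD PM F; rewrite (mpolyE F).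
apply: big_ind => // [|m _]; first by rewrite -(mpolyC0 3 K).
rewrite -mul_mpolyC; apply: (PM) => //; rewrite mpolyXE_id.
apply: big_ind => [|G1 G2 h1 h2|i _]; [by rewrite -(mpolyC1 3 K)|exact: (PM)|].
elim: (m i) => [|k ih]; first by rewrite expr0 -(mpolyC1 3 K).
by rewrite exprS; apply: PM.
Qed.

Lemma mpoly_morph_eq (A : comNzRingType) (f g : {rmorphism S -> A}) :
  (forall c, f c%:MP = g c%:MP) -> (forall i, f 'X_i = g 'X_i) -> forall F, f F = g F.
Proof.
move=> hC hX; apply: mpoly_gen_ind => //= F G hF hG; first by rewrite !rmorphD hF hG.
by rewrite !rmorphM hF hG.
Qed.

Lemma mpoly_morph_cong (A : comNzRingType) (I : A -> Prop) (f g : {rmorphism S -> A}) : ideal I ->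
  (forall c, f c%:MP = g c%:MP) -> (forall i, I (f 'X_i - g 'X_i)) -> forall F, I (f F - g F).
Proof.
move=> [I0 ID IM] hC hX; apply: mpoly_gen_ind => [c|i|F G hF hG|F G hF hG] //.
- by rewrite hC subrr.
- by rewrite !rmorphD opprD addrACA; apply: ID.
- have -> : f (F * G) - g (F * G) = f F * (f G - g G) + g G * (f F - g F) by rewrite !rmorphM; ring.
  by apply: ID; apply: IM.
Qed.

Lemma homog_scale (A : comNzRingType) (f g : {rmorphism S -> A}) (a : A) N F :
  (forall c, f c%:MP = g c%:MP) -> (forall i, f 'X_i = a * g 'X_i) ->
  F \is N.-homog -> f F = a ^+ N * g F.
Proof.
move=> hC hX /dhomogP hF; rewrite (mpolyE F) !raddf_sum mulr_sumr /= big_seq [RHS]big_seq.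
apply: eq_bigr => m /hF /= em.
rewrite -mul_mpolyC !rmorphM /= hC mulrCA; congr (_ * _).
rewrite mpolyXE_id !rmorph_prod /=.
rewrite -em mdegE -prodrXr -big_split /=; apply: eq_bigr => i _.
by rewrite !rmorphXn /= hX exprMn.
Qed.

Lemma pihomogM d k F G : F \is d.-homog -> pihomog mdeg (d + k) (F * G) = F * pihomog mdeg k G.
Proof.
move=> hF; pose n := (msize G + k.+1)%N.
rewrite {1}(pihomog_partitionE (mf := mdeg) (k := n) (p := G)); last exact: leq_addr.
rewrite mulr_sumr raddf_sum /=.
have kn : (k < n)%N by rewrite /n addnS ltnS leq_addl.
rewrite (bigD1 (Ordinal kn)) //= big1 ?addr0 => [|j jk].
  by rewrite pihomog_dE // dhomogM // pihomogP.
apply: (pihomog_ne0 (d := (d + j)%N)); last by rewrite dhomogM // pihomogP.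
by rewrite eqn_add2l; apply: contraNneq jk => e; apply/eqP/val_inj.
Qed.

Lemma homog_quot d e F G : F != 0 -> F \is d.-homog -> F * G \is e.-homog -> G != 0 ->
  (d <= e)%N /\ G \is (e - d).-homog.
Proof.
move=> F0 hF hFG G0.
have h k : (d + k)%N != e -> pihomog mdeg k G = 0.
  move=> ne; apply: (mulfI F0); rewrite mulr0 -(pihomogM k G hF).
  by apply: pihomog_ne0 hFG; rewrite eq_sym.
have de : (d <= e)%N.
  rewrite leqNgt; apply: contraNN G0 => ed; apply/eqP.
  rewrite (pihomog_partitionE (mf := mdeg) (k := msize G) (p := G)) // big1 // => k _.
  by apply: h; rewrite gtn_eqF // ltn_addr.
split=> //.
rewrite (pihomog_partitionE (mf := mdeg) (k := msize G) (p := G)) //.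
apply: rpred_sum => k _; have [<-|ne] := eqVneq (k : nat) (e - d)%N; first exact: pihomogP.
by rewrite h ?dhomog0 //; apply: contraNneq ne => <-; rewrite addKn.
Qed.

End Homogeneous.

Definition e0 : 'I_3 := @Ordinal 3 0 isT.
Definition e1 : 'I_3 := @Ordinal 3 1 isT.
Definition e2 : 'I_3 := @Ordinal 3 2 isT.

Lemma sum3 (V : nmodType) (F : 'I_3 -> V) : \sum_i F i = F e0 + F e1 + F e2.
Proof.
rewrite !big_ord_recl big_ord0 addr0 addrA.
by congr (F _ + F _ + F _); apply: val_inj.
Qed.

Lemma ord3P (P : 'I_3 -> Prop) : P e0 -> P e1 -> P e2 -> forall i, P i.
Proof.
move=> h0 h1 h2 [[|[|[|//]]] hi].
- by have -> : Ordinal hi = e0 by apply: val_inj.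
- by have -> : Ordinal hi = e1 by apply: val_inj.
- by have -> : Ordinal hi = e2 by apply: val_inj.
Qed.

(** Basis vectors [B a] with dual linear forms [D a]. Throughout, index [e1] belongs to the equation
    of the line, index [e2] to the form set to 1 in the chart; [B e2] is the origin of the chart and
    [B e0] the point at infinity of the line. *)
Record frame (K : fieldType) (B D : 'I_3 -> 'I_3 -> K) := Frame {
  frame_dual : forall a b, \sum_i D a i * B b i = (a == b)%:R;
  frame_span : forall i j, \sum_a B a i * D a j = (i == j)%:R }.

Section Psi.
Variable K : closedFieldType.
Notation S := {mpoly K[3]}.
Notation R := {poly {poly K}}.
Notation yy := (yy K).
Notation bc := (@bc K).
Implicit Types (F G : S) (r : R).
Variables (B D : 'I_3 -> 'I_3 -> K).
Hypothesis BD : frame B D.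

Definition lam a : S := \sum_i D a i *: 'X_i.

(** Restriction to the affine plane B2 + x B0 + y B1, where [lam e2 = 1]. *)
Definition psi : {rmorphism S -> R} :=
  mmap bc (fun i => bc (B e0 i) * 'X + bc (B e1 i) * yy + bc (B e2 i)).

Lemma psiC c : psi c%:MP = bc c.
Proof. exact: mmapC. Qed.

Lemma psiX i : psi 'X_i = bc (B e0 i) * 'X + bc (B e1 i) * yy + bc (B e2 i).
Proof. by rewrite /psi /= mmapX mmap1U. Qed.

Lemma lam_homog a : lam a \is 1.-homog.
Proof. by apply: rpred_sum => i _; apply: dhomogZ; rewrite dhomogX /= mdeg1. Qed.

Lemma lam_morph (A : comNzRingType) (f : {rmorphism S -> A}) (j : {rmorphism K -> A}) a :
  (forall c, f c%:MP = j c) -> f (lam a) = \sum_i j (D a i) * f 'X_i.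
Proof.
move=> hC; rewrite /lam rmorph_sum; apply: eq_bigr => i _.
by rewrite -mul_mpolyC rmorphM hC.
Qed.

Lemma psi_lam a : psi (lam a) = bc (a == e0)%:R * 'X + bc (a == e1)%:R * yy + bc (a == e2)%:R.
Proof.
rewrite (lam_morph (j := bc)); last exact: psiC.
rewrite -!(frame_dual BD) !rmorph_sum /= !mulr_suml -!big_split /=.
by apply: eq_bigr => i _; rewrite psiX !rmorphM; ring.
Qed.

Lemma psi_lam0 : psi (lam e0) = 'X.
Proof. by rewrite psi_lam /= rmorph1 rmorph0 mul1r mul0r !addr0. Qed.
Lemma psi_lam1 : psi (lam e1) = yy.
Proof. by rewrite psi_lam /= rmorph1 rmorph0 mul1r mul0r add0r addr0. Qed.
Lemma psi_lam2 : psi (lam e2) = 1.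
Proof. by rewrite psi_lam /= rmorph1 rmorph0 !mul0r !add0r. Qed.

Lemma X_lam i : 'X_i = \sum_a B a i *: lam a.
Proof.
have -> : \sum_a B a i *: lam a = \sum_j (\sum_a B a i * D a j) *: 'X_j.
  under [LHS]eq_bigr => a _ do rewrite /lam scaler_sumr.
  rewrite exchange_big /=; apply: eq_bigr => j _.
  by rewrite scaler_suml; apply: eq_bigr => a _; rewrite scalerA.
rewrite (bigD1 i) //= [X in _ + X]big1 => [|j ji]; first by rewrite (frame_span BD) eqxx scale1r addr0.
by rewrite (frame_span BD) eq_sym (negPf ji) scale0r.
Qed.

Lemma lam_eval a b : (lam a).@[B b] = (a == b)%:R.
Proof.
rewrite -(frame_dual BD) /lam raddf_sum /=; apply: eq_bigr => i _; by rewrite mevalZ mevalXU.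
Qed.

Lemma lam_neq0 a : lam a != 0.
Proof. by apply/eqP => e; have /eqP := lam_eval a a; rewrite e meval0 eqxx eq_sym oner_eq0. Qed.

Lemma at0_psi F : at0 (psi F) = F.@[B e2].
Proof.
move: F; apply: (mpoly_gen_ind (P := fun F => at0 (psi F) = F.@[B e2])) => [c|i|F G hF hG|F G hF hG].
- by rewrite psiC at0bc mevalC.
- have at0X : at0 ('X : R) = 0 by rewrite /at0 ryX hornerX.
  by rewrite psiX !at0D !at0M at0yy at0X !at0bc mevalXU !mulr0 !add0r.
- by rewrite rmorphD at0D hF hG mevalD.
- by rewrite rmorphM at0M hF hG mevalM.
Qed.

Definition dird (v : 'I_3 -> K) F : S := \sum_i v i *: F^`M(i).

Lemma dirdD v F G : dird v (F + G) = dird v F + dird v G.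
Proof. by rewrite /dird -big_split; apply: eq_bigr => i _; rewrite mderivD scalerDr. Qed.
Lemma dirdM v F G : dird v (F * G) = dird v F * G + F * dird v G.
Proof.
rewrite /dird mulr_suml mulr_sumr -big_split; apply: eq_bigr => i _.
by rewrite mderivM scalerDr scalerAl scalerAr.
Qed.
Lemma dirdC v c : dird v c%:MP = 0.
Proof. by rewrite /dird big1 // => i _; rewrite mderivC scaler0. Qed.
Lemma dirdX v i : dird v 'X_i = (v i)%:MP.
Proof.
rewrite /dird (bigD1 i) //= big1 ?addr0 => [|j ji].
  rewrite mderivX; have -> : (U_(i) - U_(i))%MM = 0%MM :> 'X_{1..3} by apply/mnmP => j; rewrite mnmBE mnm0E subnn.
  by rewrite mnm1E eqxx scale1r mpolyX0 -mul_mpolyC mulr1.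
by rewrite mderivX mnm1E eq_sym (negPf ji) scale0r scaler0.
Qed.

Lemma deriv_psi F : (psi F)^`() = psi (dird (B e0) F).
Proof.
move: F; apply: (mpoly_gen_ind (P := fun F => (psi F)^`() = psi (dird (B e0) F))) => [c|i|F G hF hG|F G hF hG].
- by rewrite psiC dirdC rmorph0 /Submission.bc /= derivC.
- rewrite psiX dirdX psiC !derivD !derivM !derivC derivX; ring.
- by rewrite rmorphD derivD hF hG dirdD rmorphD.
- by rewrite rmorphM derivM hF hG dirdM rmorphD !rmorphM.
Qed.

Lemma dy_psi F : dy (psi F) = psi (dird (B e1) F).
Proof.
have dybc c : dy (bc c) = 0 :> R by rewrite /Submission.bc /= dyC derivC.
move: F; apply: (mpoly_gen_ind (P := fun F => dy (psi F) = psi (dird (B e1) F))) => [c|i|F G hF hG|F G hF hG].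
- by rewrite psiC dirdC rmorph0 dybc.
- have dX : dy ('X : R) = 0 by rewrite -['X]mul1r -[1 * _]addr0 -polyC0 dy_cons -polyC1 dyC deriv0 derivC mul0r addr0.
  rewrite psiX dirdX psiC !dyD !dyM dyyy !dybc dX; ring.
- by rewrite rmorphD dyD hF hG dirdD rmorphD.
- by rewrite rmorphM dyM hF hG dirdM rmorphD !rmorphM.
Qed.

(** Multiplying by [lam e2], which [psi] sends to 1, raises the degree. Lifts in every large degree
    allow several polynomials to be homogenized together. *)
Lemma psi_lift r : exists N0, forall N, (N0 <= N)%N -> exists2 F, F \is N.-homog & psi F = r.
Proof.
pose P r := exists N0, forall N, (N0 <= N)%N -> exists2 F, F \is N.-homog & psi F = r.
have PD a b : P a -> P b -> P (a + b).
  move=> [n hn] [m hm]; exists (maxn n m) => N; rewrite geq_max => /andP[/hn [F hF <-] /hm [G hG <-]].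
  by exists (F + G); [apply: dhomogD|rewrite rmorphD].
have PM1 a b F : F \is 1.-homog -> psi F = b -> P a -> P (a * b).
  move=> hF <- [n hn]; exists n.+1 => -[//|N]; rewrite ltnS => /hn [G hG <-].
  by exists (G * F); [by rewrite -[N.+1]addn1; apply: dhomogM|rewrite rmorphM].
have PC c : P (bc c).
  exists 0%N => N _; exists (c%:MP * lam e2 ^+ N); last by rewrite rmorphM rmorphXn psiC psi_lam2 expr1n mulr1.
  rewrite mul_mpolyC; apply: dhomogZ.
  by have := dhomogMn N (lam_homog e2); rewrite mul1n.
have Py (p : {poly K}) : P p%:P.
  elim/poly_ind: p => [|p c ih]; first exact: (PC 0).
  rewrite polyCD polyCM; apply: PD => //; last exact: PC.
  exact: (PM1 _ _ _ (lam_homog e1) psi_lam1).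
rewrite -/(P r); elim/poly_ind: r => [|a p ih]; first by rewrite -polyC0.
by apply: PD => //; apply: (PM1 _ _ _ (lam_homog e0) psi_lam0).
Qed.

Lemma psi_surj r : exists F, psi F = r.
Proof. by have [N h] := psi_lift r; have [F _ e] := h N (leqnn N); exists F. Qed.

(* The section x |-> lam e0, y |-> lam e1 inverts psi modulo lam e2 - 1. *)
Lemma psi_ker F : psi F = 0 -> exists G, F = (lam e2 - 1) * G.
Proof.
pose sg : {rmorphism R -> S} := horner_eval (lam e0) \o map_poly (ev1 (@mpolyC 3 K) (lam e1)).
have sgE r : sg r = (map_poly (ev1 (@mpolyC 3 K) (lam e1)) r).[lam e0] by [].
have sgbc c : sg (bc c) = c%:MP by rewrite sgE map_polyC hornerC /= ev1C.
have sgX : sg 'X = lam e0 by rewrite sgE map_polyX hornerX.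
have sgy : sg yy = lam e1 by rewrite sgE map_polyC hornerC /= ev1X.
move=> e; pose I G := exists H, G = (lam e2 - 1) * H.
have II : ideal I.
  split; first by exists 0; rewrite mulr0.
  - by move=> _ _ [H ->] [H' ->]; exists (H + H'); rewrite mulrDr.
  - by move=> a _ [H ->]; exists (a * H); rewrite mulrCA.
have sg0 : sg (psi F) = 0 by rewrite e rmorph0.
suff : I (F - sg (psi F)) by rewrite sg0 subr0.
apply: (@mpoly_morph_cong _ S I idfun (sg \o psi : {rmorphism S -> S}) II) => [c|i].
  by apply/esym; rewrite -[LHS]/(sg (psi c%:MP)) psiC sgbc.
exists (B e2 i)%:MP; rewrite -[LHS]/('X_i - sg (psi 'X_i)).
by rewrite psiX !rmorphD !rmorphM !sgbc sgX sgy X_lam sum3 -!mul_mpolyC; ring.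
Qed.
End Psi.

(** * Restriction of forms to a line *)

Lemma coefM_top (A : nzRingType) (p q : {poly A}) n m :
  (size p <= n.+1)%N -> (size q <= m.+1)%N -> (p * q)`_(n + m) = p`_n * q`_m.
Proof.
move=> sp sq; have nm : (n < (n + m).+1)%N by rewrite ltnS leq_addr.
rewrite coefM (bigD1 (Ordinal nm)) //= addKn big1 ?addr0 // => j jn.
have [h|h|h] := ltngtP j n.
- by rewrite [q`_ _]nth_default ?mulr0 // (leq_trans sq) // ltn_subRL; lia.
- by rewrite nth_default ?mul0r // (leq_trans sp).
- by case/eqP: jn; apply: val_inj.
Qed.

Lemma frac_homog_aux (Q : fieldType) (a b0 b1 b2 l0 l1 : Q) : a != 0 ->
  b0 * l0 + b1 * l1 + b2 * a = a * (b0 * (l0 / a) + b1 * (l1 / a) + b2).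
Proof. by move=> a0; field. Qed.

Section Restriction.
Variable K : closedFieldType.
Notation S := {mpoly K[3]}.
Notation R := {poly {poly K}}.
Notation Q := {fraction S}.
Notation yy := (yy K).
Notation bc := (@bc K).
Implicit Types (F G : S) (r : R).
Variables (B D : 'I_3 -> 'I_3 -> K).
Hypothesis BD : frame B D.
Notation lam := (lam D).
Notation psi := (psi B).

(** A form is recovered from its dehomogenization by substituting quotients by [lam e2]. The
    identity for [pi] shows that [psi] is injective on forms; [restr e1] determines the kernel of
    the restriction to the line. *)
Lemma frac_homog (pi : {rmorphism S -> S}) : (forall c, pi c%:MP = c%:MP) -> pi (lam e2) != 0 ->
  exists sg : {rmorphism R -> Q},
    sg yy = tofrac (pi (lam e1)) / tofrac (pi (lam e2)) /\
    forall N F, F \is N.-homog -> tofrac (pi F) = tofrac (pi (lam e2)) ^+ N * sg (psi F).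
Proof.
move=> piC l2; pose a := tofrac (pi (lam e2)).
have a0 : a != 0 by rewrite tofrac_eq0.
pose j : {rmorphism K -> Q} := @tofrac S \o @mpolyC 3 K.
pose u := tofrac (pi (lam e0)) / a; pose v := tofrac (pi (lam e1)) / a.
pose sg : {rmorphism R -> Q} := horner_eval u \o map_poly (ev1 j v).
have sgE r : sg r = (map_poly (ev1 j v) r).[u] by [].
have sgbc c : sg (bc c) = j c by rewrite sgE map_polyC hornerC /= ev1C.
have sgX : sg 'X = u by rewrite sgE map_polyX hornerX.
have sgy : sg yy = v by rewrite sgE map_polyC hornerC /= ev1X.
exists sg; split=> // N F hF.
apply: (@homog_scale _ _ (@tofrac S \o pi : {rmorphism S -> Q}) (sg \o psi : {rmorphism S -> Q}) _ N F _ _ hF) => [c|i].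
  rewrite -[LHS]/(tofrac (pi c%:MP)) -[RHS]/(sg (psi c%:MP)).
  by rewrite piC psiC sgbc.
rewrite -[LHS]/(tofrac (pi 'X_i)) -[RHS]/(a * sg (psi 'X_i)).
rewrite [in RHS]psiX [in LHS](X_lam BD) sum3 -!mul_mpolyC !rmorphD !rmorphM !piC !sgbc sgX sgy.
exact: frac_homog_aux a0.
Qed.

Lemma psi_homog_inj N F : F \is N.-homog -> psi F = 0 -> F = 0.
Proof.
move=> hF e; have [//||sg [_ h]] := @frac_homog idfun; first exact: lam_neq0 BD _.
by have /eqP := h N F hF; rewrite e rmorph0 mulr0 tofrac_eq0 => /eqP.
Qed.

Lemma psi_homog_eq N F G : F \is N.-homog -> G \is N.-homog -> psi F = psi G -> F = G.
Proof.
move=> hF hG e; apply/eqP; rewrite -subr_eq0; apply/eqP; apply: (@psi_homog_inj N).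
  by apply: rpredB.
by rewrite rmorphB e subrr.
Qed.

(** Composition with the projection along [B a] onto [lam a = 0]. Being an endomorphism of a domain
    with kernel generated by [lam a], it shows that [lam a] is prime. *)
Definition restr a : {rmorphism S -> S} := mmap (@mpolyC 3 K) (fun i => 'X_i - B a i *: lam a).

Lemma restrC a c : restr a c%:MP = c%:MP. Proof. exact: mmapC. Qed.
Lemma restrX a i : restr a 'X_i = 'X_i - B a i *: lam a.
Proof. by rewrite /restr /= mmapX mmap1U. Qed.

Lemma restr_lam a b : restr a (lam b) = lam b - (a == b)%:R *: lam a.
Proof.
rewrite (@lam_morph K D S (restr a) (@mpolyC 3 K)); last exact: restrC.
under eq_bigr => i _ do rewrite restrX mulrBr.
rewrite sumrB; congr (_ - _); first by apply: eq_bigr => i _; rewrite mul_mpolyC.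
rewrite eq_sym -(frame_dual BD) scaler_suml; apply: eq_bigr => i _.
by rewrite mul_mpolyC scalerA.
Qed.

Lemma restr_cong a F : exists G, F - restr a F = lam a * G.
Proof.
pose I F := exists G, F = lam a * G.
have II : ideal I.
  split; first by exists 0; rewrite mulr0.
  - by move=> _ _ [H ->] [H' ->]; exists (H + H'); rewrite mulrDr.
  - by move=> b _ [H ->]; exists (b * H); rewrite mulrCA.
apply: (@mpoly_morph_cong _ S I idfun (restr a) II) => [c|i]; first by rewrite restrC.
exists (B a i)%:MP; rewrite -[LHS]/('X_i - restr a 'X_i) restrX -mul_mpolyC; ring.
Qed.

Lemma restr_eq0 a F : restr a F = 0 <-> exists G, F = lam a * G.
Proof.
split=> [e|[G ->]]; first by have [G] := restr_cong a F; rewrite e subr0; exists G.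
by rewrite rmorphM restr_lam eqxx scale1r subrr mul0r.
Qed.

Lemma lam_prime a F G : (exists H, F * G = lam a * H) ->
  (exists H, F = lam a * H) \/ (exists H, G = lam a * H).
Proof.
move/restr_eq0/eqP; rewrite rmorphM mulf_eq0 => /orP[] /eqP h; [left|right]; exact/restr_eq0.
Qed.

Lemma psi_restrict N F : F \is N.-homog -> ry (psi F) = 0 -> exists G, F = lam e1 * G.
Proof.
move=> hF e; apply/restr_eq0.
have l2 : restr e1 (lam e2) = lam e2 by rewrite restr_lam scale0r subr0.
have l1 : restr e1 (lam e1) = 0 by rewrite restr_lam eqxx scale1r subrr.
have [||sg [sgy h]] := @frac_homog (restr e1); first exact: restrC.
  by rewrite l2 (lam_neq0 BD).
have [r er] := ry_ker e.
have /eqP := h N F hF; rewrite er rmorphM sgy l1 rmorph0 mul0r !mulr0 tofrac_eq0.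
by move/eqP.
Qed.

Lemma psi_restrict_homog N F : F \is N.-homog -> ry (psi F) = 0 ->
  F = 0 \/ exists2 G, F = lam e1 * G & (0 < N)%N /\ G \is N.-1.-homog.
Proof.
move=> hF e; have [->|F0] := eqVneq F 0; [by left|right].
have [G eG] := psi_restrict hF e; exists G => //.
have G0 : G != 0 by apply: contraNneq F0 => G0; rewrite eG G0 mulr0.
have [] := homog_quot (lam_neq0 BD e1) (lam_homog D e1) _ G0 (e := N); first by rewrite -eG.
by rewrite subn1.
Qed.

Lemma uni_lift (p : {poly K}) N : (size p <= N.+1)%N -> exists2 F, F \is N.-homog & ry (psi F) = p.
Proof.
move=> sp; exists (\sum_(i < N.+1) p`_i *: (lam e0 ^+ i * lam e2 ^+ (N - i))).
  apply: rpred_sum => i _; apply: dhomogZ.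
  have h1 := dhomogMn i (lam_homog D e0); have h2 := dhomogMn (N - i) (lam_homog D e2).
  by rewrite !mul1n in h1 h2; have := dhomogM h1 h2; rewrite subnKC // -ltnS.
pose f : {rmorphism S -> {poly K}} := @ry K \o psi.
have fE G : f G = ry (psi G) by [].
rewrite -fE rmorph_sum [RHS](_ : p = \sum_(i < N.+1) p`_i *: 'X^i).
  apply: eq_bigr => i _; rewrite -mul_mpolyC !rmorphM !rmorphXn !fE psiC (psi_lam0 BD) (psi_lam2 BD).
  by rewrite rmorph1 expr1n mulr1 ryX -mul_polyC /Submission.bc /= ryC hornerC.
by apply/polyP => i; rewrite -poly_def coef_poly; case: ltnP => // h; rewrite nth_default // (leq_trans sp).
Qed.

(** The top coefficient in x is the value at infinity [B e0]; a form not vanishing there keeps its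
    full degree in x. *)
Lemma psi_top N F : F \is N.-homog ->
  (size (psi F) <= N.+1)%N /\ (psi F)`_N = (F.@[B e0])%:P.
Proof.
move=> /dhomogP hF; rewrite (mpolyE F) (rmorph_sum psi) (raddf_sum (meval (B e0))) coef_sum rmorph_sum.
have key m : mdeg m = N -> (size (psi 'X_[m]) <= N.+1)%N /\ (psi 'X_[m])`_N = (('X_[m] : S).@[B e0])%:P.
  move=> <-; rewrite mpolyXE_id rmorph_prod (rmorph_prod (meval (B e0))) rmorph_prod mdegE.
  elim/big_rec3: _ => [|i x y z _ [s1 s2]]; first by rewrite size_poly1 coef1.
  have [s3 s4] : (size (psi ('X_i ^+ m i)) <= (m i).+1)%N /\
      (psi ('X_i ^+ m i))`_(m i) = ((('X_i : S) ^+ m i).@[B e0])%:P.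
    elim: (m i) => [|k [h1 h2]]; first by rewrite expr0 rmorph1 size_poly1 coef1 meval1.
    have eX : psi 'X_i = (B e0 i)%:P%:P * 'X + ((B e1 i)%:P * 'X + (B e2 i)%:P)%:P.
      by rewrite psiX -addrA polyCD polyCM.
    have sX : (size (psi 'X_i) <= 2)%N.
      by rewrite eX size_MXaddC; case: ifP => // _; rewrite ltnS size_polyC_leq1.
    rewrite exprS rmorphM mevalM mevalXU; split.
      by apply: leq_trans (size_polyMleq _ _) _; lia.
    by rewrite -[k.+1]add1n (coefM_top sX h1) h2 eX coefD coefMX !coefC /= addr0 polyCM.
  split; last by rewrite (coefM_top s3 s1) s4 s2.
  apply: leq_trans (size_polyMleq _ _) _; rewrite -subn1 leq_subLR add1n.
  by have := leq_add s3 s1; rewrite addSn addnS.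
have fZ c G : psi (c *: G) = bc c * psi G by rewrite -mul_mpolyC rmorphM psiC.
split; last first.
  apply: eq_big_seq => m /hF em; have [_ h] := key m em.
  by rewrite fZ [LHS]coefCM h -polyCM; congr polyC; apply/esym/mevalZ.
rewrite big_seq; apply: (big_ind (fun p : R => size p <= N.+1)%N) => [|p q hp hq|m /hF em].
- by rewrite size_poly0.
- by rewrite (leq_trans (size_polyD _ _)) // geq_max hp.
- have [h _] := key m em; rewrite fZ mul_polyC; exact: leq_trans (size_scale_leq _ _) h.
Qed.

Lemma ry_psi_top N F : F \is N.-homog ->
  (size (ry (psi F)) <= N.+1)%N /\ (ry (psi F))`_N = F.@[B e0].
Proof.
move=> hF; have [h1 h2] := psi_top hF; split.
  exact: leq_trans (size_poly _ _) h1.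
by rewrite coef_map /= h2 /horner_eval hornerC.
Qed.

Definition sqfree (g : R) := forall h, irreducible_poly (fr h) ->
  ~ exists (c : {poly K}) s, c != 0 /\ c%:P * g = h * h * s.

Lemma sqfree_locally g : sqfree g -> locally_reduced g.
Proof.
move=> sf h [ih _ _] [c [s [c0 e]]]; apply: (sf h ih); exists c, s; split=> //.
by apply: contraNneq c0 => ->; rewrite horner0.
Qed.

Lemma yc_prime (c : K) (a b r : R) : a * b = r * ('X - c%:P)%:P ->
  (exists s, a = s * ('X - c%:P)%:P) \/ (exists s, b = s * ('X - c%:P)%:P).
Proof.
pose ev : {rmorphism R -> {poly K}} := map_poly (horner_eval c).
have evC p : ev p%:P = p.[c]%:P by rewrite /ev /= map_polyC.
have evX : ev 'X = 'X by rewrite /ev /= map_polyX.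
have ker s : ev s = 0 -> exists s', s = s' * ('X - c%:P)%:P.
  elim/poly_ind: s => [|s p ih]; first by exists 0; rewrite mul0r.
  rewrite rmorphD rmorphM evX evC => /eqP; rewrite addr_eq0 => /eqP e.
  have pc : p.[c] = 0.
    have := congr1 (fun q : {poly K} => q`_0) e.
    by rewrite coefMX coefN coefC /= => /eqP; rewrite eq_sym oppr_eq0 => /eqP.
  move: e; rewrite pc oppr0 => /eqP; rewrite mulf_eq0 polyX_eq0 orbF => /eqP/ih [s' ->].
  have /factor_theorem [q ->] : root p c by apply/rootP.
  exists (s' * 'X + q%:P); rewrite polyCM; ring.
move=> e; have : ev (a * b) = 0 by rewrite e rmorphM evC hornerXsubC subrr polyC0 mulr0.
rewrite rmorphM => /eqP; rewrite mulf_eq0 => /orP[] /eqP /ker; [by left|by right].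
Qed.

Definition red (F : S) := F != 0 /\ forall G H : S, F = G * G * H -> (msize G <= 1)%N.

(** A square factor over [K(y)] is turned into one of the form itself in two stages: linear factors
    of the denominator in y are prime and cancel, then homogenization introduces powers of the prime
    [lam e2], which cancel too. *)
Lemma red_sqfree N F : F \is N.-homog -> red F -> sqfree (psi F).
Proof.
move=> hF [F0 hred] h ih [c [s [c0 e]]].
have sh : (1 < size h)%N by rewrite -size_fr; case: ih.
have [h' [s' [sh' e']]] : exists h' s' : R, (1 < size h')%N /\ psi F = h' * h' * s'.
  have [n] := ubnP (size c); elim: n c c0 h s sh e {ih} => // n IH c c0 h s sh e sc.
  have [s1|s1] := leqP (size c) 1.
    exists h, (s * (c`_0)^-1%:P%:P); split=> //; rewrite mulrA -e (size1_polyC s1) coefC /=.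
    rewrite mulrAC -!polyCM mulfV ?polyC1 ?mul1r //.
    by apply: contraNneq c0 => c00; rewrite (size1_polyC s1) c00.
  have [|z rz] := closed_rootP c _; first by rewrite gtn_eqF.
  have [c1 ec] := factor_theorem _ _ rz.
  have c10 : c1 != 0 by apply: contraNneq c0 => c10; rewrite ec c10 mul0r.
  have sc1 : (size c1 < n)%N.
    by move: sc; rewrite ec size_Mmonic ?monicXsubC // size_XsubC addn2.
  have L0 : ('X - z%:P)%:P != 0 :> R by rewrite polyC_eq0 polyXsubC_eq0.
  have E : h * (h * s) = c1%:P * psi F * ('X - z%:P)%:P.
    by rewrite mulrA -e ec polyCM mulrAC.
  have main h1 : h = h1 * ('X - z%:P)%:P -> exists h' s' : R, (1 < size h')%N /\ psi F = h' * h' * s'.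
    move=> eh; apply: (IH c1 c10 h1 (('X - z%:P)%:P * s)) => //.
      by move: sh; rewrite eh mulrC mul_polyC size_scale // polyXsubC_eq0.
    apply: (mulIf L0); rewrite -E eh; ring.
  case: (yc_prime E) => [[h1 eh]|[s1' es]]; first exact: main eh.
  case: (yc_prime es) => [[h1 eh]|[s2 es2]]; first exact: main eh.
  apply: (IH c1 c10 h s2) => //; apply: (mulIf L0).
  by rewrite -E es2; ring.
have [n1 /(_ n1 (leqnn _)) [H hH eH]] := psi_lift BD h'.
have [n2 hn2] := psi_lift BD s'.
have [G hG eG] := hn2 (n2 + N)%N (leq_addr _ _).
(* [G] is lifted in degree [n2 + N] so that the right side has degree at least [N]; powers of
   [lam e2], invisible to [psi], make up the surplus. *)
pose M := (n1 + n1 + (n2 + N) - N)%N.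
have hl k : lam e2 ^+ k \is k.-homog by have := dhomogMn k (lam_homog D e2); rewrite mul1n.
have E : F * lam e2 ^+ M = H * H * G.
  apply: (@psi_homog_eq (N + M)%N).
  - exact: dhomogM.
  - have -> : (N + M = n1 + n1 + (n2 + N))%N by rewrite /M; lia.
    by do 2?apply: dhomogM.
  - by rewrite !rmorphM rmorphXn (psi_lam2 BD) expr1n mulr1 eH eG.
clear hH hG; elim: M H G eH E {eG} => [|M IH] H G eH E.
  move: sh'; rewrite -eH; have := hred H G; rewrite -E expr0 mulr1 => /(_ erefl) /msize1_polyC ->.
  by rewrite psiC ltnNge size_polyC_leq1.
have l0 := lam_neq0 BD e2.
have E' : H * (H * G) = lam e2 * (F * lam e2 ^+ M) by rewrite mulrA -E exprS; ring.
have main H1 : H = lam e2 * H1 -> False.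
  move=> eq1; apply: (IH H1 (lam e2 * G)).
    by rewrite -eH eq1 rmorphM (psi_lam2 BD) mul1r.
  apply: (mulfI l0); rewrite -E' eq1; ring.
have [|[H1 /main //]|[G1 eG1]] := @lam_prime e2 H (H * G); first by exists (F * lam e2 ^+ M).
have [|[H1 /main //]|[G2 eG2]] := @lam_prime e2 H G; first by exists G1.
by apply: (IH H G2 eH); apply: (mulfI l0); rewrite -E' eG2; ring.
Qed.
End Restriction.

Lemma frame_coord (F : fieldType) (B D : 'I_3 -> 'I_3 -> F) k : frame B D ->
  (forall i, D e2 i = (i == k)%:R) -> forall a, B a k = (a == e2)%:R.
Proof.
move=> BD Dk a; have h := frame_dual BD e2 a.
rewrite (bigD1 k) //= Dk eqxx mul1r big1 ?addr0 in h; first by rewrite h eq_sym.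
by move=> i /negPf ik; rewrite Dk ik mul0r.
Qed.

(** * Derivations in the coordinates of a frame *)

Section Frames.
Variable K : closedFieldType.
Notation S := {mpoly K[3]}.

(* [apply_der], [hom_der] and [theta_E] over an arbitrary closed field. *)
Definition adr (th : 'I_3 -> S) (f : S) : S := \sum_(i < 3) th i * mderiv i f.
Definition homd (th : 'I_3 -> S) k := forall i, th i \is k.-homog.
Definition eul : 'I_3 -> S := fun i => 'X_i.

Lemma dird_homog (v : 'I_3 -> K) (F : S) n : F \is n.+1.-homog -> dird v F \is n.-homog.
Proof.
move=> hF; apply: rpred_sum => i _; apply: dhomogZ.
apply/dhomogP => m hm; have : F@_(m + U_(i)) != 0.
  by move: hm; rewrite mcoeff_msupp mcoeff_mderiv; apply: contraNneq => ->; rewrite mul0rn.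
have /dhomogP h := hF; rewrite -mcoeff_msupp => /h /=.
by rewrite mdegD mdeg1 addn1 => /eqP; rewrite eqSS => /eqP.
Qed.

Section FrameBD.
Variables (B D : 'I_3 -> 'I_3 -> K).

Lemma frame_of_dual : (forall a b, \sum_i D a i * B b i = (a == b)%:R) -> frame B D.
Proof.
move=> h; split=> // i j.
pose M := \matrix_(a, i) D a i; pose N := \matrix_(i, b) B b i.
have e : M *m N = 1%:M by apply/matrixP => a b; rewrite !mxE -h; apply: eq_bigr => k _; rewrite !mxE.
have /matrixP/(_ i j) := mulmx1C e; rewrite !mxE => <-.
by apply: eq_bigr => a _; rewrite !mxE.
Qed.

Hypothesis BD : frame B D.
Notation lam := (lam D).

Lemma mderiv_frame F i : F^`M(i) = \sum_a D a i *: dird (B a) F.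
Proof.
have -> : \sum_a D a i *: dird (B a) F = \sum_j (\sum_a B a j * D a i) *: F^`M(j).
  under [LHS]eq_bigr => a _ do rewrite /dird scaler_sumr.
  rewrite exchange_big /=; apply: eq_bigr => j _.
  by rewrite scaler_suml; apply: eq_bigr => a _; rewrite scalerA mulrC.
rewrite (bigD1 i) //= [X in _ + X]big1 => [|j ji]; first by rewrite (frame_span BD) eqxx scale1r addr0.
by rewrite (frame_span BD) (negPf ji) scale0r.
Qed.

Lemma dird_lam a b : dird (B a) (lam b) = ((b == a)%:R)%:MP.
Proof.
have d0 : dird (B a) 0 = 0 by rewrite -(mpolyC0 3 K) dirdC mpolyC0.
rewrite /lam /Submission.lam (big_morph _ (dirdD (B a)) d0) -(frame_dual BD) raddf_sum.
apply: eq_bigr => j _; rewrite -mul_mpolyC dirdM dirdC dirdX mul0r add0r -mpolyCM //.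
Qed.

Lemma adr_frame (th : 'I_3 -> S) F : adr th F = \sum_a adr th (lam a) * dird (B a) F.
Proof.
have e a : adr th (lam a) = \sum_i D a i *: th i.
  apply: eq_bigr => i _; rewrite /lam /Submission.lam raddf_sum /= mulr_sumr (bigD1 i) //= big1 => [|j ji].
    rewrite addr0 mderivZ; have -> : mderiv i ('X_i : S) = 1.
      have := dirdX (fun j => (j == i)%:R : K) i; rewrite /dird eqxx (bigD1 i) //= eqxx scale1r.
      by rewrite big1 ?addr0 // => j /negPf ->; rewrite scale0r.
    by rewrite -scalerAr mulr1.
  by rewrite mderivZ mderivX mnm1E (negPf ji) scale0r scaler0 mulr0.
rewrite {1}/adr; under eq_bigr => i _ do rewrite mderiv_frame mulr_sumr.
rewrite exchange_big /=; apply: eq_bigr => a _; rewrite e mulr_suml.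
by apply: eq_bigr => i _; rewrite -scalerAr scalerAl.
Qed.

Lemma euler n F : F \is n.-homog -> \sum_(i < 3) ('X_i : S) * F^`M(i) = n%:R * F.
Proof.
move=> /dhomogP hF; rewrite [in RHS](mpolyE F) mulr_sumr.
transitivity (\sum_(m <- msupp F) \sum_(i < 3) ('X_i : S) * mderiv i (F@_m *: 'X_[m])).
  rewrite exchange_big /=; apply: eq_bigr => i _.
  by rewrite {1}(mpolyE F) raddf_sum mulr_sumr.
rewrite big_seq [RHS]big_seq; apply: eq_bigr => m /hF em.
have -> : n%:R * (F@_m *: 'X_[m]) = \sum_(i < 3) (m i)%:R * (F@_m *: 'X_[m] : S).
  by rewrite -mulr_suml -natr_sum -em /= mdegE.
apply: eq_bigr => i _; rewrite mderivZ mderivX.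
have [m0|m0] := eqVneq (m i) 0%N; first by rewrite m0 scale0r scaler0 mulr0 mul0r.
have e : 'X_i * 'X_[(m - U_(i))] = 'X_[m] :> S.
  rewrite -mpolyXD; congr 'X_[_]; apply/mnmP => j; rewrite mnmDE mnmBE mnm1E.
  by case: eqP => [<-|_]; rewrite ?subn0 // add1n subn1 prednK // lt0n.
by rewrite -!scalerAr e scaler_nat mulr_natl -scalerMnr.
Qed.

Lemma euler_frame n F : F \is n.-homog -> \sum_a lam a * dird (B a) F = n%:R * F.
Proof.
move=> hF; have h := euler hF; rewrite -h -[RHS]/(adr eul F) adr_frame.
apply: eq_bigr => a _; congr (_ * _).
have ha := euler (lam_homog D a); rewrite mul1r in ha.
exact: esym ha.
Qed.

End FrameBD.
End Frames.

(** * Milnor and Tjurina numbers in the chart of a frame *)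

Lemma K_char0 n : n.+1%:R != 0 :> K.
Proof.
have h : n.+1%:R != 0 :> (Rdefinitions.R)[i] by rewrite Num.Theory.pnatr_eq0.
exact: h.
Qed.

Lemma in_ideal_gen gs r : in_ideal gs r <-> gen gs r.
Proof.
elim: gs r => [|g gs ih] r /=.
  split=> [[cs ->]|->]; first by rewrite big_ord0.
  by exists [::]; rewrite big_ord0.
split=> [[cs ->]|[u [r' [/ih [cs ->] ->]]]].
  rewrite big_ord_recl; exists cs`_0, (\sum_(i < size gs) (behead cs)`_i * gs`_i).
  split=> //; first by apply/ih; exists (behead cs).
  by congr (_ + _); apply: eq_bigr => i _; rewrite nth_behead.
by exists (u :: cs); rewrite big_ord_recl.
Qed.

Lemma loc_indepP gs q n : loc_indep gs q n <->
  exists b, indep (@mpolyC 3 K) (fun=> True) (sat (fun h : {mpoly K[3]} => h.@[q] <> 0) (gen gs)) (n := n) b.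
Proof.
have eqc c (b : 'I_n -> {mpoly K[3]}) : comb (@mpolyC 3 K) c b = \sum_(i < n) c i *: b i.
  by apply: eq_bigr => i _; rewrite mul_mpolyC.
split=> [[b hb]|[b [_ hb]]]; exists b; last first.
  move=> c [h [h0 /in_ideal_gen hi]]; apply: hb; rewrite eqc; exists h => //.
  exact/eqP.
by split=> // c; rewrite eqc => -[h /eqP h0 hi]; apply: hb; exists h; split=> //; apply/in_ideal_gen.
Qed.

Lemma loc_len_qdim gs q n :
  qdim (@mpolyC 3 K) (fun=> True) (sat (fun h : {mpoly K[3]} => h.@[q] <> 0) (gen gs)) n -> loc_len gs q = n.
Proof.
set W := sat _ _ => dn.
have sW : subsp (@mpolyC 3 K) W.
  apply: ideal_subsp; apply: sat_ideal; last exact: gen_ideal.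
    by rewrite meval1; apply/eqP; apply: oner_neq0.
  move=> s t /eqP hs /eqP ht; rewrite mevalM; apply/eqP; exact: mulf_neq0.
have big m : (n < m)%N -> ~ loc_indep gs q m.
  move=> nm /loc_indepP [b ib]; case: dn => d id sd.
  by have := indep_le sW sd ib; rewrite leqNgt nm.
have small m : (m <= n)%N -> loc_indep gs q m.
  move=> mn; apply/loc_indepP; case: dn => d [_ id] _.
  exists (fun i => d (widen_ord mn i)); split=> // c hc i.
  pose c' (j : 'I_n) := if insub (j : nat) is Some k then c k else 0.
  have e : comb (@mpolyC 3 K) c (fun i => d (widen_ord mn i)) = comb (@mpolyC 3 K) c' d.
    rewrite /comb (bigID (fun j : 'I_n => (j < m)%N)) /= [X in _ + X]big1 ?addr0; last first.
      by move=> j jm; rewrite /c' insubN // mpolyC0 mul0r.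
    rewrite (big_ord_narrow mn); apply: eq_bigr => j _.
    by rewrite /c' /= (insubT (fun x => x < m)%N (ltn_ord j)); congr ((c _)%:MP * _); apply: val_inj.
  have := id c'; rewrite -e => /(_ hc (widen_ord mn i)).
  by rewrite /c' /= (insubT (fun x => x < m)%N (ltn_ord i)) => <-; congr c; apply: val_inj.
rewrite /loc_len /maxsat.
(* [maxsat] picks the least m for which m + 1 fails, and failure at m + 1 means [n <= m]. *)
have bP m : (if excluded_middle_informative (~ loc_indep gs q m.+1) then true else false) = (n <= m)%N.
  case: excluded_middle_informative => h.
    by apply/esym; rewrite leqNgt; apply/negP => mn; apply: h; apply: small.
  by apply/esym; rewrite leqNgt; apply/negbTE; rewrite negbK ltnNge; apply/negP => nm; apply: h; apply: big.
case: excluded_middle_informative => [H|[]]; last by exists n; rewrite bP.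
by case: ex_minnP => m; rewrite bP => nm hm; apply/eqP; rewrite eqn_leq nm hm // bP.
Qed.

Section Transfer.
Notation S := {mpoly K[3]}.
Notation R := {poly {poly K}}.
Notation yy := (yy K).
Notation bc := (@bc K).
Notation unit0 := (@unit0 K).
Notation len0 := (@len K R bc unit0).
Notation sat0 := (@sat R unit0).
Variables (B D : 'I_3 -> 'I_3 -> K).
Hypothesis BD : frame B D.
Notation lam := (lam D).
Notation psi := (psi B).
Let U1 : unit0 1 := unit01 K.
Let UM := @unit0M K.

Lemma psi_gen gs F : (forall G, psi G = 0 -> gen gs G) -> gen [seq psi g | g <- gs] (psi F) <-> gen gs F.
Proof.
move=> hk; split.
  suff: forall r, gen [seq psi g | g <- gs] r -> exists2 G, gen gs G & psi G = r.
    move=> h /h [G gG e]; have [_ iD _] := gen_ideal gs.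
    rewrite -[F](subrK G); apply: iD => //; apply: hk; by rewrite rmorphB e subrr.
  elim: gs {hk} => [|g gs ih] r /=; first by move=> ->; exists 0; rewrite ?rmorph0.
  move=> [u [r' [/ih [G gG <-] ->]]]; have [U <-] := psi_surj BD u.
  by exists (U * g + G); [exists U, G|rewrite rmorphD rmorphM].
elim: gs {hk} F => [|g gs ih] F /=; first by move=> ->; rewrite rmorph0.
by move=> [u [G [/ih hG ->]]]; exists (psi u), (psi G); rewrite rmorphD rmorphM.
Qed.

(** The definitions realize the chart as a plane in three-space. If the ideal contains the kernel of
    [psi], generated by the equation of the plane, lengths can be computed in two variables. *)
Lemma loc_len_psi gs n : (forall G, psi G = 0 -> gen gs G) ->
  len0 [seq psi g | g <- gs] n -> loc_len gs (B e2) = n.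
Proof.
move=> hk dn; apply: loc_len_qdim.
have T1 : (1 : S).@[B e2] <> 0 by rewrite meval1; apply/eqP; apply: oner_neq0.
have TM (s t : S) : s.@[B e2] <> 0 -> t.@[B e2] <> 0 -> (s * t).@[B e2] <> 0.
  by move=> /eqP hs /eqP ht; rewrite mevalM; apply/eqP; apply: mulf_neq0.
apply: (@qdim_map_inv K S R (@mpolyC 3 K) bc psi _ _ (fun=> True) _ (fun=> True) (sat0 (gen [seq psi g | g <- gs])) n _ _ _ _ _ _ dn) => //.
- by move=> x y; rewrite rmorphD.
- by move=> c x; rewrite rmorphM psiC.
- exact: (ideal_subsp _ (sat_ideal T1 TM (gen_ideal gs))).
- exact: (ideal_subsp _ (ideal_satgen U1 UM _)).
- move=> r _; have [F e] := psi_surj BD r; exists F => //; rewrite e subrr.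
  by case: (ideal_satgen U1 UM [seq psi g | g <- gs]).
- move=> F _; split=> [[s Us]|[s Us h]].
    have [G eG] := psi_surj BD s; rewrite -eG -rmorphM => /(psi_gen _ hk) h.
    exists G => //; move: Us; rewrite -eG /Submission.unit0 at0_psi; exact: elimN eqP.
  exists (psi s); first by rewrite /Submission.unit0 at0_psi; apply/eqP.
  by rewrite -rmorphM; apply/psi_gen.
Qed.
End Transfer.

Section Frames.
Notation S := {mpoly K[3]}.
Notation R := {poly {poly K}}.
Notation len0 := (@len K R (@bc K) (@unit0 K)).
Notation sat0 := (@sat R (@unit0 K)).
Variables (B D : 'I_3 -> 'I_3 -> K).

Hypothesis BD : frame B D.
Notation lam := (lam D).
Notation psi := (psi B).

Variable k : 'I_3.
Hypothesis Dk : forall i, D e2 i = (i == k)%:R.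

Lemma lam2E : lam e2 = 'X_k.
Proof.
rewrite /lam /Submission.lam (bigD1 k) //= big1 ?addr0 => [|j jk]; first by rewrite Dk eqxx scale1r.
by rewrite Dk (negPf jk) scale0r.
Qed.

Lemma Bk a : B a k = (a == e2)%:R.
Proof. exact: frame_coord BD Dk a. Qed.

Notation parts F := [seq mderiv i F | i <- enum 'I_3 & i != k].

Lemma gen_parts F (x : R) : x \in [seq psi g | g <- parts F] ->
  gen [:: (psi F)^`(); dy (psi F)] x.
Proof.
case/mapP => _ /mapP [i + ->] ->; rewrite mem_filter => /andP[ik _].
rewrite (mderiv_frame BD) sum3 Dk (negPf ik) scale0r addr0 -!mul_mpolyC rmorphD !rmorphM !psiC.
by rewrite -deriv_psi -dy_psi; apply/gen2P; do 2 eexists.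
Qed.

Lemma parts_gen F a : a != e2 -> gen [seq psi g | g <- parts F] (psi (dird (B a) F)).
Proof.
move=> a2; rewrite /dird rmorph_sum; have [g0 gD gM] := gen_ideal [seq psi g | g <- parts F].
apply: big_ind => // i _; rewrite -mul_mpolyC rmorphM.
have [->|ik] := eqVneq i k; first by rewrite Bk (negPf a2) mpolyC0 rmorph0 mul0r.
by apply: gM; apply: gen_mem; apply: map_f; apply: map_f; rewrite mem_filter ik mem_enum.
Qed.

Lemma ker_lam2 gs G : psi G = 0 -> gen ('X_k - 1 :: gs) G.
Proof.
move=> /(psi_ker BD) [H ->]; rewrite lam2E; have [_ _ gM] := gen_ideal ('X_k - 1 :: gs).
by rewrite mulrC; apply: gM; apply: gen_mem; rewrite mem_head.
Qed.

Lemma psi_Xk1 : psi ('X_k - 1) = 0.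
Proof. by rewrite -lam2E rmorphB (psi_lam2 BD) rmorph1 subrr. Qed.

Let U1 := unit01 K.
Let UM := @unit0M K.

(** The k-th coordinates of [B e0] and [B e1] vanish, so derivatives along these two vectors and the
    partial derivatives other than the k-th generate the same ideal in the chart. *)
Lemma milnor_frame F p n : k = chart p -> B e2 =1 normalize p ->
  len0 [:: (psi F)^`(); dy (psi F)] n -> milnor F p = n.
Proof.
move=> ek eB dn; rewrite /milnor /chart_partials -ek.
have -> : normalize p = B e2 by apply: functional_extensionality.
apply: (loc_len_psi BD) => [G|]; first exact: ker_lam2.
apply: (@len_ext K R (@bc K) (@unit0 K) U1 UM _ _ n _ _ dn) => g.
  rewrite !inE => /orP[] /eqP ->; apply: satW => //; rewrite ?deriv_psi ?dy_psi /=.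
    by exists 0, (psi (dird (B e0) F)); rewrite mul0r add0r; split=> //; apply: parts_gen.
  by exists 0, (psi (dird (B e1) F)); rewrite mul0r add0r; split=> //; apply: parts_gen.
rewrite /= inE => /predU1P[->|hg]; apply: satW => //.
  by rewrite psi_Xk1; case: (gen_ideal [:: (psi F)^`(); dy (psi F)]).
exact: gen_parts.
Qed.

Lemma tjurina_frame F p n : k = chart p -> B e2 =1 normalize p ->
  len0 [:: psi F; (psi F)^`(); dy (psi F)] n -> tjurina F p = n.
Proof.
move=> ek eB dn; rewrite /tjurina /chart_partials -ek.
have -> : normalize p = B e2 by apply: functional_extensionality.
apply: (loc_len_psi BD) => [G|].
  by move/(ker_lam2 (parts F)) => h; exists 0, G; rewrite mul0r add0r.
apply: (@len_ext K R (@bc K) (@unit0 K) U1 UM _ _ n _ _ dn) => g.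
  rewrite !inE => /or3P[] /eqP ->; apply: satW => //; rewrite ?deriv_psi ?dy_psi.
  - by apply: gen_mem; rewrite mem_head.
  - by exists 0, (psi (dird (B e0) F)); rewrite mul0r add0r; split=> //=; exists 0, (psi (dird (B e0) F)); rewrite mul0r add0r; split=> //; apply: parts_gen.
  - by exists 0, (psi (dird (B e1) F)); rewrite mul0r add0r; split=> //=; exists 0, (psi (dird (B e1) F)); rewrite mul0r add0r; split=> //; apply: parts_gen.
have [g0 gD gM] := gen_ideal [:: psi F; (psi F)^`(); dy (psi F)].
move=> hg0; have : g \in psi F :: psi ('X_k - 1) :: [seq psi g | g <- parts F] by exact: hg0.
rewrite !inE => /or3P[/eqP->|/eqP->|hg]; apply: satW => //.
- by apply: gen_mem; rewrite mem_head.
- by rewrite psi_Xk1.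
- by exists 0, g; rewrite mul0r add0r; split=> //; apply: gen_parts.
Qed.
End Frames.

(** * The local numbers at a point of the line *)

Section Point.
Variable K : closedFieldType.
Hypothesis char0 : forall n, n.+1%:R != 0 :> K.
Notation S := {mpoly K[3]}.
Notation R := {poly {poly K}}.
Notation len0 := (@len K R (@bc K) (@unit0 K)).
Notation sat0 := (@sat R (@unit0 K)).
Variables (B D : 'I_3 -> 'I_3 -> K).
Hypothesis BD : frame B D.
Notation lam := (lam D).
Notation psi := (psi B).
Notation yy := (yy K).
Variables (f : S) (N : nat).
Hypothesis hf : f \is N.+1.-homog.
Hypothesis f_red : red f.

Variables (eta : 'I_3 -> S) (ke : S).
Hypothesis eta_f : adr eta f = ke * f.
Notation Q := (adr eta (lam e1)).
Hypothesis Q_gen : forall th M, homd th M -> (exists k, adr th f = k * f) ->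
  exists m r, adr th (lam e1) = m * Q + lam e1 * r.

(** Subtracting [adr eta (lam e2)] times the Euler field removes the [e2] component of [eta] in the
    chart and leaves a vector field of the affine plane tangent to the curve. *)
Lemma psi_f_eta : exists c, c * psi f =
  psi (adr eta (lam e0) - lam e0 * adr eta (lam e2)) * (psi f)^`() +
  psi (Q - lam e1 * adr eta (lam e2)) * dy (psi f).
Proof.
have E := euler_frame BD hf; rewrite sum3 in E.
have A := adr_frame BD eta f; rewrite sum3 eta_f in A.
exists (psi (ke - adr eta (lam e2) * N.+1%:R)).
rewrite deriv_psi dy_psi -!rmorphM -rmorphD.
apply/eqP; rewrite -subr_eq0; apply/eqP.
have l2 := psi_lam2 BD.
pose T := adr eta (lam e2); pose d2 := dird (B e2) f.
have -> : (ke - T * N.+1%:R) * f =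
   (adr eta (lam e0) - lam e0 * T) * dird (B e0) f + (Q - lam e1 * T) * dird (B e1) f
   + (1 - lam e2) * (T * d2).
  rewrite mulrBl A -mulrA -E -/T -/d2; ring.
have z : psi ((1 - lam e2) * (T * d2)) = 0 by rewrite rmorphM rmorphB rmorph1 l2 subrr mul0r.
by rewrite -rmorphB addrAC subrr add0r z.
Qed.

(** The relation says that c d/dy - v d/dx is tangent to the curve. Homogenized with [C], [V] in
    degree [M.+1] and [U] in degree [M], it becomes a member of D(f), to which [Q_gen] applies. *)
Lemma psi_f_fields (c u v : R) : c * dy (psi f) = u * psi f + v * (psi f)^`() ->
  exists m r, c = m * psi Q + yy * r.
Proof.
move=> E.
have [nc hc] := psi_lift BD c; have [nu hu] := psi_lift BD u; have [nv hv] := psi_lift BD v.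
pose M := maxn nc (maxn nu nv).
have [C hC eC] := hc M.+1 (leqW (leq_maxl _ _)).
have [V hV eV] := hv M.+1 (leqW (leq_trans (leq_maxr _ _) (leq_maxr _ _))).
have [U hU eU] := hu M (leq_trans (leq_maxl _ _) (leq_maxr _ _)).
pose th : 'I_3 -> S := fun i => B e1 i *: C - B e0 i *: V.
have hth : homd th M.+1.
  by move=> i; apply: rpredB; apply: dhomogZ.
have eth F : adr th F = C * dird (B e1) F - V * dird (B e0) F.
  rewrite /adr /dird !mulr_sumr -sumrB; apply: eq_bigr => i _.
  by rewrite mulrBl -!scalerAl !scalerAr.
have [|m [r em]] := Q_gen hth.
  exists U; rewrite eth.
  apply: (psi_homog_eq BD (N := (M.+1 + N)%N)).
  - by apply: rpredB; apply: dhomogM => //; apply: dird_homog.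
  - by rewrite addSnnS; apply: dhomogM.
  by rewrite rmorphB !rmorphM -deriv_psi -dy_psi eC eV eU E addrK.
exists (psi m), (psi r); have := congr1 psi em.
rewrite eth !(dird_lam BD) /= mpolyC1 mpolyC0 mulr1 mulr0 subr0 eC => ->.
by rewrite rmorphD !rmorphM (psi_lam1 BD).
Qed.

Lemma psi_subl (F G : S) : psi (F - lam e1 * G) = psi F - yy * psi G.
Proof. by rewrite (rmorphB psi) (rmorphM psi) (psi_lam1 BD). Qed.

Lemma ry_psi_subl (F G : S) : ry (psi (F - lam e1 * G)) = ry (psi F).
Proof.
have ryB (a b : R) : ry (a - b) = ry a - ry b by exact: raddfB.
have ryM (a b : R) : ry (a * b) = ry a * ry b by exact: rmorphM.
by rewrite psi_subl ryB ryM ryyy mul0r subr0.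
Qed.

Theorem point_numbers i b l e : ry (psi f) = b * 'X^(i.+1) -> b.[0] != 0 ->
  ry (psi Q) = e * 'X^l -> e.[0] != 0 ->
  exists m t, [/\ len0 [:: (psi f)^`(); dy (psi f)] m,
    len0 [:: (psi (f * lam e1))^`(); dy (psi (f * lam e1))] (m + i + i.+1),
    len0 [:: psi f; (psi f)^`(); dy (psi f)] t &
    len0 [:: psi (f * lam e1); (psi (f * lam e1))^`(); dy (psi (f * lam e1))] (t + i.+1 + l)].
Proof.
move=> eb b0 ee ee0.
have lr := sqfree_locally (red_sqfree BD hf f_red).
have eF : psi (f * lam e1) = yy * psi f by rewrite rmorphM (psi_lam1 BD) mulrC.
have [m [dm1 dm2]] := milnor_local char0 eb b0 lr.
(* The y-component of the affine field differs from [psi Q] by a multiple of y, so both have the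
   same order on the line. *)
pose q := psi (Q - lam e1 * adr eta (lam e2)).
have eq : ry q = e * 'X^l.
  by rewrite /q ry_psi_subl.
have q1 : sat0 (gen [:: psi f; (psi f)^`()]) (q * dy (psi f)).
  apply: satW; first exact: unit01.
  have [c ec] := psi_f_eta.
  apply/gen2P; exists c, (- psi (adr eta (lam e0) - lam e0 * adr eta (lam e2))).
  by rewrite ec -/q; ring.
have q2 c : gen [:: psi f; (psi f)^`()] (c * dy (psi f)) -> sat0 (gen [:: yy; q]) c.
  move=> /gen2P [u [v /psi_f_fields [m' [r ec]]]].
  apply: satW; first exact: unit01.
  apply/gen2P; exists (m' * psi (adr eta (lam e2)) + r), m'.
  by rewrite ec /q psi_subl; ring.
have [t [dt1 dt2]] := tjurina_local char0 eb b0 lr eq ee0 q1 q2.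
by exists m, t; rewrite eF; split.
Qed.
End Point.

(** * The points of the curve on the line *)

Section Points.
Variable K : closedFieldType.
Notation S := {mpoly K[3]}.
Notation R := {poly {poly K}}.

Lemma meval_scale n (F : S) c (v : 'I_3 -> K) : F \is n.-homog ->
  F.@[fun i => c * v i] = c ^+ n * F.@[v].
Proof.
move=> hF; apply: (homog_scale (f := meval (fun i => c * v i)) (g := meval v) _ _ hF) => [d|i] /=.
  by rewrite !mevalC.
by rewrite !mevalXU.
Qed.

Lemma homog0_const (F : S) : F \is 0.-homog -> exists c, F = c%:MP.
Proof.
move=> /dhomogP h; exists F@_0; apply/msize1_polyC.
rewrite msizeE; apply/bigmax_leqP_seq => m hm _.
by rewrite (h m hm).
Qed.

Lemma linear_form (al : S) : al \is 1.-homog -> exists a : 'I_3 -> K, al = \sum_i a i *: 'X_i.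
Proof.
move=> h; have E := euler h; rewrite mul1r in E.
have hc i : exists c, al^`M(i) = c%:MP.
  have : dird (fun j => (j == i)%:R : K) al \is 0.-homog by apply: dird_homog.
  rewrite /dird (bigD1 i) //= eqxx scale1r big1 ?addr0 => [|j /negPf ->]; last by rewrite scale0r.
  exact: homog0_const.
have [a ha] := fun_choice hc; exists a; rewrite -{1}E !sum3.
by rewrite !ha ![_ * (_)%:MP]mulrC !mul_mpolyC.
Qed.

Lemma third_index (j k : 'I_3) : j != k -> exists l, [/\ l != j, l != k &
  forall F : 'I_3 -> K, \sum_i F i = F j + F k + F l].
Proof.
move: j k; apply: ord3P; apply: ord3P => // _; [exists e2|exists e1|exists e2|exists e0|exists e1|exists e0];
  by split=> // F; rewrite sum3; ring.
Qed.

(** The form set to 1 must be the coordinate of the index k, to match [chart]. As [al] vanishes at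
    [q] and is not zero, it has a nonzero coefficient at some j other than k; [B e1] is the j-th
    unit vector divided by it. *)
Lemma local_frame (al : S) (q : 'I_3 -> K) k : q k = 1 -> al != 0 -> al \is 1.-homog -> al.@[q] = 0 ->
  exists B D : 'I_3 -> 'I_3 -> K, [/\ frame B D, lam D e1 = al,
    forall i, D e2 i = (i == k)%:R & B e2 =1 q].
Proof.
move=> qk al0 hal alq.
have [a ea] := linear_form hal.
have aq : \sum_i a i * q i = 0.
  rewrite -[RHS]alq [in RHS]ea (raddf_sum (meval q)) /=.
  by apply: eq_bigr => i _; rewrite [RHS]mevalZ mevalXU.
have [j [jk aj]] : exists j, j != k /\ a j != 0.
  apply: NNPP => h; case/eqP: al0.
  have a0 j : j != k -> a j = 0 by move=> jk; apply/eqP/negPn/negP => aj; apply: h; exists j.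
  have ak : a k = 0.
    move: aq; rewrite (bigD1 k) //= qk mulr1 big1 ?addr0 // => j /a0 ->; by rewrite mul0r.
  rewrite ea big1 // => j _; have [->|/a0 ->] := eqVneq j k; rewrite ?ak scale0r //.
have [l [lj lk s3]] := third_index jk.
pose B (c : 'I_3) (i : 'I_3) : K := match val c with
  | 0 => (i == l)%:R - a l / a j * (i == j)%:R
  | 1 => (i == j)%:R / a j | _ => q i end.
pose D (c : 'I_3) (i : 'I_3) : K := match val c with
  | 0 => (i == l)%:R - q l * (i == k)%:R | 1 => a i | _ => (i == k)%:R end.
exists B, D; split=> //.
apply: frame_of_dual => c d; rewrite s3.
have [jl kl kj] : [/\ j == l = false, k == l = false & k == j = false].
  by rewrite ![_ == l]eq_sym (negPf lj) (negPf lk) eq_sym (negPf jk).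
have [lj' lk' jk'] := And3 (negPf lj) (negPf lk) (negPf jk).
rewrite s3 qk mulr1 in aq.
have [tE fE] : true%:R = 1 :> K /\ false%:R = 0 :> K by [].
move: c d; apply: ord3P; apply: ord3P; rewrite /B /D /= ?eqxx ?jl ?kl ?kj ?lj' ?lk' ?jk' ?qk ?tE ?fE.
all: rewrite ?(sub0r, oppr0, mulr0, mulr1, subr0, mul0r, add0r, addr0, mul1r, addNr, divff aj) //.
  by rewrite mulrN mulrCA divff // mulr1 addNr.
Qed.

Section Transfer.
Variables (B D : 'I_3 -> 'I_3 -> K).
Hypothesis BD : frame B D.

Lemma meval_ry (F : S) T : (ry (psi B F)).[T] = F.@[fun i => B e2 i + T * B e0 i].
Proof.
pose f : {rmorphism S -> K} := horner_eval T \o (@ry K \o psi B).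
rewrite -[LHS]/(f F).
apply: (@mpoly_morph_eq K K f (meval _)) => [c|i].
  by rewrite -[LHS]/((ry (psi B c%:MP)).[T]) psiC [RHS]mevalC /bc /= ryC hornerC hornerC.
rewrite -[LHS]/((ry (psi B 'X_i)).[T]) psiX [RHS]mevalXU.
have ryD (a b : R) : ry (a + b) = ry a + ry b by exact: raddfD.
have ryM (a b : R) : ry (a * b) = ry a * ry b by exact: rmorphM.
rewrite !ryD !ryM ryX ryyy mulr0 addr0 /bc /= !ryC !hornerE; ring.
Qed.

Variables (B' D' : 'I_3 -> 'I_3 -> K).
Hypothesis BD' : frame B' D'.
Hypothesis same_line : lam D' e1 = lam D e1.
Variables (T c : K).
Hypothesis c0 : c != 0.
Hypothesis point : forall i, B' e2 i = c * (B e2 i + T * B e0 i).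

Lemma point_eval n (F : S) : F \is n.-homog -> F.@[B' e2] = c ^+ n * (ry (psi B F)).[T].
Proof.
by move=> hF; rewrite meval_ry -(meval_scale c _ hF); apply: meval_eq => i; rewrite point.
Qed.

(* A root of multiplicity l on the line, in one frame, has the same multiplicity in another:
   the linear factor vanishing at the point is a multiple of the new coordinate. *)
Lemma mult_transfer N l (F : S) (q : {poly K}) : F \is N.-homog ->
  ry (psi B F) = ('X - T%:P) ^+ l * q -> q.[T] != 0 ->
  exists b, ry (psi B' F) = b * 'X^l /\ b.[0] != 0.
Proof.
move=> hF eF qT.
have ryM (a b : R) : ry (a * b) = ry a * ry b by exact: rmorphM.
have ryB (a b : R) : ry (a - b) = ry a - ry b by exact: raddfB.
have ryXn (a : R) m : ry (a ^+ m) = ry a ^+ m by exact: rmorphXn.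
have psC B0 d : psi B0 (d%:MP : S) = bc d by exact: psiC.
have psD B0 (G H : S) : psi B0 (G + H) = psi B0 G + psi B0 H by exact: raddfD.
have psB B0 (G H : S) : psi B0 (G - H) = psi B0 G - psi B0 H by exact: raddfB.
have psM B0 (G H : S) : psi B0 (G * H) = psi B0 G * psi B0 H by exact: rmorphM.
have psX B0 (G : S) m : psi B0 (G ^+ m) = psi B0 G ^+ m by exact: rmorphXn.
have [sz _] := ry_psi_top B hF.
have q0 : q != 0 by apply: contraNneq qT => ->; rewrite horner0.
have szq : (size q + l <= N.+1)%N.
  move: sz; have -> : size (ry (psi B F)) = (size q + l)%N by rewrite eF mulrC size_Mmonic ?monic_exp ?monicXsubC // size_exp_XsubC addnS.
  by [].
have lN : (l <= N)%N by move: szq; rewrite -size_poly_gt0 in q0; lia.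
have sq : (size q <= (N - l).+1)%N by lia.
have [F1 hF1 eF1] := uni_lift BD sq.
pose mu : S := lam D e0 - T *: lam D e2.
have hmu : mu \is 1.-homog by apply: rpredB; rewrite ?dhomogZ // lam_homog.
have emu : ry (psi B mu) = 'X - T%:P.
  rewrite /mu -mul_mpolyC psB psM psC (psi_lam0 BD) (psi_lam2 BD) mulr1 ryB ryX.
  by rewrite /bc /= ryC hornerC.
have hmul : mu ^+ l \is l.-homog by have := dhomogMn l hmu; rewrite mul1n.
have hG : F - mu ^+ l * F1 \is N.-homog.
  by apply: rpredB => //; rewrite -(subnKC lN); apply: dhomogM.
have eG : ry (psi B (F - mu ^+ l * F1)) = 0.
  by rewrite psB psM psX ryB ryM ryXn eF emu eF1 subrr.
have [G {}eG] := psi_restrict BD hG eG.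
have ryl G0 : ry (psi B' (lam D e1 * G0)) = 0.
  by rewrite -same_line psM ryM (psi_lam1 BD') ryyy mul0r.
have eq : ry (psi B' F) = ry (psi B' mu) ^+ l * ry (psi B' F1).
  rewrite -[F](subrK (mu ^+ l * F1)) eG.
  have ryD (a b : R) : ry (a + b) = ry a + ry b by exact: raddfD.
  by rewrite psD ryD ryl add0r psM psX ryM ryXn.
have [smu tmu] := ry_psi_top B' hmu.
have mu0 : (ry (psi B' mu))`_0 = 0.
  have h := meval_ry; rewrite -horner_coef0.
  have -> : (ry (psi B' mu)).[0] = mu.@[B' e2] by exact: (at0_psi B' mu).
  by rewrite (point_eval hmu) emu hornerXsubC subrr mulr0.
pose d := mu.@[B' e0].
have emu' : ry (psi B' mu) = d%:P * 'X.
  apply/polyP => -[|[|i]]; rewrite coefMX /= ?mu0 ?coefC //=.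
  by rewrite nth_default // (leq_trans smu).
have d0 : d != 0.
  apply/eqP => d0; rewrite d0 mul0r in emu'.
  have [G1 eG1] := psi_restrict BD' hmu emu'.
  have h : mu.@[B e0] = 1.
    by rewrite /mu mevalB mevalZ !(lam_eval BD) mulr0 subr0.
  move: h; rewrite eG1 same_line mevalM (lam_eval BD) mul0r => /eqP; by rewrite eq_sym oner_eq0.
exists (d%:P ^+ l * ry (psi B' F1)); split; first by rewrite eq emu' exprMn; ring.
rewrite hornerM -polyC_exp hornerC mulf_neq0 ?expf_neq0 //.
have -> : (ry (psi B' F1)).[0] = F1.@[B' e2] by exact: (at0_psi B' F1).
by rewrite (point_eval hF1) eF1 mulf_neq0 ?expf_neq0.
Qed.
End Transfer.
End Points.

Lemma sum_count_mem (T : eqType) (s r : seq T) : uniq s -> {subset r <= s} ->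
  (\sum_(x <- s) count_mem x r = size r)%N.
Proof.
move=> us; elim: r => [|z r ih] h; first by rewrite big1.
rewrite /= big_split /= ih; last by move=> x xr; apply: h; rewrite inE xr orbT.
have zs : z \in s by apply: h; rewrite mem_head.
rewrite (big_rem z) //= eqxx big_seq big1 ?add1n // => x; rewrite mem_rem_uniq // inE => /andP[+ _].
by rewrite eq_sym => /negPf ->.
Qed.

Section Line.
Variable K : closedFieldType.
Notation S := {mpoly K[3]}.
Notation R := {poly {poly K}}.

Lemma root_mult (p : {poly K}) : p != 0 -> exists m : K -> nat,
  (forall T, exists q, p = ('X - T%:P) ^+ m T * q /\ q.[T] != 0) /\
  forall s : seq K, uniq s -> (forall T, root p T -> T \in s) ->
    (\sum_(T <- s) m T)%N = (size p).-1.
Proof.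
move=> p0; have [r er] := closed_field_poly_normal p.
have lp : lead_coef p != 0 by rewrite lead_coef_eq0.
exists (fun T => count_mem T r); split=> [T|s us hs]; last first.
  rewrite sum_count_mem //; first by rewrite er size_scale // size_prod_XsubC.
  by move=> x xr; apply: hs; rewrite er rootZ // root_prod_XsubC.
exists (lead_coef p *: \prod_(z <- r | z != T) ('X - z%:P)); split; last first.
  rewrite hornerZ mulf_neq0 // horner_prod prodf_seq_neq0; apply/allP => z _ /=.
  by apply/implyP => zT; rewrite hornerXsubC subr_eq0 eq_sym.
rewrite -scalerAr {1}er; congr (_ *: _).
rewrite (bigID (fun z => z == T)) /=; congr (_ * _).
rewrite -big_filter (eq_big_seq (fun=> 'X - T%:P)) => [|z]; last first.
  by rewrite mem_filter => /andP[/eqP ->].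
by rewrite big_const_seq count_predT size_filter -Monoid.iteropE.
Qed.

Variables (B D : 'I_3 -> 'I_3 -> K).
Hypothesis BD : frame B D.
Notation lam := (lam D).
Notation rho F := (ry (psi B F)).
Definition line_pt T : 'I_3 -> K := fun i => B e2 i + T * B e0 i.
Definition line_coord (p : 'I_3 -> K) : K := (lam e0).@[p] / (lam e2).@[p].

Lemma lam_line_pt T : [/\ (lam e0).@[line_pt T] = T, (lam e1).@[line_pt T] = 0 & (lam e2).@[line_pt T] = 1].
Proof.
rewrite -!meval_ry (psi_lam0 BD) (psi_lam1 BD) (psi_lam2 BD) ryX ryyy.
by rewrite (rmorph1 (@ry K)) hornerX horner0 hornerC.
Qed.

Lemma point_lam (p : 'I_3 -> K) i : p i = \sum_a B a i * (lam a).@[p].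
Proof.
rewrite -[LHS](mevalXU p i) (X_lam BD) (raddf_sum (meval p)) /=.
by apply: eq_bigr => a _; apply: mevalZ.
Qed.

Variables (n : nat) (f : S).
Hypothesis hf : f \is n.-homog.
Hypothesis f0 : f.@[B e0] != 0.

Lemma size_rho : size (rho f) = n.+1.
Proof.
have [h1 h2] := ry_psi_top B hf; apply/eqP; rewrite eqn_leq h1 /=.
by rewrite ltnNge; apply: contraNN f0 => h; rewrite -h2 nth_default.
Qed.

(** The point at infinity of the line is off the curve, so every intersection point has an affine
    coordinate on the line, which is a root of [rho f]. *)
Lemma line_coordP (p : 'I_3 -> K) : (exists i, p i != 0) -> f.@[p] = 0 -> (lam e1).@[p] = 0 ->
  [/\ (lam e2).@[p] != 0, forall i, p i = (lam e2).@[p] * line_pt (line_coord p) i &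
      root (rho f) (line_coord p)].
Proof.
move=> [i0 pi0] fp l1.
have e i : p i = B e0 i * (lam e0).@[p] + B e2 i * (lam e2).@[p].
  by rewrite [LHS]point_lam sum3 l1 mulr0 addr0.
have l2 : (lam e2).@[p] != 0.
  apply/eqP => l2; have e' i : p i = (lam e0).@[p] * B e0 i by rewrite e l2 mulr0 addr0 mulrC.
  have := fp; have -> : f.@[p] = f.@[fun i => (lam e0).@[p] * B e0 i] by apply: meval_eq => i; rewrite {1}e'.
  rewrite (meval_scale _ _ hf) => /eqP; rewrite mulf_eq0 (negPf f0) orbF expf_eq0 => /andP[_ /eqP l0].
  by case/eqP: pi0; rewrite e' l0 mul0r.
have e2' i : p i = (lam e2).@[p] * line_pt (line_coord p) i.
  rewrite e /line_pt /line_coord mulrDr mulrA [_ * (_ / _)]mulrCA divff // mulr1; ring.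
split=> //; apply/rootP; rewrite meval_ry.
have := fp; have -> : f.@[p] = f.@[fun i => (lam e2).@[p] * line_pt (line_coord p) i].
  by apply: meval_eq => i; rewrite {1}e2'.
rewrite (meval_scale _ _ hf) => /eqP; rewrite mulf_eq0 expf_eq0 (negPf l2) andbF => /eqP; exact.
Qed.

Lemma line_pt_zero T : root (rho f) T ->
  [/\ exists i, line_pt T i != 0, f.@[line_pt T] = 0 & (lam e1).@[line_pt T] = 0].
Proof.
move=> /rootP; rewrite meval_ry => h; have [h0 h1 h2] := lam_line_pt T; split=> //.
apply: NNPP => hn; move: h2.
have -> : (lam e2).@[line_pt T] = (lam e2).@[fun i => 0 * line_pt T i].
  apply: meval_eq => i; rewrite mul0r; apply/eqP/negPn/negP => hi; apply: hn; by exists i.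
rewrite (meval_scale _ _ (lam_homog D e2)) expr1 mul0r => /eqP; by rewrite eq_sym oner_eq0.
Qed.

Lemma line_coord_pt T : line_coord (line_pt T) = T.
Proof. by rewrite /line_coord; have [-> _ ->] := lam_line_pt T; rewrite divr1. Qed.

Lemma line_coord_scale c (p q : 'I_3 -> K) : c != 0 -> (forall i, p i = c * q i) ->
  line_coord p = line_coord q.
Proof.
move=> c0 e; rewrite /line_coord.
have h a : (lam a).@[p] = c * (lam a).@[q].
  rewrite -[c]expr1 -(meval_scale _ _ (lam_homog D a)); apply: meval_eq => i; exact: e.
by rewrite !h -mulf_div divff // mul1r.
Qed.
End Line.

Lemma chart_neq0 (p : pt) : nonzero_pt p -> p (chart p) != 0.
Proof.
move=> [i0 pi0]; rewrite /chart.
have [E0 [E1 E2]] : inord 0 = e0 /\ inord 1 = e1 /\ inord 2 = e2.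
  by split; [|split]; apply: val_inj; rewrite /= inordK.
rewrite E0 E1 E2; case: ifP => // /negbFE/eqP p2; case: ifP => // /negbFE/eqP p1.
move: i0 pi0; apply: (ord3P (P := fun i0 => p i0 != 0 -> p e0 != 0)) => //.
  by rewrite p1 eqxx.
by rewrite p2 eqxx.
Qed.

(** * Summation over the points of the curve on the line *)

Section Epsilon.
Variables (B D : 'I_3 -> 'I_3 -> K).
Hypothesis BD : frame B D.
Notation al := (lam D e1).
Notation rho F := (ry (psi B F)).
Notation coord := (line_coord D).
Variables (n : nat) (f : S).
Hypothesis hf : f \is n.+1.-homog.
Hypothesis f_red : red f.
Hypothesis f0 : f.@[B e0] != 0.

Lemma rho_neq0 : rho f != 0.
Proof. by rewrite -size_poly_gt0 (size_rho hf f0). Qed.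

Lemma line_rep_list : exists s, rep_list f al s.
Proof.
have [r er] := closed_field_poly_normal (rho f).
have rr T : (T \in undup r) = root (rho f) T.
  by rewrite mem_undup er rootZ ?root_prod_XsubC // lead_coef_eq0 rho_neq0.
exists (map (line_pt B) (undup r)); split=> [i|i j|p [pn fp ap]].
- rewrite size_map => hi; rewrite (nth_map 0) //.
  by apply: (line_pt_zero BD); rewrite -rr mem_nth.
- rewrite size_map => hi hj ij [c e]; apply: ij.
  rewrite !(nth_map 0) // in e.
  set u := nth 0 _ i in e; set v := nth 0 _ j in e.
  have uv : u = v.
    have c0 : c != 0.
      have [|[k hk] _ _] := line_pt_zero BD (T := u) (f := f); first by rewrite -rr mem_nth.
      by apply: contraNneq hk => c0; rewrite e c0 mul0r.
    by rewrite -(line_coord_pt BD u) -(line_coord_pt BD v); apply: line_coord_scale c0 e.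
  by apply/eqP; rewrite -(nth_uniq 0 hi hj (undup_uniq r)); apply/eqP.
- have [l2 e rt] := line_coordP BD hf f0 pn fp ap.
  rewrite -rr in rt; exists (index (coord p) (undup r)); first by rewrite size_map index_mem.
  rewrite (nth_map 0) ?index_mem // nth_index //; by exists (lam D e2).@[p].
Qed.

Notation nthp s i := (nth (fun _ => 0 : K) s i).

Lemma reps_line : let s := map coord (reps f al) in
  [/\ uniq s, forall T, root (rho f) T -> T \in s & forall i, (i < size (reps f al))%N ->
   common_zero f al (nthp (reps f al) i)].
Proof.
(* [reps] defaults to the empty list when no list of representatives exists; [line_rep_list]
   excludes this. *)
have [s [h1 h2 h3] ->] : exists2 s, rep_list f al s & reps f al = s.
  rewrite /reps; case: excluded_middle_informative => [h|[]]; last exact: line_rep_list.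
  by exists (proj1_sig (constructive_indefinite_description _ h)); last by []; exact: proj2_sig.
split=> // [|T rT].
  apply/(uniqP 0) => i j; rewrite !inE size_map => hi hj; rewrite !(nth_map (fun=> 0)) // => e.
  apply/eqP/negPn/negP => /eqP ij; apply: (h2 i j hi hj ij).
  have [n1 z1 a1] := h1 i hi; have [n2 z2 a2] := h1 j hj.
  have [l1 c1 _] := line_coordP BD hf f0 n1 z1 a1.
  have [l2 c2 _] := line_coordP BD hf f0 n2 z2 a2.
  exists ((lam D e2).@[nthp s i] / (lam D e2).@[nthp s j]) => k.
  by rewrite [LHS]c1 [in RHS]c2 e mulrA divfK.
have [pn z a] := line_pt_zero BD rT.
have [i hi [c e]] := h3 _ (And3 pn z a).
apply/(nthP 0); exists i; rewrite ?size_map // (nth_map (fun=> 0)) //.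
have c0 : c != 0.
  by case: pn => [k hk]; apply: contraNneq hk => c0; rewrite e c0 mul0r.
by rewrite -[RHS](line_coord_pt BD); apply/esym/(line_coord_scale D c0 e).
Qed.

Variables (eta : 'I_3 -> S) (ke : S) (M : nat).
Hypothesis eta_f : adr eta f = ke * f.
Notation Q := (adr eta al).
Hypothesis hQ : Q \is M.-homog.
Hypothesis Q_gen : forall th M, homd th M -> (exists k, adr th f = k * f) ->
  exists m r, adr th al = m * Q + al * r.

(** Adding the line raises the Milnor number by 2 mf - 1 and the Tjurina number by mf + mq. *)
Lemma eps_pt_line p mf mq qf qq : common_zero f al p ->
  rho f = ('X - (coord p)%:P) ^+ mf * qf -> qf.[coord p] != 0 ->
  rho Q = ('X - (coord p)%:P) ^+ mq * qq -> qq.[coord p] != 0 ->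
  eps_pt f al p = mf%:Z - 1 - mq%:Z.
Proof.
move=> [pn fp ap] ef ef0 eq eq0.
have ck := chart_neq0 pn; set k := chart p in ck.
have nk : normalize p k = 1 by rewrite /normalize divff.
have np i : normalize p i = (p k)^-1 * p i by rewrite /normalize mulrC.
have scale0 (F : S) d : F \is d.-homog -> F.@[p] = 0 -> F.@[normalize p] = 0.
  move=> hF F0; have -> : F.@[normalize p] = F.@[fun i => (p k)^-1 * p i] by apply: meval_eq.
  by rewrite (meval_scale _ _ hF) F0 mulr0.
have [B' [D' [BD' eal Dk Bn]]] := local_frame nk (lam_neq0 BD e1) (lam_homog D e1)
  (scale0 _ _ (lam_homog D e1) ap).
have [l2 epc _] := line_coordP BD hf f0 pn fp ap.
pose c := (p k)^-1 * (lam D e2).@[p].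
have c0 : c != 0 by rewrite mulf_neq0 // invr_eq0.
have pt i : B' e2 i = c * (B e2 i + coord p * B e0 i).
  by rewrite Bn np [p i]epc mulrA.
have [bf [tf bf0]] := mult_transfer BD BD' eal c0 pt hf ef ef0.
have [bq [tq bq0]] := mult_transfer BD BD' eal c0 pt hQ eq eq0.
have [i ei] : exists i, mf = i.+1.
  case: (mf) tf => [|i] tf; last by exists i.
  case/eqP: bf0; have := at0_psi B' f; rewrite /at0 tf expr0 mulr1 => ->.
  have -> : f.@[B' e2] = f.@[normalize p] by apply: meval_eq => j; rewrite Bn.
  exact: scale0 hf fp.
rewrite ei in tf.
rewrite -eal in tq.
have Qg th N : homd th N -> (exists k, adr th f = k * f) ->
  exists m r, adr th (lam D' e1) = m * adr eta (lam D' e1) + lam D' e1 * r.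
  by rewrite eal; exact: Q_gen.
have [m [t [L1 L2 L3 L4]]] := point_numbers K_char0 BD' hf f_red eta_f Qg tf bf0 tq bq0.
rewrite eal in L2 L4.
have m1 := milnor_frame BD' Dk (erefl k) Bn L1.
have m2 := milnor_frame BD' Dk (erefl k) Bn L2.
have t1 := tjurina_frame BD' Dk (erefl k) Bn L3.
have t2 := tjurina_frame BD' Dk (erefl k) Bn L4.
rewrite /eps_pt m1 m2 t1 t2 ei; lia.
Qed.

(** The -1 at each point cancels the number of points, and multiplicities add up to degrees. For [Q]
    this needs all its roots on the line to lie on the curve. *)
Theorem npts_eps : rho Q != 0 -> (forall T, root (rho Q) T -> root (rho f) T) ->
  (npts f al)%:Z + eps f al = n.+1%:Z - (size (rho Q)).-1%:Z.
Proof.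
move=> Q0 Qf.
have [mf [hmf sf]] := root_mult rho_neq0.
have [mq [hmq sq]] := root_mult Q0.
have [us rs cz] := reps_line.
have {}sf := sf _ us rs.
have {}sq := sq _ us (fun T h => rs T (Qf T h)).
rewrite (size_rho hf f0) /= in sf.
rewrite /npts /eps (big_nth (fun=> 0 : K)).
rewrite (eq_big_nat _ _ (F2 := fun i => (mf (coord (nthp (reps f al) i)))%:Z - 1
   - (mq (coord (nthp (reps f al) i)))%:Z)) => [|i hi]; last first.
  have [q1 [e1' q10]] := hmf (coord (nthp (reps f al) i)).
  have [q2 [e2' q20]] := hmq (coord (nthp (reps f al) i)).
  by apply: (eps_pt_line (cz i _) e1' q10 e2' q20).
rewrite -(big_nth (fun=> 0 : K) predT (fun p => (mf (coord p))%:Z - 1 - (mq (coord p))%:Z)).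
have s1 : \sum_(p <- reps f al) (1 : int) = (size (reps f al))%:Z.
  by elim: (reps f al) => [|p s ih]; rewrite ?big_nil // big_cons ih.
rewrite -sf -sq !big_map !sumrB s1 !(big_morph Posz PoszD (erefl 0%:Z)); ring.
Qed.
End Epsilon.

(** * Graded generators modulo the Euler field *)

Section Graded.
Variable K : closedFieldType.
Notation S := {mpoly K[3]}.
Notation der := ('I_3 -> S).
Implicit Types (F : S) (th : der).

(* [c] times a [d]-homogeneous element is [M]-homogeneous *)
Definition gh (M d : nat) (c : S) := c = 0 \/ exists2 k, (d + k)%N = M & c \is k.-homog.

Definition gpart (M d : nat) (c : S) : S := if (d <= M)%N then pihomog mdeg (M - d) c else 0.

Lemma gpart_gh M d (c : S) : gh M d (gpart M d c).
Proof.
rewrite /gpart; case: leqP => h; [right|by left].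
by exists (M - d)%N; rewrite ?subnKC // pihomogP.
Qed.

Lemma pihomog_gpart M d (c : S) F : F \is d.-homog -> pihomog mdeg M (c * F) = gpart M d c * F.
Proof.
move=> hF; rewrite /gpart; case: leqP => h.
  by rewrite -[in LHS](subnKC h) mulrC (pihomogM _ _ hF) mulrC.
rewrite mul0r {1}(pihomog_partitionE (mf := mdeg) (k := msize c) (p := c)) // mulr_suml raddf_sum /=.
apply: big1 => j _; apply: (pihomog_ne0 (d := (j + d)%N)); first by rewrite gtn_eqF // ltn_addl.
by apply: dhomogM => //; apply: pihomogP.
Qed.

Lemma gh_homog M d (c : S) F : gh M d c -> F \is d.-homog -> c * F \is M.-homog.
Proof.
move=> [->|[k <- hc]] hF; first by rewrite mul0r dhomog0.
by rewrite mulrC; apply: dhomogM.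
Qed.

Lemma gh_mul M d e (c c' : S) : gh M d c -> gh d e c' -> gh M e (c * c').
Proof.
move=> [->|[k <- hc]]; first by rewrite mul0r; left.
move=> [->|[l <- hc']]; first by rewrite mulr0; left.
by right; exists (k + l)%N; [rewrite -addnA [(l + k)%N]addnC|apply: dhomogM].
Qed.

Lemma homog_at0 k F : F \is k.+1.-homog -> F.@[fun=> 0] = 0.
Proof.
move=> hF; have -> : F.@[fun=> 0] = F.@[fun i => 0 * (0 : K)] by apply: meval_eq => i; rewrite mul0r.
by rewrite (meval_scale _ _ hF) exprS !mul0r.
Qed.

Lemma gh_at0 M d (c : S) : gh M d c -> c.@[fun=> 0] != 0 -> M = d.
Proof.
move=> [->|[[|k] <- hc]]; rewrite ?meval0 ?eqxx ?addn0 //.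
by rewrite (homog_at0 hc) eqxx.
Qed.

Lemma gh_sum M d (I : finType) (F : I -> S) : (forall i, gh M d (F i)) -> gh M d (\sum_i F i).
Proof.
move=> h; have [dM|Md] := leqP d M; last first.
  left; apply: big1 => i _; case: (h i) => // -[k ek]; lia.
right; exists (M - d)%N; first by rewrite subnKC.
apply: rpred_sum => i _; case: (h i) => [->|[k <- hk]]; first exact: dhomog0.
by rewrite addKn.
Qed.

Lemma dvd_homog1 M d (x y z : S) : x != 0 -> y != 0 -> y \is 1.-homog -> gh M d z -> z = x * y ->
  (d < M)%N.
Proof.
move=> x0 y0 hy gz ez; have z0 : z != 0 by rewrite ez mulf_neq0.
case: gz => [/eqP|[k <- hk]]; first by rewrite (negPf z0).
rewrite ez mulrC in hk; have [k1 _] := homog_quot y0 hy hk x0.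
by rewrite -addn1 leq_add2l.
Qed.

Definition lcomb a (c : 'I_a -> S) (g : 'I_a -> der) : der := fun i => \sum_j c j * g j i.

Lemma graded_lcomb M a (c : 'I_a -> S) (g : 'I_a -> der) (d : 'I_a -> nat) (th : der) (e : S) :
  (forall j, homd (g j) (d j)) -> homd th M ->
  (forall i, th i = e * 'X_i + lcomb c g i) ->
  forall i, th i = gpart M 1 e * 'X_i + lcomb (fun j => gpart M (d j) (c j)) g i.
Proof.
move=> hg hth E i; rewrite -[LHS](pihomog_dE (hth i)) E raddfD /=.
rewrite (pihomog_gpart _ _ (d := 1)); last by rewrite dhomogX /= mdeg1.
congr (_ + _); rewrite raddf_sum; apply: eq_bigr => j _; exact: pihomog_gpart (hg j i).
Qed.

Variable f : S.
Definition inD th := exists k, adr th f = k * f.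

Definition gens a (g : 'I_a -> der) (d : 'I_a -> nat) :=
  [/\ forall j, homd (g j) (d j), forall j, inD (g j) &
   forall th M, homd th M -> inD th -> exists (e : S) (c : 'I_a -> S), forall i, th i = e * 'X_i + lcomb c g i].

(** Minimality in the graded sense: modulo the Euler field, every relation has its coefficients in
    the maximal ideal of the origin. *)
Definition minrel a (g : 'I_a -> der) := forall (e : S) (c : 'I_a -> S),
  (forall i, e * 'X_i + lcomb c g i = 0) -> forall j, (c j).@[fun=> 0] = 0.

Lemma gens_matrix a b (g : 'I_a -> der) d (g' : 'I_b -> der) d' : gens g d -> gens g' d' ->
  exists M : 'M[S]_(b, a), (forall i j, gh (d' i) (d j) (M i j)) /\
    forall i, exists e, forall k, g' i k = e * 'X_k + lcomb (M i) g k.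
Proof.
move=> [hg _ gen] [hg' gD' _].
have h i : exists c : 'I_a -> S, (forall j, gh (d' i) (d j) (c j)) /\
   exists e, forall k, g' i k = e * 'X_k + lcomb c g k.
  have [e [c E]] := gen _ _ (hg' i) (gD' i).
  exists (fun j => gpart (d' i) (d j) (c j)); split=> [j|]; first exact: gpart_gh.
  by exists (gpart (d' i) 1 e); apply: graded_lcomb.
have [c hc] := fun_choice h.
exists (\matrix_(i, j) c i j); split=> [i j|i]; first by rewrite mxE; case: (hc i).
have [_ [e E]] := hc i; exists e => k; rewrite E; congr (_ + _).
by apply: eq_bigr => j _; rewrite mxE.
Qed.

Lemma lcomb_trans a b (g : 'I_a -> der) (g' : 'I_b -> der) (M : 'M[S]_(b, a)) :
  (forall i, exists e, forall k, g' i k = e * 'X_k + lcomb (M i) g k) ->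
  forall (c : 'rV[S]_b), exists e, forall k, lcomb (c 0) g' k = e * 'X_k + lcomb ((c *m M) 0) g k.
Proof.
move=> /fun_choice [e E] c; exists (\sum_i c 0 i * e i) => k.
rewrite /lcomb mulr_suml; under eq_bigr => i _ do rewrite E mulrDr mulrA.
rewrite big_split /=; congr (_ + _).
under [RHS]eq_bigr => j _ do rewrite mxE mulr_suml.
rewrite exchange_big /=; apply: eq_bigr => i _; rewrite mulr_sumr.
by apply: eq_bigr => j _; rewrite mulrA.
Qed.

Notation at00 := (map_mx (meval (fun=> 0 : K))).

(** Expressing [g] by [g'] and back makes each row of N M - 1 a relation of [g], whose entries
    vanish at the origin. *)
Lemma minrel_inverse a b (g : 'I_a -> der) (g' : 'I_b -> der) (M : 'M[S]_(b, a)) (N : 'M[S]_(a, b)) :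
  (forall i, exists e, forall k, g' i k = e * 'X_k + lcomb (M i) g k) ->
  (forall i, exists e, forall k, g i k = e * 'X_k + lcomb (N i) g' k) ->
  minrel g -> at00 N *m at00 M = 1%:M.
Proof.
move=> hM hN hg; rewrite -map_mxM; apply/matrixP => i j.
have [e E] := hN i; have [e' E'] := lcomb_trans hM (row i N).
have := hg (e + e') (fun j => (N *m M) i j - (i == j)%:R) _ j.
rewrite !mxE => h; apply/eqP; rewrite -subr_eq0; apply/eqP; rewrite -[RHS]h.
  rewrite mevalB; congr (_ - _).
  by case: (i == j); rewrite ?meval1 ?meval0.
move=> {h} k; have := E k.
have -> : lcomb (N i) g' k = lcomb (row i N 0) g' k by apply: eq_bigr => l _; rewrite mxE.
rewrite E' => /eqP; rewrite -subr_eq0 => /eqP e0.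
have -> : lcomb (fun j => (N *m M) i j - (i == j)%:R) g k = lcomb ((row i N *m M) 0) g k - g i k.
  rewrite /lcomb (eq_bigr (fun j => (row i N *m M) 0 j * g j k - (i == j)%:R * g j k)).
    rewrite sumrB; congr (_ - _).
    rewrite (bigD1 i) //= eqxx mul1r big1 ?addr0 // => l li.
    by rewrite eq_sym (negPf li) mul0r.
  by move=> l _; rewrite -mulrBl -row_mul [in RHS]mxE.
rewrite -[RHS]oppr0 -e0; ring.
Qed.

Lemma gens_le a b (g : 'I_a -> der) d (g' : 'I_b -> der) d' :
  gens g d -> gens g' d' -> minrel g -> (a <= b)%N.
Proof.
move=> hg hg' hm.
have [M [_ hM]] := gens_matrix hg hg'; have [N [_ hN]] := gens_matrix hg' hg.
exact: mulmx1_min (minrel_inverse hM hN hm).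
Qed.

Lemma det_perm_neq0 (L : fieldType) n (A : 'M[L]_n) : \det A != 0 ->
  exists s : 'S_n, forall i, A i (s i) != 0.
Proof.
move=> h; apply: NNPP => hn; case/eqP: h; rewrite /determinant big1 // => s _.
have [i Ai] : exists i, A i (s i) = 0.
  apply: NNPP => hi; apply: hn; exists s => i; apply/eqP => Ai; apply: hi; by exists i.
by rewrite (bigD1 i) //= Ai mul0r mulr0.
Qed.

(** The transition matrix is invertible at the origin, so some permutation has only nonzero entries
    there. A homogeneous entry that is nonzero at the origin has degree 0, which equates the two
    degrees. *)
Lemma gens_perm a (g g' : 'I_a -> der) d d' :
  gens g d -> gens g' d' -> minrel g -> exists s : 'S_a, forall i, d' i = d (s i).
Proof.
move=> hg hg' hm.
have [M [gM hM]] := gens_matrix hg hg'; have [N [_ hN]] := gens_matrix hg' hg.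
have e := minrel_inverse hM hN hm.
have : \det (at00 M) != 0.
  apply/eqP => d0; have := congr1 determinant e; rewrite det_mulmx d0 mulr0 det1.
  by move/eqP; rewrite eq_sym oner_eq0.
case/det_perm_neq0 => s hs; exists s => i; apply: gh_at0 (gM i (s i)) _.
by have := hs i; rewrite mxE.
Qed.

Lemma minrel_det_neq0 a (g g' : 'I_a -> der) (M N : 'M[S]_a) :
  (forall i, exists e, forall k, g' i k = e * 'X_k + lcomb (M i) g k) ->
  (forall i, exists e, forall k, g i k = e * 'X_k + lcomb (N i) g' k) ->
  minrel g -> \det M != 0 /\ \det N != 0.
Proof.
move=> hM hN hm; have e := congr1 determinant (minrel_inverse hM hN hm).
rewrite det_mulmx !det_map_mx det1 in e.
split; apply/eqP => d0; move/eqP: e; rewrite d0 (rmorph0 (meval _)) ?mul0r ?mulr0 eq_sym oner_eq0 //.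
Qed.
End Graded.

(** * Deletion of a line from a free curve *)

Section GenericFrame.
Variable K : closedFieldType.
Notation S := {mpoly K[3]}.
Notation der := ('I_3 -> S).
Implicit Types (th : der).

Lemma adrD th (F G : S) : adr th (F + G) = adr th F + adr th G.
Proof. by rewrite /adr -big_split; apply: eq_bigr => i _; rewrite mderivD mulrDr. Qed.
Lemma adrZ th c (F : S) : adr th (c *: F) = c *: adr th F.
Proof. by rewrite /adr scaler_sumr; apply: eq_bigr => i _; rewrite mderivZ scalerAr. Qed.
Lemma adrM th (F G : S) : adr th (F * G) = adr th F * G + F * adr th G.
Proof.
rewrite /adr mulr_suml mulr_sumr -big_split; apply: eq_bigr => i _.
by rewrite mderivM mulrDr; congr (_ + _); [exact: mulrA|exact: mulrCA].
Qed.
Lemma adr_homog th d n (F : S) : homd th d -> F \is n.+1.-homog -> adr th F \is (d + n).-homog.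
Proof.
move=> hth hF; apply: rpred_sum => i _; apply: dhomogM => //.
have := dird_homog (fun j => (j == i)%:R : K) hF.
rewrite /dird (bigD1 i) //= eqxx scale1r big1 ?addr0 // => j /negPf ->; exact: scale0r.
Qed.
Lemma adrX th i : adr th 'X_i = th i.
Proof.
have e j : 'X_i^`M(j) = (i == j)%:R :> S.
  have := dirdX (fun l => (l == j)%:R : K) i; rewrite /dird (bigD1 j) //= eqxx scale1r.
  rewrite big1 => [|l /negPf ->]; last exact: scale0r.
  by rewrite addr0 => ->; case: (i == j); rewrite ?mpolyC1 ?mpolyC0.
rewrite /adr (bigD1 i) //= e eqxx mulr1 big1 ?addr0 // => j ji.
by rewrite e eq_sym (negPf ji) mulr0.
Qed.

(** The determinant of the [e0] and [e2] components of [th] and of the Euler field; on the line it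
    vanishes exactly when a field tangent to the line is proportional to the Euler field. *)
Definition line_wedge (D : 'I_3 -> 'I_3 -> K) th : S :=
  lam D e2 * adr th (lam D e0) - lam D e0 * adr th (lam D e2).

Lemma line_wedge_homog D th d : homd th d -> line_wedge D th \is d.+1.-homog.
Proof.
move=> hth; have h a : adr th (lam D a) \is d.-homog.
  by have := adr_homog hth (lam_homog D a); rewrite addn0.
have key a b : lam D a * adr th (lam D b) \is d.+1.-homog.
  exact: (dhomogM (lam_homog D a) (h b)).
by apply: rpredB; apply: key.
Qed.

Lemma frame_exists (al : S) : al != 0 -> al \is 1.-homog ->
  exists B D, frame B D /\ lam D e1 = al.
Proof.
move=> al0 hal; have [a ea] := linear_form hal.
have ev (q : 'I_3 -> K) : al.@[q] = a e0 * q e0 + a e1 * q e1 + a e2 * q e2.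
  rewrite ea (raddf_sum (meval q)) /= sum3; congr (_ + _ + _); rewrite mevalZ mevalXU //.
have [q [k [qk q0]]] : exists q k, q k = 1 /\ al.@[q] = 0.
  have [a0|a0] := eqVneq (a e0) 0.
    exists (fun i => (i == e0)%:R), e0; rewrite ev /=; split=> //; rewrite a0 !mulr0 mul0r !addr0 //.
  exists (fun i => if i == e0 then - a e1 / a e0 else (i == e1)%:R), e1; rewrite ev /=; split=> //.
  by rewrite mulr0 addr0 mulrCA divff // !mulr1 addNr.
by have [B [D [BD e _ _]]] := local_frame qk al0 hal q0; exists B, D.
Qed.

(** A point [B e2 + T B e0] of the line where [G] is nonzero becomes the new point at infinity. The
    coordinate change on the line has determinant -1, whence the sign of [line_wedge]. *)
Lemma rotate_frame (B D : 'I_3 -> 'I_3 -> K) N (G : S) : frame B D -> G \is N.-homog ->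
  ~ (exists G', G = lam D e1 * G') ->
  exists B' D', [/\ frame B' D', lam D' e1 = lam D e1, G.@[B' e0] != 0 &
    forall th, line_wedge D' th = - line_wedge D th].
Proof.
move=> BD hG Gl; have : ry (psi B G) != 0.
  by apply/eqP => e; apply: Gl; apply: (psi_restrict BD hG e).
case/closed_nonrootP => T /rootP; rewrite meval_ry => GT.
pose B' (a : 'I_3) i : K := match val a with 0 => B e2 i + T * B e0 i | 1 => B e1 i | _ => B e0 i end.
pose D' (a : 'I_3) i : K := match val a with 0 => D e2 i | 1 => D e1 i | _ => D e0 i - T * D e2 i end.
have l2 : lam D' e2 = lam D e0 - T *: lam D e2.
  rewrite /lam /D' /= scaler_sumr -sumrB; apply: eq_bigr => i _.
  by rewrite scalerBl scalerA.
exists B', D'; split=> //; last first.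
- move=> th; rewrite /line_wedge l2 -[lam D' e0]/(lam D e2).
  rewrite -scaleN1r scalerA adrD adrZ mulN1r -!mul_mpolyC; ring.
- exact/eqP.
- have dd a b : \sum_i D a i * B b i = (a == b)%:R by exact: frame_dual BD a b.
  have EB u w t z : \sum_(i < 3) u i * (w i + t * z i) = \sum_i u i * w i + t * \sum_i u i * z i :> K.
    by rewrite mulr_sumr -big_split; apply: eq_bigr => i _ /=; ring.
  have ED u v t w : \sum_(i < 3) (u i - t * v i) * w i = \sum_i u i * w i - t * \sum_i v i * w i :> K.
    by rewrite mulr_sumr -sumrB; apply: eq_bigr => i _ /=; ring.
  apply: frame_of_dual; apply: ord3P; apply: ord3P; rewrite /B' /D' /=.
  all: try exact: dd.
  all: rewrite ?EB ?ED ?EB !dd /=; ring.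
Qed.

(** One rotation suffices for all conditions: the point at infinity has to avoid the product of [f]
    with those wedges that do not vanish on the line, a product not divisible by the prime [al]. *)
Lemma generic_frame (al f : S) n th1 th2 d1 d2 : al != 0 -> al \is 1.-homog ->
  f \is n.-homog -> ~ (exists G, f = al * G) -> homd th1 d1 -> homd th2 d2 ->
  exists B D, [/\ frame B D, lam D e1 = al, f.@[B e0] != 0 &
    forall th, th = th1 \/ th = th2 -> (line_wedge D th).@[B e0] = 0 -> exists G, line_wedge D th = al * G].
Proof.
move=> al0 hal hf fal h1 h2; have [B [D [BD ea]]] := frame_exists al0 hal.
have prim F G : (exists H, F * G = al * H) -> (exists H, F = al * H) \/ (exists H, G = al * H).
  by rewrite -ea; exact: (lam_prime BD).
have one : ~ exists H, 1 = al * H.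
  case=> H e; have := congr1 (meval (fun=> 0 : K)) e.
  by rewrite meval1 mevalM (homog_at0 hal) mul0r => /eqP; rewrite oner_eq0.
have hw th d : homd th d -> exists m g, [/\ g \is m.-homog, ~ (exists H, g = al * H) &
    (exists H, line_wedge D th = al * H) \/ g = line_wedge D th].
  move=> hth; case: (classic (exists H, line_wedge D th = al * H)) => h.
    exists 0%N, 1; split=> //; [exact: dhomog1|by left].
  exists d.+1, (line_wedge D th); split=> //; [exact: line_wedge_homog|by right].
have [m1 [g1 [hg1 ng1 cg1]]] := hw _ _ h1; have [m2 [g2 [hg2 ng2 cg2]]] := hw _ _ h2.
have hG : f * (g1 * g2) \is (n + (m1 + m2)).-homog := dhomogM hf (dhomogM hg1 hg2).
have nG : ~ exists H, f * (g1 * g2) = lam D e1 * H by rewrite ea => /prim [//|/prim []].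
have [B' [D' [BD' e' ne hw']]] := rotate_frame BD hG nG; exists B', D'.
move: ne; rewrite !mevalM !mulf_eq0 !negb_or => /and3P [nf n1 n2].
have key th g : (exists H, line_wedge D th = al * H) \/ g = line_wedge D th -> g.@[B' e0] != 0 ->
    (line_wedge D' th).@[B' e0] = 0 -> exists G, line_wedge D' th = al * G.
  rewrite hw'; case=> [[H ->] _ _|-> g0 /eqP]; first by exists (- H); rewrite mulrN.
  by rewrite mevalN oppr_eq0 (negPf g0).
by split=> // [|th [->|->]]; [rewrite e'|exact: key cg1 n1|exact: key cg2 n2].
Qed.
End GenericFrame.

(** * Saito's criterion *)

Section Saito.
Variable K : closedFieldType.
Hypothesis char0 : forall n, n.+1%:R != 0 :> K.
Notation S := {mpoly K[3]}.
Notation R := {poly {poly K}}.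
Notation bc := (@bc K).

Lemma fr_irreducible (q : {poly {fraction {poly K}}}) : irreducible_poly q ->
  exists2 h : R, irreducible_poly (fr h) & fr h %= q.
Proof.
move=> [sq iq]; have [c [h [c0 eh]]] := fr_clear q; exists h.
  split; rewrite -eh frC mul_polyC ?size_scale ?tofrac_eq0 //.
  move=> p sp; rewrite dvdpZr ?tofrac_eq0 // => /(iq p sp) /eqp_trans; apply.
  by rewrite eqp_sym eqp_scale // tofrac_eq0.
by rewrite -eh frC mul_polyC eqp_scale // tofrac_eq0.
Qed.

Lemma fr_dvd (a b : R) : fr a %| fr b -> exists (c : {poly K}) s, c != 0 /\ c%:P * b = a * s.
Proof.
move=> /dvdpP [q eq]; have [c [s [c0 es]]] := fr_clear q.
exists c, s; split=> //; apply: fr_inj.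
by rewrite !frM eq -es [LHS]mulrA [LHS]mulrC.
Qed.

(** A common factor h of g = h s and g_x over [K(y)] would divide h_x s; being coprime to h_x in
    characteristic 0, it would divide s. *)
Lemma sqfree_bezout (g : R) : g != 0 -> sqfree g ->
  exists (e : {poly K}) a b, e != 0 /\ a * g + b * g^`() = e%:P.
Proof.
move=> g0 sf.
have edf (r : R) : fr r^`() = (fr r)^`() by exact: esym (deriv_map _ _).
have cop : coprimep (fr g) (fr g^`()).
  apply/negPn/negP => ncop; have d0 : gcdp (fr g) (fr g^`()) != 0 by rewrite gcdp_eq0 fr_eq0 negb_and g0.
  have [|q iq qd] := @irreducible_factor _ (gcdp (fr g) (fr g^`())).
    by rewrite ltn_neqAle eq_sym ncop size_poly_gt0.
  move: qd; rewrite dvdp_gcd => /andP[qg qg'].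
  have [h ih hq] := fr_irreducible iq.
  have hg : fr h %| fr g by rewrite (eqp_dvdl _ hq).
  have hg' : fr h %| fr g^`() by rewrite (eqp_dvdl _ hq).
  have [c [s [c0 es]]] := fr_dvd hg.
  have : fr h %| fr h^`() * fr s.
    have -> : fr h^`() * fr s = fr c%:P * fr g^`() - fr s^`() * fr h.
      have e := congr1 (fun p : R => fr p^`()) es.
      rewrite !derivM derivC mul0r add0r !(frM, frD) in e; rewrite e.
      move: (fr h^`()) (fr s) (fr h) (fr s^`()) => x1 x2 x3 x4; ring.
    by apply: dvdp_sub; apply: dvdp_mull.
  have sh : (1 < size h)%N by rewrite -size_fr; case: ih.
  have ch : coprimep (fr h) (fr h^`()).
    rewrite irreducible_poly_coprime //; apply/negP => /dvdp_leq.
    rewrite fr_eq0 (deriv_neq0 char0) // => /(_ isT); rewrite !size_fr leqNgt lt_size_deriv //.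
    by apply: contraTneq sh => ->; rewrite size_poly0.
  rewrite Gauss_dvdpr // => /fr_dvd [c' [s' [c'0 es']]].
  apply: (sf h ih); exists (c' * c), s'; split; first exact: mulf_neq0.
  by rewrite polyCM -mulrA es -mulrA -es' mulrCA.
case/Bezout_eq1_coprimepP: cop => -[u v] /= e.
have [c [a [c0 ea]]] := fr_clear u; have [d [b [d0 eb]]] := fr_clear v.
exists (c * d), (d%:P * a), (c%:P * b); split; first exact: mulf_neq0.
apply: fr_inj; rewrite frD ![in LHS]frM polyCM frM -ea -eb -[RHS]mulr1 -e.
move: (fr g) (fr g^`()) (fr c%:P) (fr d%:P) => x1 x2 x3 x4; ring.
Qed.

(** Divide a by g with quotient q and remainder r: (u - c q) g = c r has too small a degree in x
    unless both sides vanish. *)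
Lemma const_dvd_monic (c : {poly K}) k (a u g : R) : k != 0 -> lead_coef g = k%:P ->
  c%:P * a = u * g -> exists u', u = c%:P * u'.
Proof.
move=> k0 lg; wlog gm : k k0 g a lg / g \is monic.
  move=> H e; apply: (H 1 (oner_neq0 _) (bc k^-1 * g) (bc k^-1 * a)).
  - by rewrite /Submission.bc /= lead_coefM lead_coefC lg -polyCM mulVf.
  - by apply/monicP; rewrite /Submission.bc /= lead_coefM lead_coefC lg -polyCM mulVf.
  - by rewrite mulrCA e mulrCA.
move=> e; exists (Pdiv.Ring.rdivp a g).
have e' : (u - c%:P * Pdiv.Ring.rdivp a g) * g = c%:P * Pdiv.Ring.rmodp a g.
  have := Pdiv.RingMonic.rdivp_eq gm a => /(congr1 (fun p => c%:P * p)); rewrite e => e'.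
  rewrite mulrBl e'; move: (Pdiv.Ring.rdivp a g) (Pdiv.Ring.rmodp a g) => q r; ring.
apply/eqP; rewrite -subr_eq0; apply/negPn/negP => n0.
have := congr1 (fun p : R => size p) e'; rewrite /= size_Mmonic //.
have h1 : (size (c%:P * Pdiv.Ring.rmodp a g)%R < size g)%N.
  by rewrite mul_polyC; apply: leq_ltn_trans (size_scale_leq _ _) _; rewrite Pdiv.Ring.ltn_rmodp monic_neq0.
rewrite -size_poly_gt0 in n0; move=> h; move: h1 n0; rewrite -h; case: (size _) => // m; by rewrite addSn /= ltnNge leq_addl.
Qed.

Lemma size_mul_eq1 a b : 1 = (a + b).-1 :> nat -> (0 < a)%N -> (0 < b)%N -> (b <= 1)%N.
Proof. lia. Qed.

(* [w] is proportional to the gradient [P]; the Koszul relations [d] make the factor a unit. *)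
Lemma gradient_factor (w P : 'I_3 -> R) (d : 'I_3 -> R) e (a : 'I_3 -> R) k :
  k != 0 -> lead_coef (P e1) = k%:P -> e != 0 -> \sum_b a b * P b = e%:P ->
  (forall b c, w b * P c = w c * P b) -> (forall i b, d i * w b = P i * P b) ->
  exists2 c, c != 0 & forall b, w b = bc c * P b.
Proof.
move=> k0 lP e0' bez prop kos.
have P1 : P e1 != 0 by rewrite -lead_coef_eq0 lP polyC_eq0.
pose U := \sum_b a b * w b.
have eU b : e%:P * w b = U * P b.
  rewrite -bez !mulr_suml; apply: eq_bigr => c _.
  by rewrite -!mulrA; congr (_ * _); rewrite mulrC prop.
have [u eu] := const_dvd_monic k0 lP (eU e1).
have ew b : w b = u * P b.
  have ne : e%:P != 0 :> R by rewrite polyC_eq0.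
  by apply: (mulfI ne); rewrite eU eu mulrA.
have ed i : d i * u = P i.
  by apply: (mulIf P1); rewrite -mulrA -ew kos.
have ue : e%:P = (\sum_b a b * d b) * u.
  by rewrite -bez mulr_suml; apply: eq_bigr => b _; rewrite -mulrA ed.
have u0 : u != 0 by apply: contraNneq P1 => u0; rewrite -ed u0 mulr0.
(* [u] divides [e], so it involves y only; it also divides [P e1], whose leading coefficient in x is
   a constant, so it is a constant. *)
have [q eq] : exists q, u = q%:P.
  exists u`_0; apply: size1_polyC.
  have D0 : (\sum_b a b * d b) != 0 by apply: contraNneq e0' => D0; rewrite -polyC_eq0 ue D0 mul0r.
  have := congr1 (fun p : R => size p) ue; rewrite /= size_polyC e0' size_mul // => h.
  by apply: (size_mul_eq1 h); rewrite size_poly_gt0.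
have [c ec] : exists c, q = c%:P.
  exists q`_0; apply: size1_polyC.
  have := congr1 lead_coef (ed e1); rewrite eq lP lead_coefM lead_coefC => eqk.
  have l0 : lead_coef (d e1) != 0 by apply: contraNneq k0 => l0; rewrite -polyC_eq0 -eqk l0 mul0r.
  have q0 : q != 0 by apply: contraNneq k0 => q0; rewrite -polyC_eq0 -eqk q0 mulr0.
  have := congr1 (fun p : {poly K} => size p) eqk; rewrite /= size_polyC k0 size_mul // => h.
  by apply: (size_mul_eq1 (esym h)); rewrite size_poly_gt0.
exists c; last by move=> b; rewrite ew eq ec.
by apply: contraNneq u0 => c0; rewrite eq ec c0.
Qed.
End Saito.

(** Multiplicativity of 2 by 2 determinants: a minor of two combinations is the coefficient
    determinant times a minor of [th1], [th2]. *)
Lemma cross_lincomb (A : comNzRingType) (x y x' y' a c a' c' : A) :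
  (x * y' - y * x') * (a * c' - a' * c) =
  (x * a + y * c) * (x' * a' + y' * c') - (x * a' + y * c') * (x' * a + y' * c).
Proof. ring. Qed.

Section Saito.
Variable K : closedFieldType.
Hypothesis char0 : forall n, n.+1%:R != 0 :> K.
Notation S := {mpoly K[3]}.
Notation R := {poly {poly K}}.
Notation der := ('I_3 -> S).
Variables (B D : 'I_3 -> 'I_3 -> K).
Hypothesis BD : frame B D.
Notation lam := (lam D).
Notation psi := (psi B).
Notation bc := (@bc K).
Variables (n : nat) (f : S).
Hypothesis hf : f \is n.-homog.
Hypothesis f0 : f.@[B e0] != 0.
Notation F := (f * lam e1).
Hypothesis F_red : red F.
Variables (th1 th2 : der) (d1 d2 : nat).
Hypotheses (hth1 : homd th1 d1) (hth2 : homd th2 d2).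
Hypotheses (F1 : adr th1 F = 0) (F2 : adr th2 F = 0).
Hypothesis gen12 : forall th, adr th F = 0 -> exists a1 a2, forall i, th i = a1 * th1 i + a2 * th2 i.

Notation A a := (adr th1 (lam a)).
Notation C a := (adr th2 (lam a)).
Notation P a := (dird (B a) F).

Definition wedge (a : 'I_3) : S := match val a with
  | 0 => A e1 * C e2 - A e2 * C e1
  | 1 => A e2 * C e0 - A e0 * C e2
  | _ => A e0 * C e1 - A e1 * C e0 end.

Lemma F_homog : F \is n.+1.-homog.
Proof. by have := dhomogM hf (lam_homog D e1); rewrite addn1. Qed.

Lemma P_homog a : P a \is n.-homog. Proof. exact: dird_homog F_homog. Qed.

Lemma P1_B0 : (P e1).@[B e0] = f.@[B e0].
Proof.
rewrite dirdM (dird_lam BD) mpolyC1 mulr1 mevalD mevalM (lam_eval BD).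
by rewrite mulr0 add0r.
Qed.

(** Both fields kill [F], so both are orthogonal to its gradient and their cross product is parallel
    to it. *)
Lemma wedge_grad b c : wedge b * P c = wedge c * P b.
Proof.
have E1 := adr_frame BD th1 F; rewrite F1 sum3 in E1.
have E2 := adr_frame BD th2 F; rewrite F2 sum3 in E2.
have h1 : A e0 * P e0 = - (A e1 * P e1) - A e2 * P e2 by apply/eqP; rewrite -subr_eq0 E1; apply/eqP; ring.
have h2 : C e0 * P e0 = - (C e1 * P e1) - C e2 * P e2 by apply/eqP; rewrite -subr_eq0 E2; apply/eqP; ring.
have k01 : wedge e0 * P e1 = wedge e1 * P e0.
  rewrite /wedge /=; apply/eqP; rewrite -subr_eq0; apply/eqP.
  move: h1 h2; move: (A e0) (A e1) (A e2) (C e0) (C e1) (C e2) (P e0) (P e1) (P e2).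
  move=> a0 a1 a2 c0 c1 c2 p0 p1 p2 h1 h2.
  rewrite (_ : _ - _ = c2 * (a0 * p0 + a1 * p1) - a2 * (c0 * p0 + c1 * p1)); last by ring.
  rewrite h1 h2; ring.
have k02 : wedge e0 * P e2 = wedge e2 * P e0.
  rewrite /wedge /=; apply/eqP; rewrite -subr_eq0; apply/eqP.
  move: h1 h2; move: (A e0) (A e1) (A e2) (C e0) (C e1) (C e2) (P e0) (P e1) (P e2).
  move=> a0 a1 a2 c0 c1 c2 p0 p1 p2 h1 h2.
  rewrite (_ : _ - _ = a1 * (c0 * p0 + c2 * p2) - c1 * (a0 * p0 + a2 * p2)); last by ring.
  rewrite h1 h2; ring.
have k12 : wedge e1 * P e2 = wedge e2 * P e1.
  rewrite /wedge /=; apply/eqP; rewrite -subr_eq0; apply/eqP.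
  move: h1 h2; move: (A e0) (A e1) (A e2) (C e0) (C e1) (C e2) (P e0) (P e1) (P e2).
  move=> a0 a1 a2 c0 c1 c2 p0 p1 p2 h1 h2.
  rewrite (_ : _ - _ = c0 * (a1 * p1 + a2 * p2 + a0 * p0) - a0 * (c1 * p1 + c2 * p2 + c0 * p0)); last by ring.
  rewrite h1 h2; ring.
by move: b c; apply: ord3P; apply: ord3P.
Qed.

Lemma adr_comb2 (th : der) a1 a2 G : (forall i, th i = a1 * th1 i + a2 * th2 i) ->
  adr th G = a1 * adr th1 G + a2 * adr th2 G.
Proof.
move=> e; rewrite /adr !mulr_sumr -big_split; apply: eq_bigr => i _ /=.
by rewrite e mulrDl !mulrA.
Qed.

(* The Koszul derivations of [F] lie in the span of [th1] and [th2]. *)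
Lemma koszul a b : exists x y, forall c,
  P b * (c == a)%:R - P a * (c == b)%:R = x * A c + y * C c.
Proof.
pose th : der := fun i => B a i *: P b - B b i *: P a.
have eth G : adr th G = P b * dird (B a) G - P a * dird (B b) G.
  rewrite /adr /th; move: (P a) (P b) => u v; rewrite [dird (B a) G]/dird [dird (B b) G]/dird !mulr_sumr -sumrB; apply: eq_bigr => i _.
  by rewrite mulrBl -!scalerAl !scalerAr.
have [|x [y e]] := gen12 (th := th); first by rewrite eth mulrC subrr.
exists x, y => c; rewrite -(adr_comb2 _ e) eth !(dird_lam BD).
by congr (_ * _ - _ * _); case: (_ == _); rewrite ?mpolyC1 ?mpolyC0.
Qed.

(** The cross product of two Koszul derivations is [P i] times the gradient; [d] is the determinant
    of their coefficients over [th1], [th2]. *)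
Lemma wedge_koszul i : exists d, forall b, d * wedge b = P i * P b.
Proof.
have [x0 [y0 h0]] := koszul e1 e2.
have [x1 [y1 h1]] := koszul e2 e0.
have [x2 [y2 h2]] := koszul e0 e1.
have [tE fE] : true%:R = 1 :> S /\ false%:R = 0 :> S by [].
have key u (v : bool) : P u * v%:R = if v then P u else 0 by case: v; rewrite ?tE ?fE ?mulr1 ?mulr0.
move: i; apply: ord3P;
  [exists (x1 * y2 - y1 * x2)|exists (x2 * y0 - y2 * x0)|exists (x0 * y1 - y0 * x1)];
  apply: ord3P; rewrite /wedge /= cross_lincomb -4?(h0, h1, h2) !key /=.
all: move: (P e0) (P e1) (P e2) => p0 p1 p2; ring.
Qed.

(** [gradient_factor] works in the chart, where powers of [lam e2] are invisible. Degrees leave the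
    factor [lam e2 ^+ (d1 + d2 - n)], whose exponent is then shown to be 0. *)
Theorem saito : d1 + d2 = n /\ exists2 c, c != 0 & forall b, wedge b = c *: P b.
Proof.
have psM (G H : S) : psi (G * H) = psi G * psi H by exact: rmorphM.
have psD (G H : S) : psi (G + H) = psi G + psi H by exact: raddfD.
have wh b : wedge b \is (d1 + d2).-homog.
  have hA a : A a \is d1.-homog by have := adr_homog hth1 (lam_homog D a); rewrite addn0.
  have hC a : C a \is d2.-homog by have := adr_homog hth2 (lam_homog D a); rewrite addn0.
  by move: b; apply: ord3P; apply: rpredB; apply: dhomogM.
have [sP tP] := psi_top B (P_homog e1).
have sP' : size (psi (P e1)) = n.+1.
  apply/eqP; rewrite eqn_leq sP ltnNge; apply: contraNN f0 => h.
  by rewrite -P1_B0 -polyC_eq0 -tP nth_default.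
have lP : lead_coef (psi (P e1)) = (f.@[B e0])%:P by rewrite lead_coefE sP' tP P1_B0.
have F0 : F != 0 by case: F_red.
have g0 : psi F != 0 by apply: contraNneq F0 => /(psi_homog_inj BD F_homog) ->.
have [e [a [b [e0' bez]]]] := sqfree_bezout char0 g0 (red_sqfree BD F_homog F_red).
rewrite deriv_psi in bez.
(* Euler's formula turns the multiple of [F] in the Bezout relation into a combination of the three
   partial derivatives. *)
have bez' : \sum_c (a * bc (n.+1%:R)^-1 * psi (lam c) + (c == e0)%:R * b) * psi (P c) = e%:P.
  have E := congr1 psi (euler_frame BD F_homog); rewrite sum3 !psD !psM rmorph_nat -[psi f * _]psM in E.
  have nV : bc (n.+1%:R)^-1 * n.+1%:R = 1 :> R.
    by rewrite -(rmorph_nat bc) -(rmorphM bc) mulVf // rmorph1.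
  have -> : e%:P = a * (bc (n.+1%:R)^-1 * (n.+1%:R * psi F)) + b * psi (P e0) by rewrite (mulrA (bc _)) nV mul1r bez.
  rewrite -E sum3 /=.
  move: (psi _) (psi _) (psi _) (psi (P e0)) (psi (P e1)) (psi (P e2)) (bc _) => l0 l1 l2 p0 p1 p2 v.
  have [tE fE] : true%:R = 1 :> R /\ false%:R = 0 :> R by [].
  rewrite tE !fE; ring.
have [i3 hd] := fun_choice wedge_koszul.
have [c c0 hc] := gradient_factor f0 lP e0' bez'
  (w := fun b => psi (wedge b)) (d := fun i => psi (i3 i))
  (fun b c => etrans (esym (psM _ _)) (etrans (congr1 psi (wedge_grad b c)) (psM _ _)))
  (fun i b => etrans (esym (psM _ _)) (etrans (congr1 psi (hd i b)) (psM _ _))).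
have dn : (n <= d1 + d2)%N.
  have [sw _] := psi_top B (wh e1); move: sw; rewrite hc /Submission.bc /= mul_polyC size_scale ?polyC_eq0 //.
  by rewrite sP'.
have hl k : lam e2 ^+ k \is k.-homog by have := dhomogMn k (lam_homog D e2); rewrite mul1n.
have ew b' : wedge b' = c *: (P b' * lam e2 ^+ (d1 + d2 - n)).
  apply: (psi_homog_eq BD (wh b')).
    by apply: dhomogZ; have := dhomogM (P_homog b') (hl (d1 + d2 - n)%N); rewrite subnKC.
  have psX (G : S) k : psi (G ^+ k) = psi G ^+ k by exact: rmorphXn.
  by rewrite -mul_mpolyC psM psM psX (psi_lam2 BD) expr1n mulr1 psiC; exact: hc.
have [/eqP dn'|dn'] := boolP (d1 + d2 - n == 0)%N; last first.
  (* A positive power of [lam e2] would vanish at [B e0], where the Koszul relation equates it with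
     the square of the nonzero value of [P e1]. *)
  have := congr1 (meval (B e0)) (hd e1 e1).
  rewrite ew !mevalM mevalZ mevalM (rmorphXn (meval _)) /= (lam_eval BD) /= expr0n (negPf dn') !mulr0.
  by rewrite P1_B0 => /eqP; rewrite eq_sym mulf_eq0 orbb (negPf f0).
split; first by apply/eqP; rewrite eqn_leq dn -subn_eq0 dn'.
by exists c => // b'; rewrite ew dn' expr0 mulr1.
Qed.
End Saito.

Lemma coprime_syzygy (F : fieldType) (s1 s2 b1 b2 : {poly F}) : coprimep s1 s2 ->
  b1 * s1 + b2 * s2 = 0 -> exists t, b1 = t * s2 /\ b2 = - (t * s1).
Proof.
move=> /Bezout_eq1_coprimepP [[u1 u2] /= bez] e; exists (u2 * b1 - u1 * b2).
have e' : b2 * s2 = - (b1 * s1) by apply/eqP; rewrite -addr_eq0 addrC e.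
split.
  have -> : (u2 * b1 - u1 * b2) * s2 = u2 * s2 * b1 - u1 * (b2 * s2) by ring.
  rewrite e' -[LHS]mul1r -bez; ring.
have -> : (u2 * b1 - u1 * b2) * s1 = - (u1 * s1 * b2) + u2 * (b1 * s1) by ring.
have -> : b1 * s1 = - (b2 * s2) by rewrite e' opprK.
rewrite -[LHS]mul1r -bez; ring.
Qed.

(** * Generators and relations of the derivations of the deleted curve *)

Section Structure.
Variable K : closedFieldType.
Hypothesis char0 : forall n, n.+1%:R != 0 :> K.
Notation S := {mpoly K[3]}.
Notation R := {poly {poly K}}.
Notation der := ('I_3 -> S).
Variables (B D : 'I_3 -> 'I_3 -> K).
Hypothesis BD : frame B D.
Notation lam := (lam D).
Notation psi := (psi B).
Notation al := (lam e1).
Definition rho (F : S) : {poly K} := ry (psi F).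

Lemma rhoM F G : rho (F * G) = rho F * rho G.
Proof. by rewrite -[RHS](rmorphM (@ry K)) -(rmorphM psi). Qed.
Lemma rhoD F G : rho (F + G) = rho F + rho G.
Proof. by rewrite -[RHS](rmorphD (@ry K)) -(rmorphD psi). Qed.
Lemma rhoC c : rho c%:MP = c%:P.
Proof. by rewrite /rho psiC /bc /= ryC hornerC. Qed.
Lemma rhoZ c F : rho (c *: F) = c *: rho F.
Proof. by rewrite -mul_mpolyC rhoM rhoC mul_polyC. Qed.
Lemma rho0 : rho 0 = 0.
Proof. by rewrite -(mpolyC0 3 K) rhoC. Qed.
Lemma rhoN F : rho (- F) = - rho F.
Proof. by apply/eqP; rewrite -addr_eq0 -rhoD addNr rho0. Qed.
Lemma rhoB F G : rho (F - G) = rho F - rho G.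
Proof. by rewrite rhoD rhoN. Qed.
Lemma rho_lam0 : rho (lam e0) = 'X. Proof. by rewrite /rho psi_lam0 // ryX. Qed.
Lemma rho_al : rho al = 0. Proof. by rewrite /rho psi_lam1 // ryyy. Qed.
Lemma rho_lam2 : rho (lam e2) = 1. Proof. by rewrite /rho psi_lam2 // (rmorph1 (@ry K)). Qed.

Lemma al_neq0 : al != 0. Proof. exact: lam_neq0 BD e1. Qed.
Lemma al_lam2 : ~ exists G, lam e2 = al * G.
Proof. by case=> G /(congr1 rho); rewrite rho_lam2 rhoM rho_al mul0r => /eqP; rewrite oner_eq0. Qed.

Lemma gh_lift M d (p : {poly K}) : p = 0 \/ (exists2 k, (d + k)%N = M & (size p <= k.+1)%N) ->
  exists2 F, gh M d F & rho F = p.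
Proof.
case=> [->|[k e sp]]; first by exists 0; [left|exact: rho0].
by have [F hF eF] := uni_lift BD sp; exists F => //; right; exists k.
Qed.

Lemma gh_sub M d (F G : S) : gh M d F -> gh M d G -> gh M d (F - G).
Proof.
case=> [->|[k e hF]]; case=> [->|[l e' hG]].
- by left; rewrite subrr.
- by right; exists l => //; rewrite sub0r rpredN.
- by right; exists k => //; rewrite subr0.
have kl : k = l by apply/eqP; rewrite -(eqn_add2l d) e e' eqxx.
by right; exists k => //; apply: rpredB; rewrite // kl.
Qed.

Lemma gh_al M d F : gh M d F -> rho F = 0 -> exists G, F = al * G.
Proof.
case=> [->|[k _ hF] e]; first by exists 0; rewrite mulr0.
by have [G eG] := psi_restrict BD hF e; exists G.
Qed.

Lemma adr_lin3 (th u v w : der) (a b c : S) G :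
  (forall i, th i = a * u i + b * v i + c * w i) ->
  adr th G = a * adr u G + b * adr v G + c * adr w G.
Proof.
move=> e; rewrite /adr !mulr_sumr -!big_split; apply: eq_bigr => i _ /=.
by rewrite e !mulrDl !mulrA.
Qed.

Lemma adr_eul_lam a : adr (@eul K) (lam a) = lam a.
Proof. by have := euler (lam_homog D a); rewrite mul1r. Qed.

Lemma der_coord (th : der) i : th i = \sum_a B a i *: adr th (lam a).
Proof.
rewrite -[LHS](adrX th i) (X_lam BD) sum3 [RHS]sum3 !adrD !adrZ //.
Qed.

Variables (n : nat) (f : S).
Hypothesis hf : f \is n.-homog.
Hypothesis f0 : f.@[B e0] != 0.
Notation F := (f * al).
Hypothesis F_red : red F.
Variables (th1 th2 : der) (d1 d2 : nat).
Hypotheses (hth1 : homd th1 d1) (hth2 : homd th2 d2).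
Hypotheses (F1 : adr th1 F = 0) (F2 : adr th2 F = 0).
Hypothesis gen12 : forall th, adr th F = 0 -> exists a1 a2, forall i, th i = a1 * th1 i + a2 * th2 i.
Hypothesis ind12 : forall a1 a2, (forall i, a1 * th1 i + a2 * th2 i = 0) -> a1 = 0 /\ a2 = 0.
Hypotheses
  (lw1 : (line_wedge D th1).@[B e0] = 0 -> exists G, line_wedge D th1 = al * G)
  (lw2 : (line_wedge D th2).@[B e0] = 0 -> exists G, line_wedge D th2 = al * G).

Lemma al_f G : (exists H, G * f = al * H) -> exists H, G = al * H.
Proof.
case/(lam_prime BD) => // -[H e]; case/eqP: f0.
by rewrite e mevalM (lam_eval BD) mul0r.
Qed.

Lemma adr_al th : adr th F = 0 -> exists2 g, adr th al = al * g & adr th f = - (g * f).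
Proof.
rewrite adrM => /eqP; rewrite addrC addr_eq0 => /eqP e.
have [g eg] : exists g, adr th al = al * g.
  by apply: al_f; exists (- adr th f); rewrite mulrC e mulrN mulrC.
exists g => //; apply: (mulIf al_neq0); rewrite -[LHS]opprK -{}e eg; ring.
Qed.

(** By the choice of frame the wedge keeps its full degree d + 1 on the line unless it vanishes
    there. *)
Lemma size_line_wedge th d : homd th d ->
  ((line_wedge D th).@[B e0] = 0 -> exists G, line_wedge D th = al * G) ->
  rho (line_wedge D th) = 0 \/ size (rho (line_wedge D th)) = d.+2.
Proof.
move=> hth h; have [s1 s2] := ry_psi_top B (line_wedge_homog D hth).
have [e|ne] := eqVneq (line_wedge D th).@[B e0] 0.
  by left; have [G ->] := h e; rewrite rhoM rho_al mul0r.
right; apply/eqP; rewrite eqn_leq s1 ltnNge; apply: contraNN ne => sz.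
by rewrite -s2 nth_default.
Qed.

Lemma rho_line_wedge th : rho (line_wedge D th) = rho (adr th (lam e0)) - 'X * rho (adr th (lam e2)).
Proof. by rewrite /line_wedge rhoB !rhoM rho_lam0 rho_lam2 mul1r. Qed.

Notation p1 := (rho (line_wedge D th1)).
Notation p2 := (rho (line_wedge D th2)).
Notation b1 := (rho (adr th1 (lam e2))).
Notation b2 := (rho (adr th2 (lam e2))).

(* Restrictions to the line of the components of [saito]. *)
Lemma saito_line : d1 + d2 = n /\ exists c g1 g2,
  [/\ c != 0, adr th1 al = al * g1 /\ adr th1 f = - (g1 * f),
    adr th2 al = al * g2 /\ adr th2 f = - (g2 * f),
    p2 * b1 - p1 * b2 = c *: rho f &
    rho g1 * p2 - rho g2 * p1 = - (n%:R * c) *: rho f].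
Proof.
have [dn [c c0 hw]] := saito char0 BD hf f0 F_red hth1 hth2 F1 F2 gen12.
split=> //; have [g1 eg1 ef1] := adr_al F1; have [g2 eg2 ef2] := adr_al F2.
exists c, g1, g2; split=> //.
  have := congr1 rho (hw e1); rewrite rhoB !rhoM rhoZ dirdM rhoD !rhoM rho_al mulr0 add0r.
  rewrite (dird_lam BD) rhoC mulr1 !rho_line_wedge => <-.
  move: (rho (adr th1 (lam e0))) (rho (adr th1 (lam e2))) (rho (adr th2 (lam e0))) (rho (adr th2 (lam e2))) => x y z t; ring.
have P02 a : a != e1 -> dird (B a) F = al * dird (B a) f.
  move=> ne; rewrite dirdM (dird_lam BD) eq_sym (negPf ne) mpolyC0 mulr0 addr0 mulrC //.
have q0 : rho g1 * b2 - rho g2 * b1 = c *: rho (dird (B e0) f).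
  rewrite -rhoZ -!rhoM -rhoB; congr rho; apply: (mulfI al_neq0).
  rewrite -scalerAr -P02 // -hw /wedge /= eg1 eg2; ring.
have q2 : rho g2 * rho (adr th1 (lam e0)) - rho g1 * rho (adr th2 (lam e0)) = c *: rho (dird (B e2) f).
  rewrite -rhoZ -!rhoM -rhoB; congr rho; apply: (mulfI al_neq0).
  rewrite -scalerAr -P02 // -hw /wedge /= eg1 eg2; ring.
have E := congr1 rho (euler_frame BD hf).
rewrite sum3 !rhoD !rhoM rho_lam0 rho_al rho_lam2 mul0r addr0 mul1r in E.
have -> : rho g1 * p2 - rho g2 * p1 = - ('X * (rho g1 * b2 - rho g2 * b1)
   + (rho g2 * rho (adr th1 (lam e0)) - rho g1 * rho (adr th2 (lam e0)))).
  rewrite !rho_line_wedge.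
  move: (rho (adr th1 (lam e0))) (rho (adr th1 (lam e2))) (rho (adr th2 (lam e0))) (rho (adr th2 (lam e2))) (rho g1) (rho g2) => x y z t u v; ring.
have rn : rho n%:R = n%:R%:P by rewrite -(rmorph_nat (@mpolyC 3 K)) rhoC.
rewrite q0 q2; move: (rho (dird (B e0) f)) (rho (dird (B e2) f)) E => x y E.
by rewrite -scalerAr -scalerDr E rn mul_polyC scaleNr scalerA mulrC.
Qed.

(** [m] = n - deg H will be the degree of [eta]. The degree of s_1 is d1 + 1 - deg H, which equals m
    + 1 - d2 because d1 + d2 = n; symmetrically for s_2. *)
Lemma line_gcd : d1 + d2 = n /\ exists m (H s1 s2 : {poly K}) c g1 g2,
  [/\ [/\ c != 0, adr th1 al = al * g1 /\ adr th1 f = - (g1 * f) &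
       adr th2 al = al * g2 /\ adr th2 f = - (g2 * f)],
     [/\ p1 = s1 * H, p2 = s2 * H, coprimep s1 s2, H != 0 & ((size H).-1 + m)%N = n],
     s1 = 0 \/ (exists2 k, (d2 + k)%N = m.+1 & size s1 = k.+1),
     s2 = 0 \/ (exists2 k, (d1 + k)%N = m.+1 & size s2 = k.+1) &
     [/\ H * (s2 * b1 - s1 * b2) = c *: rho f, size (s2 * b1 - s1 * b2) = m.+1 &
      H * (rho g1 * s2 - rho g2 * s1) = - (n%:R * c) *: rho f]].
Proof.
have [dn [c [g1 [g2 [c0 t1 t2 e e']]]]] := saito_line; split=> //.
have hs1 := size_line_wedge hth1 lw1; have hs2 := size_line_wedge hth2 lw2.
move: p1 p2 b1 b2 hs1 hs2 e e' => q1 q2 r1 r2 hs1 hs2 e e'.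
have rf : size (rho f) = n.+1 := size_rho hf f0.
have rf0 : rho f != 0 by rewrite -size_poly_gt0 rf.
pose H := gcdp q1 q2; pose s1 := q1 %/ H; pose s2 := q2 %/ H.
have eq1 : q1 = s1 * H by rewrite divpK // dvdp_gcdl.
have eq2 : q2 = s2 * H by rewrite divpK // dvdp_gcdr.
have H0 : H != 0.
  apply: contraNneq rf0 => H0; rewrite -(scale1r (rho f)) -(mulVf c0) -scalerA -e.
  by rewrite eq1 eq2 H0 !mulr0 !mul0r subrr scaler0.
have cop : coprimep s1 s2.
  by rewrite coprimep_div_gcd // -negb_and -gcdp_eq0.
have eu : H * (s2 * r1 - s1 * r2) = c *: rho f by rewrite -e eq1 eq2; ring.
have u0 : s2 * r1 - s1 * r2 != 0.
  by apply: contraNneq rf0 => u0; rewrite -(scale1r (rho f)) -(mulVf c0) -scalerA -eu u0 mulr0 scaler0.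
have su : ((size H).-1 + size (s2 * r1 - s1 * r2)%R)%N = n.+1.
  rewrite -rf -(size_scale (rho f) c0) -eu size_mul //; move: H0; rewrite -size_poly_gt0.
  by case: (size H) => // k _.
move: u0; rewrite -size_poly_gt0; case em : (size _) => [//|m] _.
exists m, H, s1, s2, c, g1, g2.
have dm : ((size H).-1 + m)%N = n by move: su; rewrite em addnS => -[].
have sz (q s : {poly K}) d d' : q = s * H -> q = 0 \/ size q = d.+2 -> d + d' = n ->
    s = 0 \/ (exists2 k, (d' + k)%N = m.+1 & size s = k.+1).
  move=> eq [q0|sq] edd.
    by left; move: eq; rewrite q0 => /esym/eqP; rewrite mulf_eq0 (negPf H0) orbF => /eqP.
  have s0 : s != 0 by apply/eqP => s0; move: sq; rewrite eq s0 mul0r size_poly0.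
  right; move: sq; rewrite eq size_mul //; move: s0 H0; rewrite -!size_poly_gt0.
  case ek: (size s) => [//|k] _; case eH: (size H) dm => [//|h] /= dm _ e3.
  exists k => //; move: e3; rewrite addnS /= => -[e3]; lia.
split=> //.
- exact: sz eq1 hs1 dn.
- by have dn2 : (d2 + d1)%N = n; [rewrite addnC|exact: sz eq2 hs2 dn2].
- by split=> //; rewrite -e' eq1 eq2; move: (rho g1) (rho g2) => x1 x2; ring.
Qed.

Lemma adr_eul_f : adr (@eul K) f = n%:R * f. Proof. exact: euler hf. Qed.
Lemma adr_eul_F : adr (@eul K) F = n.+1%:R * F.
Proof. exact: euler (F_homog D hf). Qed.

Lemma rho_coord (th : der) i : rho (adr th al) = 0 ->
  rho (th i) = (B e0 i)%:P * rho (adr th (lam e0)) + (B e2 i)%:P * rho (adr th (lam e2)).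
Proof.
move=> h; rewrite [in LHS]der_coord sum3 !rhoD !rhoZ h scaler0 addr0 -!mul_polyC //.
Qed.

(* On the line, [s2 th1 - s1 th2] is proportional to the Euler field. *)
Lemma eta_coord m (S1 S2 gg : S) (s1 s2 H : {poly K}) :
  gh m.+1 d2 S1 -> gh m.+1 d1 S2 -> gg \is m.-homog ->
  rho S1 = s1 -> rho S2 = s2 -> rho gg = s2 * b1 - s1 * b2 ->
  p1 = s1 * H -> p2 = s2 * H ->
  exists2 eta, homd eta m & forall i, S2 * th1 i - S1 * th2 i = gg * 'X_i + al * eta i.
Proof.
move=> g1 g2 hg r1 r2 rg e1' e2'.
have h i : exists eta, eta \is m.-homog /\ S2 * th1 i - S1 * th2 i = gg * 'X_i + al * eta.
  have hom : S2 * th1 i - S1 * th2 i - gg * 'X_i \is m.+1.-homog.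
    apply: rpredB; first by apply: rpredB; [exact: gh_homog g2 (hth1 i)|exact: gh_homog g1 (hth2 i)].
    by have hX : ('X_i : S) \is 1.-homog; [rewrite dhomogX /= mdeg1|have := dhomogM hg hX; rewrite addn1].
  have z : rho (S2 * th1 i - S1 * th2 i - gg * 'X_i) = 0.
    have [x1 ex1 _] := adr_al F1; have [x2 ex2 _] := adr_al F2.
    have q1 : rho (adr th1 al) = 0 by rewrite ex1 rhoM rho_al mul0r.
    have q2 : rho (adr th2 al) = 0 by rewrite ex2 rhoM rho_al mul0r.
    have qE : rho (adr (@eul K) al) = 0 by rewrite adr_eul_lam rho_al.
    rewrite !rhoB !rhoM r1 r2 rg (rho_coord i q1) (rho_coord i q2) -['X_i]/(@eul K i) (rho_coord i qE).
    rewrite !adr_eul_lam rho_lam0 rho_lam2.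
    move: e1' e2'; rewrite !rho_line_wedge => e1' e2'.
    have e1'' : rho (adr th1 (lam e0)) = s1 * H + 'X * b1 by apply/eqP; rewrite -subr_eq; apply/eqP.
    have e2'' : rho (adr th2 (lam e0)) = s2 * H + 'X * b2 by apply/eqP; rewrite -subr_eq; apply/eqP.
    rewrite e1'' e2''; move: b1 b2 (B e0 i)%:P (B e2 i)%:P => x y u v; ring.
  have [/eqP|[G eG [_ hG]]] := psi_restrict_homog BD hom z.
    rewrite subr_eq0 => /eqP ->; exists 0; split; [exact: dhomog0|by rewrite mulr0 addr0].
  by exists G; split=> //; rewrite -eG [RHS]addrC subrK.
by have [eta he] := fun_choice h; exists eta => i; case: (he i).
Qed.

Lemma al_scale_eul (e : S) (z : der) : (forall i, e * 'X_i = al * z i) -> exists e', e = al * e'.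
Proof.
move=> h; have P : exists G, e * lam e2 = al * G.
  exists (\sum_i D e2 i *: z i); rewrite mulr_sumr {1}/lam /Submission.lam mulr_sumr.
  by apply: eq_bigr => i _; rewrite -scalerAr h scalerAr.
by case: (lam_prime BD P) => [[G ->]|/al_lam2 //]; exists G.
Qed.

(** Write [al th] as a E + x1 th1 + x2 th2. On the line x1 p_1 + x2 p_2 = 0, so (x1, x2) is there a
    multiple t of (s_2, - s_1). Subtracting a lift of t times the relation defining [eta] leaves
    coefficients divisible by [al], which cancels. *)
Lemma generation m (eta : der) (S1 S2 gg : S) (s1 s2 H : {poly K}) th M :
  gh m.+1 d2 S1 -> gh m.+1 d1 S2 -> rho S1 = s1 -> rho S2 = s2 ->
  s1 = 0 \/ (exists2 k, (d2 + k)%N = m.+1 & size s1 = k.+1) ->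
  s2 = 0 \/ (exists2 k, (d1 + k)%N = m.+1 & size s2 = k.+1) ->
  p1 = s1 * H -> p2 = s2 * H -> coprimep s1 s2 -> H != 0 ->
  (forall i, S2 * th1 i - S1 * th2 i = gg * 'X_i + al * eta i) ->
  homd th M -> inD f th -> exists e c1 c2 c3, forall i,
         th i = e * 'X_i + c1 * th1 i + c2 * th2 i + c3 * eta i.
Proof.
move=> gS1 gS2 rS1 rS2 k1 k2 ep1 ep2 cop H0 eeta hth [k ek].
(* al th, corrected by a multiple of the Euler field, kills F. *)
pose nV : S := ((n.+1%:R)^-1)%:MP.
have nVE : nV * n.+1%:R = 1.
  by rewrite /nV -(rmorph_nat (@mpolyC 3 K)) -mpolyCM mulVf // mpolyC1.
pose th' : der := fun i => al * th i - nV * (al * k + adr th al) * 'X_i.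
have th'F : adr th' F = 0.
  rewrite (@adr_lin3 th' th (@eul K) th al (- (nV * (al * k + adr th al))) 0); last first.
    by move=> i; rewrite mul0r addr0 mulNr.
  rewrite adr_eul_F adrM ek mul0r addr0.
  have -> : al * (k * f * al + f * adr th al) = 1 * (al * k + adr th al) * F by ring.
  move: (n.+1%:R : S) nVE => nn <-; ring.
have [y1 [y2 ey]] := gen12 th'F.
pose v : 'I_2 -> der := fun j => if j == ord0 then th1 else th2.
pose dv (j : 'I_2) := if j == ord0 then d1 else d2.
pose cv (j : 'I_2) := if j == ord0 then y1 else y2.
pose ath : der := fun i => al * th i.
have hath : homd ath M.+1 by move=> i; exact: (dhomogM (lam_homog D e1) (hth i)).
have hv j : homd (v j) (dv j) by rewrite /v /dv; case: (j == ord0).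
have lc2 (c : 'I_2 -> S) i : lcomb c v i = c ord0 * th1 i + c ord_max * th2 i.
  rewrite /lcomb big_ord_recl big_ord1 /v /=; congr (_ + _ * _); congr (c _); exact: val_inj.
have /(graded_lcomb hv hath) G i : ath i = nV * (al * k + adr th al) * 'X_i + lcomb cv v i.
  by rewrite lc2 /cv /= -ey /th' /ath addrC subrK.
move: (gpart_gh M.+1 d1 y1) (gpart_gh M.+1 d2 y2).
have {G} : forall i, al * th i = gpart M.+1 1 (nV * (al * k + adr th al)) * 'X_i
   + gpart M.+1 d1 y1 * th1 i + gpart M.+1 d2 y2 * th2 i.
  by move=> i; have := G i; rewrite lc2 addrA.
move: (gpart M.+1 1 _) (gpart M.+1 d1 y1) (gpart M.+1 d2 y2) => a x1 x2 E gx1 gx2.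
have Ea G : al * adr th G = a * adr (@eul K) G + x1 * adr th1 G + x2 * adr th2 G.
  rewrite -(@adr_lin3 ath (@eul K) th1 th2 a x1 x2) //.
  by rewrite /adr mulr_sumr; apply: eq_bigr => i _; rewrite mulrA.
have syz : rho x1 * s1 + rho x2 * s2 = 0.
  apply: (mulIf H0); rewrite mul0r mulrDl -!mulrA -ep1 -ep2.
  rewrite -!rhoM -rhoD.
  have -> : x1 * line_wedge D th1 + x2 * line_wedge D th2 =
      al * (lam e2 * adr th (lam e0) - lam e0 * adr th (lam e2)).
    rewrite [RHS]mulrBr !(mulrCA al) !Ea !adr_eul_lam /line_wedge.
    move: (adr th1 (lam e0)) (adr th1 (lam e2)) (adr th2 (lam e0)) (adr th2 (lam e2)) => u0 u2 v0 v2; ring.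
  by rewrite rhoM rho_al mul0r.
have [t [et1 et2]] := coprime_syzygy cop syz.
(* The degree of [t] is at most M - m, so that it lifts to a form of degree M - m, the degree needed
   next to [eta]. *)
have sizet d x s (q : {poly K}) : gh M.+1 d x -> rho x = q -> size q = size (t * s) ->
    s != 0 -> s = 0 \/ (exists2 k, (d + k)%N = m.+1 & size s = k.+1) -> t != 0 ->
    exists2 k, (m.+1 + k)%N = M.+1 & (size t <= k.+1)%N.
  move=> gx rx sq s0 [/eqP|[j ej sj] t0]; first by rewrite (negPf s0).
  move: sq; rewrite size_mul // sj addnS /=; move: t0; rewrite -size_poly_gt0.
  case et: (size t) => [//|u] _ /= sq.
  case: gx => [x0|[l el hx]]; first by move: sq; rewrite -rx x0 rho0 size_poly0.
  have [sx _] := ry_psi_top B hx; rewrite -/(rho x) rx sq in sx.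
  by exists (l - j)%N; lia.
have [t' gt rt] : exists2 t', gh M.+1 m.+1 t' & rho t' = t.
  apply: gh_lift; have [t0|t0] := eqVneq t 0; [by left|right].
  have [s0|s0] := eqVneq s1 0.
    have s20 : s2 != 0 by apply: contraTneq cop => s20; rewrite s0 s20 coprime0p -size_poly_eq1 size_poly0.
    exact: (sizet d1 x1 s2 _ gx1 et1 erefl s20 k2 t0).
  apply: (sizet d2 x2 s1 _ gx2 et2 _ s0 k1 t0); by rewrite size_polyN.
have [z1 ez1] : exists z, x1 - t' * S2 = al * z.
  apply: (gh_al (gh_sub gx1 (gh_mul gt gS2))); by rewrite rhoB rhoM rt rS2 et1 subrr.
have [z2 ez2] : exists z, x2 - t' * - S1 = al * z.
  rewrite mulrN -mulNr; apply: (gh_al (gh_sub gx2 _)).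
    apply: gh_mul gS1; case: gt => [->|[j ej hj]]; first by left; rewrite oppr0.
    by right; exists j => //; rewrite rpredN.
  by rewrite rhoB rhoM rhoN rt rS1 et2 mulNr subrr.
have ex1 : x1 = t' * S2 + al * z1 by rewrite -ez1 addrC subrK.
have ex2 : x2 = - (t' * S1) + al * z2 by rewrite -ez2 mulrN addrC subrK.
have [a' ea'] : exists e, a + t' * gg = al * e.
  apply: (@al_scale_eul _ (fun i => th i - t' * eta i - z1 * th1 i - z2 * th2 i)) => i.
  rewrite !mulrBr E ex1 ex2.
  have := eeta i; move: ('X_i : S) (th1 i) (th2 i) (eta i) => x y z w Ew.
  have -> : al * (t' * w) = t' * (S2 * y - S1 * z - gg * x).
    by rewrite Ew mulrCA; congr (_ * _); rewrite addrC addKr.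
  ring.
exists a', z1, z2, t' => i; apply: (mulfI al_neq0); rewrite E ex1 ex2.
have := eeta i; move: ('X_i : S) (th1 i) (th2 i) (eta i) => x y z w Ew.
have ea : a = al * a' - t' * gg by rewrite -ea' addrK.
have -> : al * (a' * x + z1 * y + z2 * z + t' * w) = al * a' * x + al * z1 * y + al * z2 * z + t' * (al * w) by ring.
have -> : al * w = S2 * y - S1 * z - gg * x by rewrite Ew addrC addKr.
rewrite ea; ring.
Qed.

Theorem structure : d1 + d2 = n /\ exists m eta S1 S2 gg,
  [/\ [/\ (m <= n)%N, gh m.+1 d2 S1, gh m.+1 d1 S2 & forall i, S2 * th1 i - S1 * th2 i = gg * 'X_i + al * eta i],
      [/\ homd eta m, inD f th1, inD f th2 & inD f eta],
      size (rho (adr eta al)) = m.+1 /\ (forall T, root (rho (adr eta al)) T -> root (rho f) T),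
      forall th M, homd th M -> inD f th -> exists e c1 c2 c3, forall i,
         th i = e * 'X_i + c1 * th1 i + c2 * th2 i + c3 * eta i &
      forall e c1 c2 c3, (forall i, e * 'X_i + c1 * th1 i + c2 * th2 i + c3 * eta i = 0) ->
         exists t, [/\ c1 = - (t * S2), c2 = t * S1 & c3 = t * al] ].
Proof.
have [dn [m [H [s1 [s2 [c [g1 [g2 [[c0 [a1 ff1] [a2 ff2]] [ep1 ep2 cop H0 dm] k1 k2 [eu su eQ]]]]]]]]]] := line_gcd.
split=> //.
have lift M d (s : {poly K}) : s = 0 \/ (exists2 k, (d + k)%N = M & size s = k.+1) ->
    s = 0 \/ (exists2 k, (d + k)%N = M & (size s <= k.+1)%N).
  by case=> [|[k ek ->]]; [left|right; exists k].
have [S1 gS1 rS1] := gh_lift (lift _ _ _ k1); have [S2 gS2 rS2] := gh_lift (lift _ _ _ k2).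
have [gg hgg rgg] := uni_lift BD (eq_leq su).
have [eta heta eeta] := eta_coord gS1 gS2 hgg rS1 rS2 rgg ep1 ep2.
exists m, eta, S1, S2, gg.
have aeta G : al * adr eta G = S2 * adr th1 G - S1 * adr th2 G - gg * adr (@eul K) G.
  pose th : der := fun i => al * eta i.
  have <- : adr th G = al * adr eta G.
    by rewrite /adr mulr_sumr; apply: eq_bigr => i _; rewrite mulrA.
  rewrite (@adr_lin3 th th1 th2 (@eul K) S2 (- S1) (- gg)); first by rewrite !mulNr.
  move=> i; rewrite /th !mulNr -[eul K i]/('X_i : S) eeta.
  by rewrite [RHS]addrC addKr.
have [ke eke] : inD f eta.
  have [k ek] : exists k, (- S2 * g1 + S1 * g2 - gg * n%:R) = al * k.
    apply: al_f; exists (adr eta f); rewrite aeta ff1 ff2 adr_eul_f.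
    move: (n%:R : S) => nn; ring.
  exists k; apply: (mulfI al_neq0); rewrite aeta ff1 ff2 adr_eul_f (mulrA al k f) -ek.
  move: (n%:R : S) => nn; ring.
have eQ' : adr eta al = S2 * g1 - S1 * g2 - gg.
  apply: (mulfI al_neq0); rewrite aeta a1 a2 adr_eul_lam; ring.
(* Both products in [line_gcd] enter: the fields contribute -n c and the Euler part [gg] contributes
   -c. Hence the degree on the line is exactly n - deg H, and all roots lie on the curve. *)
have HQ : H * rho (adr eta al) = - (n.+1%:R * c) *: rho f.
  rewrite eQ' !rhoB !rhoM rS1 rS2.
  have -> : rho gg = s2 * b1 - s1 * b2 by exact: rgg.
  rewrite mulrBr eu -natr1 mulrDl mul1r opprD scalerDl -eQ scaleNr.
  congr (_ - _); move: (rho g1) (rho g2) => x1 x2; ring.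
have cn : - (n.+1%:R * c) != 0 by rewrite oppr_eq0 mulf_neq0.
have inD1 : inD f th1 by exists (- g1); rewrite ff1 mulNr.
have inD2 : inD f th2 by exists (- g2); rewrite ff2 mulNr.
split=> //.
- by split=> //; rewrite -dm leq_addl.
- by split=> //; exists ke.
- split.
    have Q0 : rho (adr eta al) != 0.
      apply/eqP => Q0; move/eqP: HQ; rewrite Q0 mulr0 eq_sym scaler_eq0 (negPf cn) /=.
      by rewrite -size_poly_eq0 (size_rho hf f0).
    have := congr1 (fun p : {poly K} => size p) HQ; rewrite /= size_scale // size_mul // (size_rho hf f0).
    move: H0 Q0 dm; rewrite -!size_poly_gt0; case: (size H) => // h _; case: (size _) => // q _ /=; lia.
  move=> T rT; have := rootM H (rho (adr eta al)) T; rewrite rT orbT HQ rootZ //.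
- move=> th M hth iD; apply: (@generation m eta S1 S2 gg s1 s2 H) => //; by rewrite -?rS1 -?rS2.
move=> e c1 c2 c3 rel.
(* Multiplying by [al] eliminates [eta]. Applied to [F], the result loses its Euler coefficient;
   independence of [th1], [th2] gives the rest. *)
have rel' i : (al * e - c3 * gg) * 'X_i + (al * c1 + c3 * S2) * th1 i + (al * c2 - c3 * S1) * th2 i = 0.
  have := congr1 (fun x => al * x) (rel i); rewrite mulr0 /= => <-.
  have := eeta i; move: ('X_i : S) (th1 i) (th2 i) (eta i) => x y z t E.
  rewrite [RHS](_ : _ = al * e * x + al * c1 * y + al * c2 * z + c3 * (al * t)); last by ring.
  have -> : al * t = S2 * y - S1 * z - gg * x by rewrite E [RHS]addrC addKr.
  ring.
have xE : al * e - c3 * gg = 0.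
  have : adr (fun=> 0) F = (al * e - c3 * gg) * adr (@eul K) F + (al * c1 + c3 * S2) * adr th1 F + (al * c2 - c3 * S1) * adr th2 F.
    by apply: adr_lin3 => i; rewrite -[eul K i]/('X_i : S) rel'.
  rewrite F1 F2 !mulr0 !addr0 {1}/adr big1 => [|i _]; last by rewrite mul0r.
  move/esym/eqP; rewrite adr_eul_F mulf_eq0 mulf_eq0 -(rmorph_nat (@mpolyC 3 K)) mpolyC_eq0 (negPf (char0 n)) /=.
  by case: F_red => /negPf -> _; rewrite orbF => /eqP.
have [|y1 y2] := ind12 (a1 := al * c1 + c3 * S2) (a2 := al * c2 - c3 * S1).
  by move=> i; have := rel' i; rewrite xE mul0r add0r.
(* The coprime s_1, s_2 are not both zero, so one of [S1], [S2] is prime to [al], and [al] divides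
   [c3]. *)
have [t et] : exists t, c3 = al * t.
  have [s0|s0] := eqVneq s1 0.
    have : s2 != 0 by apply: contraTneq cop => s20; rewrite s0 s20 coprime0p -size_poly_eq1 size_poly0.
    rewrite -rS2 => ns2; have P : exists G, c3 * S2 = al * G.
      by exists (- c1); apply/eqP; rewrite mulrN -addr_eq0 addrC y1.
    case: (lam_prime BD P) => [[G ->]|[G eG]]; first by exists G.
    by case/eqP: ns2; rewrite eG rhoM rho_al mul0r.
  rewrite -rS1 in s0; have P : exists G, c3 * S1 = al * G.
    by exists c2; apply/eqP; rewrite eq_sym -subr_eq0 y2.
  case: (lam_prime BD P) => [[G ->]|[G eG]]; first by exists G.
  by case/eqP: s0; rewrite eG rhoM rho_al mul0r.
exists t; split; last by rewrite et mulrC.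
  apply: (mulfI al_neq0); apply/eqP; rewrite -subr_eq0 -y1 et; apply/eqP; ring.
apply: (mulfI al_neq0); apply/eqP; rewrite -subr_eq0 -y2 et; apply/eqP; ring.
Qed.
End Structure.

(** * Comparison with free and plus-one generators *)

Section Cases.
Variable K : closedFieldType.
Hypothesis char0 : forall n, n.+1%:R != 0 :> K.
Notation S := {mpoly K[3]}.
Notation der := ('I_3 -> S).

Definition fam2 T (x y : T) (j : 'I_2) : T := if j == ord0 then x else y.
Definition fam3 T (x y z : T) (j : 'I_3) : T := match val j with 0 => x | 1 => y | _ => z end.

Lemma lcomb2 (c : 'I_2 -> S) (x y : der) i :
  lcomb c (fam2 x y) i = c ord0 * x i + c ord_max * y i.
Proof.
rewrite /lcomb big_ord_recl big_ord1 /fam2 /=; congr (_ + _ * _); congr (c _); exact: val_inj.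
Qed.

Lemma lcomb3 (c : 'I_3 -> S) (x y z : der) i :
  lcomb c (fam3 x y z) i = c e0 * x i + c e1 * y i + c e2 * z i.
Proof. by rewrite /lcomb sum3. Qed.

Lemma gh_const M d (c : S) : gh M d c -> c.@[fun=> 0] != 0 ->
  exists2 k, k != 0 & c = k%:MP.
Proof.
move=> g c0; have e := gh_at0 g c0; move: g; rewrite e => -[c00|[k ek hc]].
  by case/eqP: c0; rewrite c00 meval0.
have k0 : k = 0%N by apply/eqP; rewrite -(eqn_add2l d) ek addn0.
rewrite k0 in hc; have [x ex] := homog0_const hc; exists x => //.
by move: c0; rewrite ex mevalC.
Qed.

Lemma ord2P (P : 'I_2 -> Prop) : P ord0 -> P ord_max -> forall i, P i.
Proof.
move=> h0 h1 [[|[|//]] hi].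
- by have -> : Ordinal hi = ord0 by apply: val_inj.
- by have -> : Ordinal hi = ord_max by apply: val_inj.
Qed.

Lemma perm2_cases (s : 'S_2) (T : Type) (x y : T) : 
  (fam2 x y (s ord0) = x /\ fam2 x y (s ord_max) = y) \/ (fam2 x y (s ord0) = y /\ fam2 x y (s ord_max) = x).
Proof.
have : s ord0 != s ord_max by rewrite (inj_eq perm_inj).
by move: (s ord0) (s ord_max); apply: ord2P; apply: ord2P => // _; [left|right].
Qed.

Variables (n : nat) (f : S).
Hypothesis hf : f \is n.+1.-homog.
Hypothesis f0 : f != 0.

Lemma eul_f : adr (@eul K) f = n.+1%:R * f. Proof. exact: euler hf. Qed.

Lemma eul_coef (e : S) (z : der) : adr z f = 0 -> (forall i, e * 'X_i + z i = 0) -> e = 0.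
Proof.
move=> z0 h; have : adr (fun=> 0) f = e * adr (@eul K) f + adr z f.
  rewrite /adr mulr_sumr -big_split; apply: eq_bigr => i _ /=.
  by rewrite /eul -(h i) mulrDl mulrA.
rewrite z0 addr0 {1}/adr big1 => [|i _]; last by rewrite mul0r.
rewrite eul_f => /esym/eqP; rewrite mulf_eq0 mulf_eq0 -(rmorph_nat (@mpolyC 3 K)) mpolyC_eq0.
by rewrite (negPf (char0 n)) (negPf f0) /= orbF => /eqP.
Qed.

Lemma free_gens (x y : der) dx dy : homd x dx -> homd y dy -> adr x f = 0 -> adr y f = 0 ->
  (forall th, adr th f = 0 -> exists a b, forall i, th i = a * x i + b * y i) ->
  (forall a b, (forall i, a * x i + b * y i = 0) -> a = 0 /\ b = 0) ->
  gens f (fam2 x y) (fam2 dx dy) /\ minrel (fam2 x y).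
Proof.
move=> hx hy fx fy gen ind; split.
  split; try by apply: ord2P.
  - by apply: ord2P; [exists 0|exists 0]; rewrite mul0r.
  move=> th M hth [k ek].
  pose nV : S := ((n.+1%:R)^-1)%:MP.
  have nVE : nV * n.+1%:R = 1.
    by rewrite /nV -(rmorph_nat (@mpolyC 3 K)) -mpolyCM mulVf // mpolyC1.
  pose th' : der := fun i => th i - nV * k * 'X_i.
  have e' : adr th' f = adr th f - nV * k * adr (@eul K) f.
    rewrite /adr mulr_sumr -sumrB; apply: eq_bigr => i _; by rewrite /th' mulrBl !mulrA.
  have [|a [b eab]] := gen th'.
    rewrite e' ek eul_f; apply/eqP; rewrite subr_eq0 (mulrC nV) mulrA -(mulrA k) nVE mulr1 //.
  exists (nV * k), (fam2 a b) => i; rewrite lcomb2 /fam2 /= -eab /th'.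
  by rewrite [RHS]addrC subrK.
move=> e c rel.
have fc : adr (lcomb c (fam2 x y)) f = 0.
  have -> : adr (lcomb c (fam2 x y)) f = c ord0 * adr x f + c ord_max * adr y f.
    rewrite /adr !mulr_sumr -big_split; apply: eq_bigr => i _ /=.
    by rewrite lcomb2 mulrDl !mulrA.
  by rewrite fx fy !mulr0 addr0.
have ez := eul_coef fc rel.
have [|c0 c1] := ind (c ord0) (c ord_max).
  by move=> i; have := rel i; rewrite ez mul0r add0r lcomb2.
by apply: ord2P; rewrite ?c0 ?c1 meval0.
Qed.

Lemma principal_gens (x y z : der) dy dz k (a b c : S) : k != 0 ->
  (forall i, k%:MP * x i = a * 'X_i + b * y i + c * z i) ->
  homd y dy -> homd z dz -> inD f y -> inD f z ->
  (forall th M, homd th M -> inD f th -> exists e c1 c2 c3, forall i,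
     th i = e * 'X_i + c1 * x i + c2 * y i + c3 * z i) ->
  gens f (fam2 y z) (fam2 dy dz).
Proof.
move=> k0 e hy hz iy iz gen; split; try by apply: ord2P.
move=> th M hth ith; have [u [c1 [c2 [c3 E]]]] := gen th M hth ith.
pose kV : S := (k^-1)%:MP.
have kVE : kV * k%:MP = 1 by rewrite /kV -mpolyCM mulVf // mpolyC1.
exists (u + c1 * kV * a), (fam2 (c2 + c1 * kV * b) (c3 + c1 * kV * c)) => i.
rewrite lcomb2 /fam2 /= E.
have -> : c1 * x i = c1 * kV * (a * 'X_i + b * y i + c * z i).
  by rewrite -e mulrA -(mulrA c1) kVE mulr1.
move: ('X_i : S) (y i) (z i) => p q r; ring.
Qed.

Variables (th1 th2 eta : der) (d1 d2 m : nat) (S1 S2 gg al : S).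
Hypotheses (al0 : al != 0) (hal : al \is 1.-homog).
Hypotheses (h1 : homd th1 d1) (h2 : homd th2 d2) (heta : homd eta m).
Hypotheses (i1 : inD f th1) (i2 : inD f th2) (ieta : inD f eta).
Hypotheses (gS1 : gh m.+1 d2 S1) (gS2 : gh m.+1 d1 S2).
Hypothesis eeta : forall i, S2 * th1 i - S1 * th2 i = gg * 'X_i + al * eta i.
Hypothesis gen : forall th M, homd th M -> inD f th -> exists e c1 c2 c3, forall i,
  th i = e * 'X_i + c1 * th1 i + c2 * th2 i + c3 * eta i.
Hypothesis rel : forall e c1 c2 c3, (forall i, e * 'X_i + c1 * th1 i + c2 * th2 i + c3 * eta i = 0) ->
  exists t, [/\ c1 = - (t * S2), c2 = t * S1 & c3 = t * al].

Notation g3 := (fam3 th1 th2 eta).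
Notation dg3 := (fam3 d1 d2 m).

Lemma gens3 : gens f g3 dg3.
Proof.
split; try by apply: ord3P.
move=> th M hth ith; have [u [c1 [c2 [c3 E]]]] := gen hth ith.
by exists u, (fam3 c1 c2 c3) => i; rewrite lcomb3 /= E !addrA.
Qed.

(** The coefficients of the only syzygy are multiples of [S2], [S1] and [al]. If [S2] or [S1] is
    nonzero at the origin, it is a constant, which fixes a degree and eliminates [th1] or [th2];
    otherwise all coefficients vanish at the origin. *)
Lemma syzygy_cases : [\/ d1 = m.+1 /\ gens f (fam2 th2 eta) (fam2 d2 m) /\ minrel (fam2 th2 eta),
   d2 = m.+1 /\ gens f (fam2 th1 eta) (fam2 d1 m) /\ minrel (fam2 th1 eta) | minrel g3].
Proof.
have [z2|z2] := eqVneq S2.@[fun=> 0] 0; last first.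
  have [k k0 ek] := gh_const gS2 z2; apply: Or31; split; first by rewrite (gh_at0 gS2 z2).
  split.
    apply: (@principal_gens th1 th2 eta d2 m k gg S1 al) => //.
    move=> i; rewrite -ek; have := eeta i; move: ('X_i : S) (th1 i) (th2 i) (eta i) => p q r s E.
    by rewrite -[LHS](subrK (S1 * r)) E; ring.
  move=> e c rc; have [|t [t1 t2 t3]] := @rel e 0 (c ord0) (c ord_max).
    by move=> i; have := rc i; rewrite lcomb2 mul0r addr0 addrA.
  have t0 : t = 0.
    move/eqP: t1; rewrite eq_sym oppr_eq0 mulf_eq0 => /orP[/eqP //|/eqP s20].
    by move: z2; rewrite s20 meval0 eqxx.
  by apply: ord2P; rewrite ?t2 ?t3 t0 mul0r meval0.
have [z1|z1] := eqVneq S1.@[fun=> 0] 0; last first.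
  have [k k0 ek] := gh_const gS1 z1; apply: Or32; split; first by rewrite (gh_at0 gS1 z1).
  split.
    apply: (@principal_gens th2 th1 eta d1 m k (- gg) S2 (- al)) => //.
      move=> i; rewrite -ek; have := eeta i; move: ('X_i : S) (th1 i) (th2 i) (eta i) => p q r s E.
      have -> : S1 * r = S2 * q - (S2 * q - S1 * r) by ring.
      rewrite E; ring.
    move=> th M hth ith; have [u [c1 [c2 [c3 E]]]] := gen hth ith.
    exists u, c2, c1, c3 => i; rewrite E; move: ('X_i : S) (th1 i) (th2 i) (eta i) => p q r s; ring.
  move=> e c rc; have [|t [t1 t2 t3]] := @rel e (c ord0) 0 (c ord_max).
    by move=> i; have := rc i; rewrite lcomb2 mul0r addr0 addrA.
  have t0 : t = 0.
    move/eqP: t2; rewrite eq_sym mulf_eq0 => /orP[/eqP //|/eqP s20].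
    by move: z1; rewrite s20 meval0 eqxx.
  by apply: ord2P; rewrite ?t1 ?t3 t0 mul0r ?oppr0 meval0.
apply: Or33 => e c rc; have [|t [t1 t2 t3]] := @rel e (c e0) (c e1) (c e2).
  by move=> i; have := rc i; rewrite lcomb3 !addrA.
apply: ord3P; rewrite ?t1 ?t2 ?t3 ?mevalN !mevalM ?z1 ?z2 ?(homog_at0 hal) mulr0 ?oppr0 //.
Qed.

Theorem free_case (x y : der) dx dy : gens f (fam2 x y) (fam2 dx dy) -> minrel (fam2 x y) ->
  (d1 = m.+1 /\ ((dx = d2 /\ dy = m) \/ (dx = m /\ dy = d2))) \/
  (d2 = m.+1 /\ ((dx = d1 /\ dy = m) \/ (dx = m /\ dy = d1))).
Proof.
move=> hg hm; case: syzygy_cases => [[ed [hg' hm']]|[ed [hg' hm']]|hm3].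
- left; split=> //; have [s hs] := gens_perm hg' hg hm'.
  have := hs ord0; have := hs ord_max; rewrite /fam2 /= -/(fam2 d2 m _) -/(fam2 d2 m _) => -> ->.
  by case: (perm2_cases s d2 m) => -[-> ->]; [left|right].
- right; split=> //; have [s hs] := gens_perm hg' hg hm'.
  have := hs ord0; have := hs ord_max; rewrite /fam2 /= -/(fam2 d1 m _) -/(fam2 d1 m _) => -> ->.
  by case: (perm2_cases s d1 m) => -[-> ->]; [left|right].
- by have := gens_le gens3 hg hm3.
Qed.

Section PlusOne.
Variables (g : 'I_3 -> der) (dg : 'I_3 -> nat) (r0 : S) (r : 'I_3 -> S).
Hypothesis hg : gens f g dg.
Hypothesis r_rel : forall i, r0 * 'X_i + lcomb r g i = 0.
Hypotheses (r2 : r e2 != 0) (hr2 : r e2 \is 1.-homog).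
Hypothesis g_rel : forall (e : S) (c : 'I_3 -> S), (forall i, e * 'X_i + lcomb c g i = 0) ->
  exists t, e = t * r0 /\ forall j, c j = t * r j.
Hypothesis g_min : forall j, ~ exists (e : S) (c : 'I_3 -> S), c j = 0 /\
  forall i, g j i = e * 'X_i + lcomb c g i.

(** The homogeneous part of the relation in degree [(dg e2).+1] is again a relation, hence a
    multiple t of it; the last coefficient has degree 1 and survives unchanged, so t = 1. *)
Lemma rel_homog j : gh (dg e2).+1 (dg j) (r j).
Proof.
have [hd _ _] := hg; set M := (dg e2).+1.
have z : homd (fun=> 0 : S) M by move=> i; exact: dhomog0.
have E := graded_lcomb hd z (fun i => esym (r_rel i)).
have [t [_ et]] := g_rel (fun i => esym (E i)).
have e2' : gpart M (dg e2) (r e2) = r e2.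
  by rewrite /gpart /M leqnSn subSnn pihomog_dE.
have t1 : t = 1.
  by apply: (mulIf r2); rewrite mul1r -et e2'.
by have := gpart_gh M (dg j) (r j); rewrite et t1 mul1r.
Qed.

(** A coefficient of the relation that is nonzero at the origin would be a constant, and its
    generator could be expressed by the others. *)
Lemma plus_one_minrel : minrel g.
Proof.
move=> e c rc j; have [t [_ ->]] := g_rel rc; rewrite mevalM.
have [->|nz] := eqVneq (r j).@[fun=> 0] 0; first by rewrite mulr0.
have [k k0 ek] := gh_const (rel_homog j) nz; exfalso; apply: (g_min (j := j)).
pose kV : S := (k^-1)%:MP.
have kVE : kV * k%:MP = 1 by rewrite /kV -mpolyCM mulVf // mpolyC1.
exists (- kV * r0), (fun l => if l == j then 0 else - kV * r l); split=> [|i]; first by rewrite eqxx.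
have E := r_rel i; rewrite /lcomb (bigD1 j) //= ek in E.
rewrite /lcomb (bigD1 j) //= eqxx mul0r add0r.
have -> : \sum_(l < 3 | l != j) (if l == j then 0 else - kV * r l) * g l i =
    - kV * \sum_(l < 3 | l != j) r l * g l i.
  by rewrite mulr_sumr; apply: eq_bigr => l /negPf ->; rewrite mulrA.
move: (\sum_(l < 3 | _) _) ('X_i : S) E => w p E.
have {}E : k%:MP * g j i = - (r0 * p) - w by apply/eqP; rewrite -subr_eq0 -E; apply/eqP; ring.
rewrite -[LHS]mul1r -kVE -mulrA E; ring.
Qed.

(** Minimality alone matches degrees only up to a permutation. That the level belongs to [eta]
    follows from the syzygies, of degrees m + 1 and [(dg e2).+1], whose last coefficients both have
    degree 1. *)
Theorem plus_one_case : dg e2 = m /\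
  ((dg e0 = d1 /\ dg e1 = d2) \/ (dg e0 = d2 /\ dg e1 = d1)).
Proof.
have mg := plus_one_minrel.
case: syzygy_cases => [[_ [hg' _]]|[_ [hg' _]]|m3]; try by have := gens_le hg hg' mg.
have [s hs] := gens_perm gens3 hg m3.
have [M [gM hM]] := gens_matrix gens3 hg; have [N [gN hN]] := gens_matrix hg gens3.
have [dM dN] := minrel_det_neq0 hM hN m3.
have row_neq0 (A : 'M[S]_3) (v : 'rV[S]_3) : \det A != 0 -> v != 0 -> v *m A != 0.
  move=> dA; apply: contraNneq => vA; have := congr1 (fun w => w *m \adj A) vA.
  rewrite mul0mx -mulmxA mul_mx_adj mul_mx_scalar => e; apply/eqP/rowP => j.
  by have /eqP := congr1 (fun w : 'rV[S]_3 => w 0 j) e; rewrite !mxE mulf_eq0 (negPf dA) => /eqP.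
have lcE (c : 'I_3 -> S) h i : lcomb c h i = lcomb ((\row_j c j) 0) h i.
  by apply: eq_bigr => j _; rewrite mxE.
(* The generating syzygy of each family is mapped to a multiple of the other one. *)
have le1 : (dg e2 < m.+1)%N.
  pose sg := \row_j fam3 (- S2) S1 al j.
  have sg0 : sg != 0 by apply/eqP => /matrixP /(_ 0 e2); rewrite !mxE /fam3 /=; apply/eqP.
  have [e E] := lcomb_trans hN sg.
  have [|t [_ et]] := g_rel (e := gg + e) (c := (sg *m N) 0).
    move=> i; rewrite mulrDl -addrA -E -lcE lcomb3 /fam3 /=.
    have := eeta i; move: ('X_i : S) (th1 i) (th2 i) (eta i) => p q u v Ei.
    have -> : gg * p + (- S2 * q + S1 * u + al * v) = (gg * p + al * v) - (S2 * q - S1 * u) by ring.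
    by rewrite Ei subrr.
  have t0 : t != 0.
    apply/eqP => t0; have := row_neq0 N sg dN sg0; case/eqP; apply/rowP => j.
    by rewrite et t0 mul0r mxE.
  have gz : gh m.+1 (dg e2) ((sg *m N) 0 e2).
    rewrite mxE; apply: gh_sum => j; apply: (gh_mul (d := dg3 j)) (gN j e2); rewrite mxE.
    move: j; apply: ord3P; rewrite /fam3 //=; last by right; exists 1%N; rewrite ?addn1.
    by case: gS2 => [->|[k ek hk]]; [left; rewrite oppr0|right; exists k; rewrite ?rpredN].
  exact: dvd_homog1 t0 r2 hr2 gz (et e2).
have le2 : (m < (dg e2).+1)%N.
  pose rr := \row_j r j.
  have rr0 : rr != 0 by apply/eqP => /matrixP /(_ 0 e2); rewrite !mxE; apply/eqP.
  have [e E] := lcomb_trans hM rr.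
  have [|t [t1 t2 t3]] := @rel (r0 + e) ((rr *m M) 0 e0) ((rr *m M) 0 e1) ((rr *m M) 0 e2).
    move=> i; have Ei := E i; rewrite lcomb3 -lcE in Ei; have := r_rel i; rewrite Ei.
    move: ('X_i : S) (th1 i) (th2 i) (eta i) => p q u v <-; ring.
  have t0 : t != 0.
    apply/eqP => t0; have := row_neq0 M rr dM rr0; case/eqP; apply/rowP; rewrite t0 in t1 t2 t3.
    by apply: ord3P; rewrite ?t1 ?t2 ?t3 !mul0r ?oppr0 mxE.
  have gz : gh (dg e2).+1 m ((rr *m M) 0 e2).
    rewrite mxE; apply: gh_sum => j; apply: (gh_mul (d := dg j)) (gM j e2); rewrite mxE.
    exact: rel_homog.
  exact: dvd_homog1 t0 al0 hal gz t3.
have em : dg e2 = m by apply/eqP; rewrite eqn_leq -ltnS le1 -ltnS le2.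
split=> //; move: em; rewrite !hs.
(* The permutation may still move [e2] when degrees coincide; [em] then restores the remaining
   pair. *)
have : s e0 != s e1 /\ (s e0 != s e2 /\ s e1 != s e2) by rewrite !(inj_eq perm_inj).
move: (s e0) (s e1) (s e2); apply: ord3P; apply: ord3P; apply: ord3P => //= -[? [? ?]] // em.
all: rewrite /fam3 /= in em *; rewrite ?em; by [left|right].
Qed.
End PlusOne.
End Cases.

(** * Exponents and level of the deleted curve *)

Section Final.
Variables (f al : {mpoly K[3]}) (n d1 d2 : nat).
Hypotheses (hf : f \is n.+1.-homog) (f_red : reduced f) (al0 : al != 0) (hal : al \is 1.-homog).
Hypotheses (f_al : ~ exists g, f = al * g) (F_red : reduced (f * al)).
Hypothesis free : free_with_exponents (f * al) d1 d2.

Lemma free_structure : exists (th1 th2 eta : der) m S1 S2 gg,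
  [/\ [/\ gh m.+1 d2 S1, gh m.+1 d1 S2 & forall i, S2 * th1 i - S1 * th2 i = gg * 'X_i + al * eta i],
   [/\ homd th1 d1, homd th2 d2, homd eta m & [/\ inD f th1, inD f th2 & inD f eta]],
   forall th M, homd th M -> inD f th -> exists e c1 c2 c3, forall i,
         th i = e * 'X_i + c1 * th1 i + c2 * th2 i + c3 * eta i,
   forall e c1 c2 c3, (forall i, e * 'X_i + c1 * th1 i + c2 * th2 i + c3 * eta i = 0) ->
         exists t, [/\ c1 = - (t * S2), c2 = t * S1 & c3 = t * al] &
   d1 + d2 = n.+1 /\ (npts f al)%:Z + eps f al = n.+1%:Z - m%:Z].
Proof.
have [th1 [th2 [[h1 h2] [F1 F2] gen12 ind12]]] := free.
have [B [D [BD eal f0 lw]]] := generic_frame al0 hal hf f_al h1 h2.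
move: (f_al) (F_red) F1 F2 gen12 lw (al0) (hal); rewrite -eal.
move=> f_al' F_red' F1 F2 gen12 lw _ _.
have [dn [m [eta [S1 [S2 [gg [[mn gS1 gS2 eeta] [heta i1 i2 ieta] [sQ rQ] gen rel]]]]]]] :=
  structure K_char0 BD hf f0 F_red' h1 h2 F1 F2 gen12 ind12 (lw th1 (or_introl erefl)) (lw th2 (or_intror erefl)).
exists th1, th2, eta, m, S1, S2, gg; split=> //; split=> //.
have [ke eke] := ieta.
have hQ : adr eta (lam D e1) \is m.-homog.
  by have := adr_homog heta (lam_homog D e1); rewrite addn0.
have Q0 : ry (psi B (adr eta (lam D e1))) != 0 by rewrite -size_poly_gt0 [size _]sQ.
rewrite (npts_eps BD hf f_red f0 eke hQ _ Q0 rQ) ?[size _]sQ //.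
move=> th M hth ith; have [e [c1 [c2 [c3 E]]]] := gen th M hth ith.
have [g1 eg1 _] := adr_al BD f0 F1; have [g2 eg2 _] := adr_al BD f0 F2.
(* The Euler field, [th1] and [th2] map the equation of the line to multiples of itself, so modulo
   it only [eta] contributes. *)
exists c3, (e + c1 * g1 + c2 * g2).
have -> : adr th (lam D e1) = e * adr (@eul K) (lam D e1) + c1 * adr th1 (lam D e1)
    + c2 * adr th2 (lam D e1) + c3 * adr eta (lam D e1).
  rewrite /adr !mulr_sumr -!big_split; apply: eq_bigr => i _ /=.
  by rewrite E !mulrDl !mulrA.
rewrite adr_eul_lam eg1 eg2; move: (adr eta (lam D e1)) (lam D e1) => x y; ring.
Qed.

Lemma free_exponents (e2 e3 : nat) : free_with_exponents f e2 e3 ->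
  exists u v : nat, [/\ unord_eq u v d1 d2, unord_eq e2 e3 u (v%:Z - 1) &
    (npts f al)%:Z + eps f al = u%:Z + 1].
Proof.
move=> [x [y [[hx hy] [fx fy] gen' ind']]].
have [th1 [th2 [eta [m [S1 [S2 [gg [[gS1 gS2 eeta] [h1 h2 heta [i1 i2 ieta]] gen rel [dn ne]]]]]]]]] :=
  free_structure.
have f0 : f != 0 by case: f_red.
have [gxy mxy] := free_gens K_char0 hf f0 hx hy fx fy gen' ind'.
case: (free_case hal h1 h2 heta i1 i2 ieta gS1 gS2 eeta gen rel gxy mxy) => -[ed cs].
(* Here d1 = m + 1, so n + 1 - m = d1 + d2 - m = d2 + 1, and d1 is the exponent lowered by one. *)
- exists d2, d1; split; first by right.
    by case: cs => -[-> ->]; [left|right]; split=> //; rewrite ed; lia.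
  by rewrite ne; lia.
- exists d1, d2; split; first by left.
    by case: cs => -[-> ->]; [left|right]; split=> //; rewrite ed; lia.
  by rewrite ne; lia.
Qed.

Lemma plus_one_exponents (th2 th3 psi : der) (k2 k3 lev : nat) :
  plus_one_generated_data f th2 th3 psi k2 k3 lev ->
  unord_eq k2 k3 d1 d2 /\ lev%:Z = n.+1%:Z - (npts f al)%:Z - eps f al.
Proof.
move=> [[h2' [h3' hpsi]] inDg gen' min' [r [r3 hr3 rrel runiq]]].
have [th1 [th2' [eta [m [S1 [S2 [gg [[gS1 gS2 eeta] [h1 h2 heta [i1 i2 ieta]] gen rel [dn ne]]]]]]]]] :=
  free_structure.
have e3E : inord 3 = lift ord0 e2 :> 'I_4 by apply: val_inj; rewrite /= inordK.
pose g := fam3 th2 th3 psi.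
have gE j : pog_gens th2 th3 psi (lift ord0 j) = g j by move: j; apply: ord3P.
have lE (a : 'I_4 -> {mpoly K[3]}) i :
    lincomb (pog_gens th2 th3 psi) a i = a ord0 * 'X_i + lcomb (fun j => a (lift ord0 j)) g i.
  rewrite /lincomb big_ord_recl; congr (_ + _); apply: eq_bigr => j _; rewrite -gE.
have hg : gens f g (fam3 k2 k3 lev).
  split.
  - by apply: ord3P.
  - by move=> j; rewrite -gE; exact: inDg.
  - move=> th M _ ith; have [a ha] := gen' th ith.
    by exists (a ord0), (fun j => a (lift ord0 j)) => i; rewrite ha lE.
pose ext (e : {mpoly K[3]}) (c : 'I_3 -> {mpoly K[3]}) (j : 'I_4) := oapp c e (unlift ord0 j).
have ext0 e c : ext e c ord0 = e by rewrite /ext unlift_none.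
have extS e c j : ext e c (lift ord0 j) = c j by rewrite /ext liftK.
have lext e c i : lincomb (pog_gens th2 th3 psi) (ext e c) i = e * 'X_i + lcomb c g i.
  by rewrite lE ext0; congr (_ + _); apply: eq_bigr => j _; rewrite extS.
have f0 : f != 0 by case: f_red.
rewrite e3E in r3 hr3.
have rrel' i : r ord0 * 'X_i + lcomb (fun j => r (lift ord0 j)) g i = 0.
  by rewrite -lE; exact: rrel.
have runiq' (e : {mpoly K[3]}) (c : 'I_3 -> {mpoly K[3]}) : (forall i, e * 'X_i + lcomb c g i = 0) ->
    exists t, e = t * r ord0 /\ forall j, c j = t * r (lift ord0 j).
  move=> h; have [|t ht] := runiq (ext e c); first by move=> i; rewrite lext.
  by exists t; split=> [|j]; rewrite -ht ?ext0 ?extS.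
have gmin' j : ~ exists (e : {mpoly K[3]}) (c : 'I_3 -> {mpoly K[3]}), c j = 0 /\
    forall i, g j i = e * 'X_i + lcomb c g i.
  move=> [e [c [cj h]]]; apply: (min' (lift ord0 j)); exists (ext e c); rewrite extS; split=> // i.
  by rewrite lext -h gE.
have [em cs] := plus_one_case al0 hal h1 h2 heta i1 i2 ieta gS1 gS2 eeta gen rel hg rrel' r3 hr3 runiq' gmin'.
rewrite /fam3 /= in em cs; split; last by rewrite em; lia.
by case: cs => -[-> ->]; [left|right].
Qed.
End Final.

Theorem theorem3p2 (f' alpha : {mpoly K[3]}) (n' d2 d3 : nat) :
  (0 < n')%N -> f' \is n'.-homog -> reduced f' ->
  alpha != 0 -> alpha \is 1.-homog -> ~ (exists g, f' = alpha * g) ->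
  reduced (f' * alpha) ->
  free_with_exponents (f' * alpha) d2 d3 ->
  (forall e2 e3 : nat, free_with_exponents f' e2 e3 ->
     exists u v : nat,
       [/\ unord_eq u v d2 d3,
           unord_eq e2 e3 u (v%:Z - 1) &
           (npts f' alpha)%:Z + eps f' alpha = u%:Z + 1])
  /\
  (forall (th2 th3 psi : der) (e2 e3 lev : nat),
     plus_one_generated_data f' th2 th3 psi e2 e3 lev ->
     unord_eq e2 e3 d2 d3 /\
     lev%:Z = n'%:Z - (npts f' alpha)%:Z - eps f' alpha).
Proof.
case: n' => // n _ hf f_red al0 hal f_al F_red free; split.
  by move=> k2 k3; exact: free_exponents hf f_red al0 hal f_al F_red free _ _.
by move=> th2 th3 psi k2 k3 lev; exact: plus_one_exponents hf f_red al0 hal f_al F_red free _ _ _ _ _ _.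
Qed.
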